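(* Suppose that conditions (C1), (C2) and (C4) (stated in the context) hold. Let $\mathbf{Q}_{\rm min}$ be the Yaglom limit of $Z$ and $G_{\mathbf{Q}_{\rm min}}$ its probability generating functional. (1) When $\alpha>1$, there exist no QSDs of $Z$ with eigenvalue $m^{\alpha}$. (2) The only QSD of $Z$ with eigenvalue $m$ is the Yaglom limit $\mathbf{Q}_{\rm min}$. (3) Let $\alpha\in(0,1)$. A probability measure $\mathbf{Q}_{\alpha}$ on $\mathfrak{N}^{\circ}(\mathbb{R})$ is a QSD of $Z$ with eigenvalue $m^{\alpha}$ if and only if its probability generating functional satisfies $$G_{\mathbf{Q}_{\alpha}}[h]=\int_{(0,\infty)}\Big(\mathrm{e}^{(G_{\mathbf{Q}_{\rm min}}[h]-1)x}-\mathrm{e}^{-x}\Big)\frac{1}{x^{\alpha}}\,\Delta(\mathrm{d}x),\quad h\in\mathcal{V}_0(\mathbb{R}),$$ where $\Delta$ is a locally finite measure on $(0,\infty)$ satisfying: (a) $\Delta(B)=\Delta(mB)$ for every Borel set $B\subset(0,\infty)$; (b) $\int_{(0,\infty)}(1-\mathrm{e}^{-x})x^{-\alpha}\,\Delta(\mathrm{d}x)=1$.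
   Context: Let $\mathbb{N}=\{0,1,2,\dots\}$. Let $p=\{p_j\}_{j\in\mathbb{N}}$ be a probability measure on $\mathbb{N}$ (offspring distribution) with mean $m=\sum_j jp_j$ and generating function $f(s)=\sum_jp_js^j$, and let $P$ be a transition probability (Markov kernel) on $\mathbb{R}$, with $n$-step transition probability $P_n$; write $P_nh(x)=\int h(y)P_n(x,\mathrm{d}y)$. $\mathfrak{N}(\mathbb{R})$ is the space of finite integer-valued Borel measures (finite point measures) on $\mathbb{R}$ with the topology of weak convergence, $\mathbf{0}$ the null measure, $\mathfrak{N}^{\circ}(\mathbb{R})=\mathfrak{N}(\mathbb{R})\setminus\{\mathbf{0}\}$. $\mathcal{B}_b^+(\mathbb{R})$ is the set of bounded nonnegative Borel functions on $\mathbb{R}$; $\mathcal{V}_0(\mathbb{R})$ is the set of Borel functions $h$ on $\mathbb{R}$ with $\inf h>0$ and $h\le1$. Branching Markov chain: under $\mathbb{P}_{\delta_x}$, generation $0$ consists of one particle at $x$. Each particle of generation $n$, independently of the others of its generation, is replaced after one unit of time by a random number of children with law $p$; given that the parent is at $y$, the children are positioned independently according to $P(y,\cdot)$; they form generation $n+1$. For $\mu=\sum_i\delta_{x_i}\in\mathfrak{N}^\circ(\mathbb{R})$, under $\mathbb{P}_\mu$ the system is the union of independent branching Markov chains started from single particles at the $x_i$. $Z_n$ is the counting measure on $\mathbb{R}$ of the positions of the particles of generation $n$, $N_n=Z_n(\mathbb{R})$, $Z=(Z_n)_{n\in\mathbb{N}}$. Conditions. (C1): $0<m<1$ and $p$ has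 finite moments of all orders. (C2): $\limsup_{n\to\infty}(p_n)^{1/n}\in[0,1)$. (C4): there exists a probability measure $\pi$ on $\mathbb{R}$ such that for every $h\in\mathcal{B}_b^+(\mathbb{R})$, $P_nh(x)\to\pi(h):=\int h\,\mathrm{d}\pi$ as $n\to\infty$, uniformly in $x\in\mathbb{R}$. Yaglom limit: under these conditions there is a unique probability measure $\mathbf{Q}_{\rm min}$ on $\mathfrak{N}^{\circ}(\mathbb{R})$ such that $\mathbb{P}_\mu(Z_n\in\cdot\mid N_n>0)\to\mathbf{Q}_{\rm min}$ weakly as $n\to\infty$ for every $\mu\in\mathfrak{N}^\circ(\mathbb{R})$; it is called the Yaglom limit of $Z$. Probability generating functionals: for a probability measure $\mathbf{Q}$ on $\mathfrak{N}(\mathbb{R})$ (or on $\mathfrak{N}^\circ(\mathbb{R})$), $G_{\mathbf{Q}}[h]=\int \mathrm{e}^{\mu(\log h)}\,\mathbf{Q}(\mathrm{d}\mu)$, $h\in\mathcal{V}_0(\mathbb{R})$, where $\mu(g)=\int g\,\mathrm{d}\mu$. Also $G[h](x)=\mathbb{E}_{\delta_x}[\mathrm{e}^{Z_1(\log h)}]$, which maps $\mathcal{V}_0(\mathbb{R})$ into itself. QSD: a probability measure $\mathbf{Q}$ on $\mathfrak{N}^\circ(\mathbb{R})$ is a quasi-stationary distribution (QSD) of $Z$ if $(\mathbf{Q}\mathbb{P})(Z_n\in B\mid N_n>0)=\mathbf{Q}(B)$ for all $n\in\mathbb{N}$ and Borel $B\subset\mathfrak{N}^\circ(\mathbb{R})$,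 where $(\mathbf{Q}\mathbb{P})(\cdot)=\int\mathbb{P}_\mu(\cdot)\,\mathbf{Q}(\mathrm{d}\mu)$. For $\alpha\in(0,\infty)$ it is a QSD with eigenvalue $m^\alpha$ if $G_{\mathbf{Q}}[G[h](\cdot)]-G_{\mathbf{Q}}[f(0)]=m^\alpha G_{\mathbf{Q}}[h]$ for all $h\in\mathcal{V}_0(\mathbb{R})$, where $f(0)$ is viewed as a constant function. Locally finite means finite on compact subsets of $(0,\infty)$; $mB=\{mx:x\in B\}$. *)

(* Defs.v *)
From HB Require Import structures.
From mathcomp Require Import all_boot all_order all_algebra.
From mathcomp Require Import all_classical all_reals all_analysis.

Set Implicit Arguments.
Unset Strict Implicit.
Unset Printing Implicit Defensive.

Import Order.TTheory GRing.Theory Num.Theory.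
Import numFieldNormedType.Exports.

Local Open Scope classical_set_scope.
Local Open Scope ring_scope.

(* Measures of the library are functions on all subsets of R, constrained on
   the Borel sets only. So two inhabitants of [pointMeasure R] that agree on
   Borel sets stand for the same point measure without being Leibniz equal;
   the topology and the sigma-algebra below do not distinguish them. *)
Record pointMeasure (R : realType) := PointMeasure {
  pm_measure :> {finite_measure set (measurableTypeR R) -> \bar R};
  pm_integer : forall A : set (measurableTypeR R), measurable A ->
    exists k : nat, pm_measure A = k%:R%:E }.

Section PointMeasures.
Variable R : realType.
Implicit Types (x : R) (mu nu : pointMeasure R) (s : seq R).

Definition pm_zero : pointMeasure R.
Proof.
exists (@mzero _ (measurableTypeR R) R : {finite_measure set _ -> \bar R}).
by move=> A _; exists 0%N.
Defined.

Definition pm_dirac x : pointMeasure R.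
Proof.
exists (@dirac _ (measurableTypeR R) x R : {finite_measure set _ -> \bar R}).
by move=> A _; exists (x \in A : nat); rewrite /= diracE.
Defined.

Definition pm_add_fun mu nu : set (measurableTypeR R) -> \bar R :=
  measure_add mu nu.

HB.instance Definition _ mu nu := Measure.on (pm_add_fun mu nu).

Let add_fin mu nu : fin_num_fun (pm_add_fun mu nu).
Proof.
move=> A mA; rewrite /pm_add_fun measure_addE fin_numD.
by rewrite !fin_num_measure.
Qed.

HB.instance Definition _ mu nu := Measure_isFinite.Build _ _ _
  (pm_add_fun mu nu) (@add_fin mu nu).

Definition pm_add mu nu : pointMeasure R.
Proof.
exists (pm_add_fun mu nu : {finite_measure set _ -> \bar R}).
move=> A mA; rewrite /= /pm_add_fun measure_addE.
have [k muA] := pm_integer mu mA; have [l nuA] := pm_integer nu mA.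
by exists (k + l)%N; rewrite natrD EFinD -muA -nuA.
Defined.

Definition pm_of_seq s : pointMeasure R :=
  foldr (fun x nu => pm_add (pm_dirac x) nu) pm_zero s.

HB.instance Definition _ := gen_eqMixin (pointMeasure R).
HB.instance Definition _ := gen_choiceMixin (pointMeasure R).
HB.instance Definition _ := isPointed.Build (pointMeasure R) pm_zero.

Definition bounded_continuous :=
  {g : R -> R | continuous g /\ exists M : R, forall x : R, `|g x| <= M}.
HB.instance Definition _ := gen_eqMixin bounded_continuous.
HB.instance Definition _ := gen_choiceMixin bounded_continuous.

Definition pairing mu : {ptws bounded_continuous -> R} :=
  fun g => (\int[mu]_x sval g x).

(* Topology of weak convergence: the coarsest one for which mu |-> mu(g) is
   continuous for every bounded continuous g. *)
HB.instance Definition _ :=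
  Topological.copy (pointMeasure R) (initial_topology pairing).

(* Borel sigma-algebra of this topology. *)
Definition pm_open : set (set (pointMeasure R)) := open.
HB.instance Definition _ := @isMeasurable.Build (sigma_display pm_open)
  (pointMeasure R) <<s pm_open >>
  (@sigma_algebra0 _ setT pm_open) (@sigma_algebraC _ pm_open)
  (@sigma_algebra_bigcup _ setT pm_open).

(* The space of nonnull point measures, as a subset of [pointMeasure R]. It is
   open, so its Borel sets are the Borel sets of [pointMeasure R] which it
   contains. *)
Definition nonnull : set (pointMeasure R) := [set mu | mu setT <> 0%E].

Definition prob_on_nonnull (Q : probability (pointMeasure R) R) : Prop :=
  Q nonnull = 1%E.

Definition V0 : set (R -> R) :=
  [set h | [/\ measurable_fun setT h, 0 < inf (range h)
             & forall x, h x <= 1]].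

Definition pgfl (Q : probability (pointMeasure R) R) (h : R -> R) : R :=
  \int[Q]_mu expR (\int[mu]_x ln (h x)).

End PointMeasures.

Section Conditions.
Variables (R : realType) (p : probability nat R).
Variable P : R.-pker (measurableTypeR R) ~> (measurableTypeR R).

Definition offspring_mass (j : nat) : R := fine (p [set j]).

Definition offspring_mean : R := \int[p]_j j%:R.

Definition offspring_gf (s : R) : R :=
  limn (series (fun j => offspring_mass j * s ^+ j)).

Definition C1 : Prop :=
  0 < offspring_mean < 1 /\
  forall k : nat, (\int[p]_j (j%:R ^+ k)%:E < +oo)%E.

Definition C2 : Prop :=
  (0 <= limn_esup (fun n => (offspring_mass n `^ n%:R^-1)%:E) < 1)%E.

Fixpoint nstep (n : nat) :
    R.-spker (measurableTypeR R) ~> (measurableTypeR R) :=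
  if n is k.+1 then mkcomp_noparam P (nstep k)
  else kdirac (@measurable_id _ (measurableTypeR R) setT).

Definition C4 : Prop :=
  exists pi : probability (measurableTypeR R) R,
    forall h : R -> R, measurable_fun setT h -> (forall x, 0 <= h x) ->
      (exists M : R, forall x, h x <= M) ->
      forall e : R, 0 < e -> \forall n \near \oo, forall x : R,
        `| \int[nstep n x]_y h y - \int[pi]_y h y | < e.

End Conditions.

Section BranchingMarkovChain.
Variables (R : realType) (p : probability nat R).
Variable P : R.-pker (measurableTypeR R) ~> (measurableTypeR R).
Local Open Scope ereal_scope.

(* Expectation of F(delta_{Y_1} + ... + delta_{Y_j}) for Y_1, ..., Y_j
   independent with law P(y, .). *)
Fixpoint siblings_expectation (y : R) (j : nat)
    (F : pointMeasure R -> \bar R) : \bar R :=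
  if j is k.+1 then
    \int[P y]_z siblings_expectation y k
                  (fun nu => F (pm_add (pm_dirac z) nu))
  else F (pm_zero R).

(* Same for a random number of siblings, with law p. *)
Definition offspring_expectation (y : R) (F : pointMeasure R -> \bar R) :
    \bar R :=
  \int[p]_j siblings_expectation y j F.

(* Expectation of F(X_1 + ... + X_k) for independent X_1, ..., X_k, where X_i
   is the offspring of a particle at the i-th point of s. *)
Fixpoint generation_expectation (s : seq R)
    (F : pointMeasure R -> \bar R) : \bar R :=
  if s is x :: s' then
    offspring_expectation x (fun nu =>
      generation_expectation s' (fun nu' => F (pm_add nu nu')))
  else F (pm_zero R).

(* An enumeration, with multiplicities, of the atoms of mu. By independence
   the expectation above does not depend on the order of the points. *)
Definition atoms (mu : pointMeasure R) : seq R :=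
  xget [::] [set s : seq R | forall A : set (measurableTypeR R),
    measurable A -> mu A = pm_of_seq s A].

(* P_mu(Z_1 \in B) *)
Definition transition (mu : pointMeasure R) (B : set (pointMeasure R)) :
    \bar R :=
  generation_expectation (atoms mu) (fun nu => (\1_B nu)%:E).

Variables (d : measure_display) (Omega : measurableType d).
Variable PP : pointMeasure R -> probability Omega R.
Variable Z : nat -> {mfun Omega >-> pointMeasure R}.

(* Under PP mu, the process Z is a Markov chain started from mu with the above
   transition law. *)
Definition branching_markov_chain : Prop :=
  forall mu : pointMeasure R, nonnull mu ->
    (forall B : set (pointMeasure R), measurable B ->
      PP mu (Z 0%N @^-1` B) = \d_mu B) /\
    (forall (n : nat) (B : nat -> set (pointMeasure R)),
      (forall i, measurable (B i)) ->
      PP mu [set w | forall i, (i <= n.+1)%N -> B i (Z i w)] =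
      \int[PP mu]_(w in [set w | forall i, (i <= n)%N -> B i (Z i w)])
        transition (Z n w) (B n.+1)).

End BranchingMarkovChain.

Section QuasiStationarity.
Variables (R : realType) (p : probability nat R).
Variables (d : measure_display) (Omega : measurableType d).
Variable PP : pointMeasure R -> probability Omega R.
Variable Z : nat -> {mfun Omega >-> pointMeasure R}.
Implicit Types Q : probability (pointMeasure R) R.

Definition surviving (n : nat) : set Omega := [set w | nonnull (Z n w)].

Definition yaglom_limit Q : Prop :=
  prob_on_nonnull Q /\
  forall mu, nonnull mu ->
  forall F : pointMeasure R -> R, {within @nonnull R, continuous F} ->
    (exists M : R, forall nu, nonnull nu -> `|F nu| <= M) ->
    (\int[PP mu]_(w in surviving n) F (Z n w)) / fine (PP mu (surviving n))
      @[n --> \oo] --> \int[Q]_(nu in @nonnull R) F nu.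

(* (Q P)(E) *)
Definition mixture Q (E : set Omega) : \bar R :=
  (\int[Q]_(mu in @nonnull R) PP mu E)%E.

(* Since division by 0 gives 0, the case B = nonnull forces the survival
   probability to be positive. *)
Definition is_QSD Q : Prop :=
  prob_on_nonnull Q /\
  forall (n : nat) (B : set (pointMeasure R)), measurable B ->
    B `<=` @nonnull R ->
    fine (mixture Q ((Z n @^-1` B) `&` surviving n)) /
      fine (mixture Q (surviving n)) = fine (Q B).

(* G[h](x) *)
Definition one_step_pgfl (h : R -> R) (x : R) : R :=
  \int[PP (pm_dirac x)]_w expR (\int[Z 1%N w]_y ln (h y)).

(* QSD with eigenvalue m ^ alpha. *)
Definition is_QSD_eigen (alpha : R) Q : Prop :=
  is_QSD Q /\
  forall h : R -> R, V0 h ->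
    pgfl Q (one_step_pgfl h) - pgfl Q (cst (offspring_gf p 0)) =
    offspring_mean p `^ alpha * pgfl Q h.

End QuasiStationarity.

Section ScalingMeasure.
Variable R : realType.

(* Measures on the half line (0, +oo): only the values on Borel subsets of
   it are used. *)
Definition locally_finite (D : {measure set (measurableTypeR R) -> \bar R}) :
    Prop :=
  forall K : set R, compact K -> K `<=` `]0, +oo[ -> (D K < +oo)%E.

Definition scale_invariant (m : R)
    (D : {measure set (measurableTypeR R) -> \bar R}) : Prop :=
  forall B : set (measurableTypeR R), measurable B -> B `<=` `]0, +oo[ ->
    D B = D ( *%R m @` B).

Definition normalized (alpha : R)
    (D : {measure set (measurableTypeR R) -> \bar R}) : Prop :=
  (\int[D]_(x in `]0%R, +oo[) ((1 - expR (- x)) / x `^ alpha)%:E = 1)%E.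

End ScalingMeasure.

(* Main.v *)
Require Import Defs.
From HB Require Import structures.
From mathcomp Require Import all_boot all_order all_algebra.
From mathcomp Require Import all_classical all_reals all_analysis.
From mathcomp Require Import measurable_realfun giry.
From mathcomp Require Import ring lra.

Set Implicit Arguments.
Unset Strict Implicit.
Unset Printing Implicit Defensive.

Import Order.TTheory GRing.Theory Num.Theory.
Import numFieldNormedType.Exports.

Local Open Scope classical_set_scope.
Local Open Scope ring_scope.

(* Put G h = f(P h), so that E_mu[exp(Z_n(log h))] = exp(mu(log(G^n h))) and Q is
   a QSD with eigenvalue lam iff 1 - G_Q[G h] = lam (1 - G_Q[h]) for all h. As f
   has derivative m at 1 and P_n h converges uniformly, m^-n (1 - G^n h) converges
   uniformly to a constant, rate h, and 1 - G_Qmin[h] = rate h / rate 0.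
   Iterating the eigenvalue equation therefore compares lam^n (1 - G_Q[h]) with
   L(m^n rate h), where L(s) = 1 - E_Q[exp(-s N)] is concave: lam < m is
   impossible, and lam = m forces 1 - G_Q[h] to be proportional to rate h.
   For lam = m^alpha with alpha < 1, lam^-n L(m^n rate 0 t) converges to a function
   psi with psi(m t) = lam psi(t), and 1 - G_Q[h] = psi(1 - G_Qmin[h]). With
   x_n = m^n rate 0 N, the measures lam^-n (1 - exp(-x_n)) dQ have limit laws on
   (0, oo) by Helly's selection principle, whose Laplace transform is
   psi(s + 1) - psi(s). Multiplying the limit law by x^alpha / (1 - exp(-x))
   gives Delta; the scaling relation of psi says that Delta and its image under
   x |-> m x have the same moments, hence that they agree. *)

(** * Functional monotone class theorems *)

Section BoundedMeasurable.
Context d (T : measurableType d) (R : realType).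
Implicit Types (f g : T -> R) (mu : {measure set T -> \bar R}).

(** Weak convergence only tests [pmexp h] with h continuous, and neither [rate] nor G_Q is linear in
    h; the formula for G_Qmin therefore reaches Borel h by induction over Baire classes, whereas
    statements linear in the functional go through a monotone class theorem generated by the
    [pmexp h]. The constant 0 is not in [V0], although extinction and the normalisation live there:
    it is approached by the constants 1 / (j + 2), which works because Q does not charge the null
    measure. The limit without weight, x^-alpha Delta(dx), has infinite mass near 0; the weight 1 -
    exp(-x) brings the total mass to one that tends to psi(1) = 1. No mass escapes to infinity
    because psi(0+) = 0, nor to 0 because the increments of psi vanish at infinity; the latter uses
    alpha < 1, through psi(t) = o(t). The eigenvalue equation only sees psi on [0, 1], the range of
    1 - G_Qmin; the scaling relation extends psi to all t >= 0, as the moments require. *)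

Definition bmeas f :=
  measurable_fun setT f /\ exists C : R, forall x, `|f x| <= C.

Lemma bmeas_cst (c : R) : bmeas (fun _ => c).
Proof. by split=> //; exists `|c|. Qed.

Lemma bmeas_lin (a : R) f g : bmeas f -> bmeas g -> bmeas (fun x => a * f x + g x).
Proof.
move=> [mf [C fC]] [mg [D gD]]; split.
  by apply: measurable_funD => //; apply: measurable_funM.
exists (`|a| * C + D) => x; rewrite (le_trans (ler_normD _ _))// normrM.
by rewrite lerD// ler_wpM2l.
Qed.

Lemma bmeasM f g : bmeas f -> bmeas g -> bmeas (fun x => f x * g x).
Proof.
move=> [mf [C fC]] [mg [D gD]]; split; first by apply: measurable_funM.
by exists (C * D) => x; rewrite normrM ler_pM.
Qed.

Lemma bmeasB f g : bmeas f -> bmeas g -> bmeas (fun x => f x - g x).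
Proof.
move=> bf bg; rewrite [X in bmeas X](_ : _ = fun x => -1 * g x + f x).
  exact: bmeas_lin.
by apply/funext => x; rewrite mulN1r addrC.
Qed.

Lemma bmeasD f g : bmeas f -> bmeas g -> bmeas (fun x => f x + g x).
Proof.
move=> bf bg; rewrite [X in bmeas X](_ : _ = fun x => 1 * f x + g x).
  exact: bmeas_lin.
by apply/funext => x; rewrite mul1r.
Qed.

Lemma bmeas_indic (A : set T) : measurable A -> bmeas (\1_A : T -> R).
Proof.
move=> mA; split; first exact: measurable_indic.
by exists 1 => x; rewrite indicE; case: (_ \in _); rewrite ?normr1 ?normr0.
Qed.

Lemma bmeas_cvg (f_ : nat -> T -> R) f (C : R) :
  (forall n, measurable_fun setT (f_ n)) ->
  (forall n x, `|f_ n x| <= C) ->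
  (forall x, f_ n x @[n --> \oo] --> f x) -> bmeas f.
Proof.
move=> mf fC ff; split.
  by apply: (measurable_fun_cvg mf) => x _; exact: ff.
exists C => x; rewrite ler_norml; apply/andP; split.
  apply: (cvgr_to_ge (ff x)).
  by apply: nearW => n; move: (fC n x); rewrite ler_norml => /andP[].
apply: (cvgr_to_le (ff x)).
by apply: nearW => n; move: (fC n x); rewrite ler_norml => /andP[].
Qed.

Section Integral.
Variable mu : {measure set T -> \bar R}.
Hypothesis mufin : (mu setT < +oo)%E.

Lemma bmeas_integrable f : bmeas f -> mu.-integrable setT (EFin \o f).
Proof.
move=> [mf [C fC]]; apply: measurable_bounded_integrable => //.
by exists C; split; [exact: num_real|move=> M CM x _; exact: (le_trans (fC x) (ltW CM))].
Qed.

Lemma Rint_lin (a : R) f g : bmeas f -> bmeas g ->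
  \int[mu]_x (a * f x + g x) = a * \int[mu]_x f x + \int[mu]_x g x.
Proof.
move=> bf bg; rewrite RintegralD//; last exact: bmeas_integrable.
  by rewrite RintegralZl//; exact: bmeas_integrable.
apply: bmeas_integrable.
have := bmeas_lin a bf (bmeas_cst 0).
by congr bmeas; apply/funext => x; rewrite addr0.
Qed.

Lemma RintB f g : bmeas f -> bmeas g ->
  \int[mu]_x (f x - g x) = \int[mu]_x f x - \int[mu]_x g x.
Proof. by move=> bf bg; rewrite RintegralB//; exact: bmeas_integrable. Qed.

Lemma RintD f g : bmeas f -> bmeas g ->
  \int[mu]_x (f x + g x) = \int[mu]_x f x + \int[mu]_x g x.
Proof. by move=> bf bg; rewrite RintegralD//; exact: bmeas_integrable. Qed.

Lemma RintZ (a : R) f : bmeas f -> \int[mu]_x (a * f x) = a * \int[mu]_x f x.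
Proof. by move=> bf; rewrite RintegralZl//; exact: bmeas_integrable. Qed.

Lemma Rint_le f g : bmeas f -> bmeas g -> (forall x, f x <= g x) ->
  \int[mu]_x f x <= \int[mu]_x g x.
Proof. by move=> bf bg fg; apply: le_Rintegral => //; exact: bmeas_integrable. Qed.

Lemma Rint_EFin f : bmeas f -> (\int[mu]_x (f x)%:E = (\int[mu]_x f x)%:E)%E.
Proof.
move=> bf; rewrite /Rintegral fineK//.
exact: (integrable_fin_num measurableT (bmeas_integrable bf)).
Qed.

Lemma Rint_bcvg (f_ : nat -> T -> R) f (C : R) :
  (forall n, measurable_fun setT (f_ n)) ->
  (forall n x, `|f_ n x| <= C) ->
  (forall x, f_ n x @[n --> \oo] --> f x) ->
  \int[mu]_x f_ n x @[n --> \oo] --> \int[mu]_x f x.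
Proof.
move=> mf fC ff.
have bf : bmeas f := bmeas_cvg mf fC ff.
apply: fine_cvg; rewrite fineK; last first.
  exact: (integrable_fin_num measurableT (bmeas_integrable bf)).
apply: (@dominated_cvg _ _ _ mu setT measurableT _ _ (cst C%:E)).
- by move=> n; apply/measurable_EFinP; exact: mf.
- by move=> x _; apply: cvg_EFin; [exact: nearW|exact: ff].
- by [].
- exact: (bmeas_integrable (bmeas_cst C)).
- by move=> n x _; rewrite abse_EFin lee_fin.
Qed.

End Integral.
End BoundedMeasurable.
Arguments bmeas_cst {d T R} c.

(** * Classes closed under linear combinations and bounded pointwise limits *)

Section BpClosed.
Variable R : realType.

(** The limits carry a uniform bound, so that dominated convergence applies to every finite
    measure. *)
Definition bp_closed (T : Type) (G : (T -> R) -> Prop) :=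
  (forall (a : R) f g, G f -> G g -> G (fun x => a * f x + g x)) /\
  (forall (f_ : nat -> T -> R) f (C : R), (forall n, G (f_ n)) ->
    (forall n x, `|f_ n x| <= C) ->
    (forall x, f_ n x @[n --> \oo] --> f x) -> G f).

Section BpClosedTheory.
Variables (T : Type) (G : (T -> R) -> Prop).
Hypothesis Gbp : bp_closed G.

Lemma bp_lin (a : R) f g : G f -> G g -> G (fun x => a * f x + g x).
Proof. by apply Gbp.1. Qed.

Lemma bp_lim (f_ : nat -> T -> R) f (C : R) : (forall n, G (f_ n)) ->
    (forall n x, `|f_ n x| <= C) ->
    (forall x, f_ n x @[n --> \oo] --> f x) -> G f.
Proof. by apply Gbp.2. Qed.

Lemma bp_sub f g : G f -> G g -> G (fun x => f x - g x).
Proof.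
move=> Gf Gg; rewrite [X in G X](_ : _ = fun x => -1 * g x + f x).
  exact: bp_lin.
by apply/funext => x; rewrite mulN1r addrC.
Qed.

Lemma bp_zero f : G f -> G (fun=> 0).
Proof. by move=> Gf; have := bp_sub Gf Gf; congr G; apply/funext => x; rewrite subrr. Qed.

Lemma bp_scale (a : R) f : G f -> G (fun x => a * f x).
Proof.
move=> Gf; have := bp_lin a Gf (bp_zero Gf).
by congr G; apply/funext => x; rewrite addr0.
Qed.

Lemma bp_add f g : G f -> G g -> G (fun x => f x + g x).
Proof.
move=> Gf Gg; have := bp_lin 1 Gf Gg.
by congr G; apply/funext => x; rewrite mul1r.
Qed.

Lemma bp_sum (I : Type) (r : seq I) (P : pred I) (F : I -> T -> R) f :
  G f -> (forall i, G (F i)) -> G (fun x => \sum_(i <- r | P i) F i x).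
Proof.
move=> Gf GF; elim: r => [|i r IH].
  rewrite (_ : (fun _ => _) = fun=> 0); first exact: bp_zero Gf.
  by apply/funext => x; rewrite big_nil.
case/boolP: (P i) => Pi.
  rewrite (_ : (fun _ => _) = fun x => F i x + \sum_(i <- r | P i) F i x).
    exact: bp_add.
  by apply/funext => x; rewrite big_cons Pi.
rewrite (_ : (fun _ => _) = fun x => \sum_(i <- r | P i) F i x)//.
by apply/funext => x; rewrite big_cons (negbTE Pi).
Qed.

End BpClosedTheory.
End BpClosed.


Section BpIndic.
Variables (R : realType) (T : Type) (G : (T -> R) -> Prop).
Hypothesis Gbp : bp_closed G.

(** The partial sums of the exponential series are bounded by [expR C]; only the products of [w]
    with powers of [z] enter, since the class need not be closed under multiplication. *)
Lemma bp_expR_powers (w z : T -> R) (C : R) :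
  (forall x, `|w x| <= 1) -> (forall x, `|z x| <= C) ->
  (forall j, G (fun x => w x * z x ^+ j)) -> G (fun x => w x * expR (z x)).
Proof.
move=> w1 zC Gwz.
have ser N x : `|series (exp_coeff (z x)) N| <= expR C.
  have C0 : 0 <= C by exact: le_trans (zC x).
  apply: (@le_trans _ _ (series (exp_coeff C) N)).
    rewrite /series/= (le_trans (ler_norm_sum _ _ _))// ler_sum// => i _.
    rewrite /exp_coeff/= normrM normrX (@ger0_norm _ (_^-1)) ?invr_ge0// ler_wpM2r ?invr_ge0//.
    by rewrite lerXn2r ?nnegrE.
  apply: nondecreasing_cvgn_le; last exact: is_cvg_series_exp_coeff.
  by apply: nondecreasing_series => i _ _; rewrite exp_coeff_ge0.
apply: (bp_lim Gbp (f_ := fun N x => w x * series (exp_coeff (z x)) N)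
  (C := expR C)).
- move=> N; rewrite (_ : (fun _ => _) =
    fun x => \sum_(0 <= i < N) (i`!%:R^-1 * (w x * z x ^+ i))).
    apply: (@bp_sum _ _ _ Gbp _ _ _ _ (fun x => w x * z x ^+ 0)) => // i.
    exact: bp_scale.
  apply/funext => x; rewrite /series/= big_distrr/=; apply: eq_bigr => i _.
  by rewrite /exp_coeff/=; ring.
- by move=> N x; rewrite normrM -[leRHS]mul1r ler_pM.
- move=> x; apply: cvgM; first exact: cvg_cst.
  exact: is_cvg_series_exp_coeff.
Qed.

(** As n grows, exp(-(y / b)^n) tends to 1 where y < b, to exp(-1) where y = b and to 0 where y > b.
    Letting b increase to a removes the middle value and leaves the indicator of y < a. *)
Lemma bp_indic_lt (w y : T -> R) (a : R) : 0 < a ->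
  (forall x, 0 <= w x <= 1) -> (forall x, 0 <= y x <= 1) ->
  (forall j, G (fun x => w x * y x ^+ j)) ->
  G (fun x => w x * (y x < a)%R%:R).
Proof.
move=> a0 w01 y01 Gwy.
have w1 x : `|w x| <= 1 by rewrite ger0_norm; case/andP: (w01 x).
have step b : 0 < b -> G (fun x => w x *
    (if y x < b then 1 else if y x == b then expR (-1) else 0)).
  move=> b0.
  apply: (bp_lim Gbp (f_ := fun n x => w x * expR (- (y x / b) ^+ n)) (C := 1)).
  - move=> n; apply: (@bp_expR_powers _ _ (b^-1 ^+ n)) => //.
      move=> x; rewrite normrN normrX normrM ger0_norm; last by case/andP: (y01 x).
      rewrite gtr0_norm ?invr_gt0// exprMn -[leRHS]mul1r ler_wpM2r ?exprn_ge0 ?invr_ge0 ?(ltW b0)//.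
      by rewrite exprn_ile1//; case/andP: (y01 x).
    move=> j; rewrite (_ : (fun _ => _) =
      fun x => ((- b^-1 ^+ n) ^+ j) * (w x * y x ^+ (n * j))).
      exact: bp_scale.
    apply/funext => x; rewrite exprM exprMn -mulrN exprMn; ring.
  - move=> n x; rewrite normrM -[leRHS]mul1r ler_pM// ger0_norm ?expR_ge0//.
    rewrite -[leRHS]expR0 ler_expR oppr_le0 exprn_ge0// divr_ge0 ?(ltW b0)//.
    by case/andP: (y01 x).
  - move=> x; apply: cvgM; first exact: cvg_cst.
    have y0 : 0 <= y x by case/andP: (y01 x).
    case: ltgtP => yb.
    + rewrite -[X in _ --> X]expR0 -[in X in _ --> X]oppr0.
      apply: continuous_cvg; first exact: continuous_expR.
      apply: cvgN; apply: cvg_expr; rewrite ger0_norm ?divr_ge0 ?(ltW b0)//.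
      by rewrite ltr_pdivrMr// mul1r.
    (* With t = (y / b)^n, the bound exp(-t) <= 1 / t gives geometric decay. *)
    + apply: (@squeeze_cvgr _ _ _ _ (fun=> 0) (fun n => (b / y x) ^+ n)).
      * near=> n; rewrite expR_ge0/= expRN -(invrK (b / y x)) invf_div exprVn.
        have q0 : 0 < (y x / b) ^+ n by rewrite exprn_gt0// divr_gt0// (lt_trans b0).
        rewrite lef_pV2 ?posrE ?expR_gt0//.
        by apply: le_trans (expR_ge1Dx _); rewrite lerDr.
      * exact: cvg_cst.
      * apply: cvg_expr; rewrite ger0_norm ?divr_ge0 ?(ltW b0)//.
        by rewrite ltr_pdivrMr ?mul1r// (lt_trans b0).
    + rewrite yb divff ?gt_eqF//; under eq_fun do rewrite expr1n; exact: cvg_cst.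
(* The shift to [n.+2] keeps [b n] positive at n = 0. *)
pose b n : R := a * (1 - (n.+2)%:R^-1).
have b0 n : 0 < b n by rewrite mulr_gt0// subr_gt0 invf_lt1// ltr1n.
have ba n : b n < a by rewrite gtr_pMr// gtrBl invr_gt0.
have bcvg : b n @[n --> \oo] --> a.
  rewrite -[X in _ --> X]mulr1 -[in X in _ --> X](subr0 1).
  apply: cvgM; first exact: cvg_cst.
  apply: cvgB; first exact: cvg_cst.
  rewrite (_ : (fun n => _) = (fun n => (harmonic n.+1 : R)))//.
  by rewrite (cvg_shiftS (@harmonic R)); exact: cvg_harmonic.
apply: (bp_lim Gbp (f_ := fun n x => w x *
    (if y x < b n then 1 else if y x == b n then expR (-1) else 0)) (C := 1)).
- by move=> n; exact: step.
- move=> n x; rewrite normrM -[leRHS]mul1r ler_pM//.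
  case: ifP => _; first by rewrite normr1.
  case: ifP => _; last by rewrite normr0.
  by rewrite ger0_norm ?expR_ge0// -[leRHS]expR0 ler_expR lerN10.
- move=> x; apply: cvgM; first exact: cvg_cst.
  case: ltP => ya.
    apply: cvg_near_cst; near=> n; rewrite ifT//.
    near: n; exact: (cvgr_gt _ bcvg).
  rewrite (_ : (fun _ => _) = fun=> 0); first exact: cvg_cst.
  apply/funext => n; have bx := lt_le_trans (ba n) ya.
  by rewrite ltNge (ltW bx)/= gt_eqF.
Unshelve. all: by end_near.
Qed.

End BpIndic.

Section BpMeasurable.
Import HBNNSimple.
Context d (T : measurableType d) (R : realType).
Variable G : (T -> R) -> Prop.
Hypothesis Gbp : bp_closed G.

(** Adding the bound [C] makes f nonnegative; its simple approximations then stay between 0 and 2C,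
    so that their limit is a bounded one. *)
Lemma bp_simple : (forall A, measurable A -> G \1_A) ->
  forall f, bmeas f -> G f.
Proof.
move=> GA f [mf [C fC]].
have G1 : G (fun=> 1).
  by have := GA setT measurableT; congr G; apply/funext => x; rewrite indicE in_setT.
pose h x := f x + C.
have h0 x : 0 <= h x by rewrite -lerBlDr sub0r; move: (fC x); rewrite ler_norml => /andP[].
have hC x : h x <= C + C by rewrite lerD2r; move: (fC x); rewrite ler_norml => /andP[].
have mh : measurable_fun setT (EFin \o h).
  by apply/measurable_EFinP; apply: measurable_funD.
suff Gh : G h.
  have := bp_lin Gbp (- C) G1 Gh; congr G.
  by apply/funext => x; rewrite /h mulr1 addrC addrK.
pose g := nnsfun_approx measurableT mh.
have cg x : g n x @[n --> \oo] --> h x.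
  have := cvg_nnsfun_approx measurableT mh (fun x _ => h0 x) (x := x) Logic.I.
  by move/fine_cvg.
apply: (bp_lim Gbp (f_ := g) (C := C + C)) => //.
- move=> n.
  rewrite (_ : (g n : T -> R) =
    fun x => \sum_(i <- finmap.enum_fset (fset_set (range (g n)))) (i * \1_(g n @^-1` [set i]) x)).
    apply: (@bp_sum _ _ _ Gbp _ _ _ _ (fun=> 1)) => // i.
    by apply: bp_scale => //; exact: GA.
  by apply/funext => x; rewrite {1}fimfunE fsbig_finite.
- move=> n x; rewrite ger0_norm//; apply: le_trans (hC x).
  rewrite -(cvg_lim (@Rhausdorff R) (cg x)).
  apply: (nondecreasing_cvgn_le (u_ := fun n => g n x)).
    by move=> k l kl; move: x; exact/lefP/nd_nnsfun_approx.
  by apply/cvg_ex; eexists; exact: cg.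
Qed.

(** Dynkin's theorem: the sets whose indicator lies in [G] are stable under complements, and under
    disjoint countable unions because the partial sums of the indicators are at most 1. *)
Lemma bp_pi (H : set (set T)) : @measurable _ T = <<s H >> -> setI_closed H ->
  G (fun=> 1) -> (forall A, H A -> G \1_A) -> forall f, bmeas f -> G f.
Proof.
move=> mH HI G1 GH; apply: bp_simple => A; rewrite mH.
apply: (dynkin_induction (P := fun A => G \1_A) mH HI) => //.
- by rewrite (_ : \1__ = fun=> 1)//; apply/funext => x; rewrite indicE in_setT.
- move=> S mS GS; have := bp_sub Gbp G1 GS; congr G.
  by apply/funext => x; rewrite !indicE in_setC; case: (x \in S); rewrite ?subrr ?subr0.
- move=> F mF tF GF.
  have S1 n k x : F k x -> (k < n)%N -> \sum_(i < n) \1_(F i) x = 1 :> R.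
    move=> Fk kn; rewrite (bigD1 (Ordinal kn))//= indicE mem_set// big1 ?addr0// => i ik.
    rewrite indicE memNset// => Fi; move/trivIsetP: tF => /(_ i k Logic.I Logic.I).
    have ik' : (i : nat) != k by apply: contra ik => /eqP ik; apply/eqP/val_inj.
    by move=> /(_ ik') /seteqP[/(_ x)] /(_ (conj Fi Fk)).
  have S0 n x : (forall k, (k < n)%N -> ~ F k x) -> \sum_(i < n) \1_(F i) x = 0 :> R.
    by move=> nF; rewrite big1// => i _; rewrite indicE memNset//; exact: nF.
  apply: (bp_lim Gbp (f_ := fun n x => \sum_(i < n) \1_(F i) x) (C := 1)).
  + by move=> n; apply: (@bp_sum _ _ _ Gbp _ _ _ _ (fun=> 1)).
  + move=> n x; have [[k [kn Fk]]|nF] := pselect (exists k, (k < n)%N /\ F k x).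
      by rewrite (S1 _ k)// normr1.
    by rewrite S0 ?normr0// => k kn Fk; apply: nF; exists k.
  + move=> x; case: (pselect ((\bigcup_k F k) x)) => [[k _ Fk]|Fx].
      rewrite indicE mem_set; last by exists k.
      by apply: cvg_near_cst; near=> n; apply: (S1 _ k) => //; near: n; exists k.+1.
    rewrite indicE memNset//.
    rewrite (_ : (fun _ => _) = fun=> 0); first exact: cvg_cst.
    by apply/funext => n; apply: S0 => k _ Fk; apply: Fx; exists k.
Unshelve. all: by end_near.
Qed.

End BpMeasurable.

Section CvgMax.
Context (R : realType) (T : Type) (F : set_system T) {FF : Filter F}.
Implicit Types (f g : T -> R) (a b : R).

Lemma cvg_maxr f g a b : f x @[x --> F] --> a -> g x @[x --> F] --> b ->
  Num.max (f x) (g x) @[x --> F] --> Num.max a b.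
Proof.
move=> fa gb; rewrite maxr_absE; under eq_fun do rewrite maxr_absE.
apply: cvgM; last exact: cvg_cst.
by apply: cvgD; [exact: cvgD|apply: cvg_norm; exact: cvgB].
Qed.

Lemma cvg_minr f g a b : f x @[x --> F] --> a -> g x @[x --> F] --> b ->
  Num.min (f x) (g x) @[x --> F] --> Num.min a b.
Proof.
move=> fa gb; rewrite minr_absE; under eq_fun do rewrite minr_absE.
apply: cvgM; last exact: cvg_cst.
by apply: cvgB; [exact: cvgD|apply: cvg_norm; exact: cvgB].
Qed.

End CvgMax.

Section BpBorel.
Variables (R : realType) (G : (R -> R) -> Prop).
Hypothesis Gbp : bp_closed G.

Lemma bp_rays : G (fun=> 1) -> (forall a, G \1_(`]a, +oo[%classic : set R)) ->
  forall f : measurableTypeR R -> R, bmeas f -> G f.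
Proof.
move=> G1 Gray; apply: (@bp_pi _ (measurableTypeR R) _ _ Gbp (@RGenOInfty.G R)) => //.
- exact: RGenOInfty.measurableE.
- move=> _ _ [x ->] [y ->]; exists (Num.max x y).
  apply/seteqP; split => z /=; rewrite !in_itv/= !andbT gt_max.
    by move=> [-> ->].
  by move=> /andP[].
- by move=> _ [x ->].
Qed.

(** The ramps min(1, max(0, n (x - a))) tend boundedly to the indicator of the open ray above a. *)
Lemma bp_continuous :
  (forall f : R -> R, continuous f -> (forall x, 0 <= f x <= 1) -> G f) ->
  forall f : measurableTypeR R -> R, bmeas f -> G f.
Proof.
move=> Gc; apply: bp_rays.
  by apply: Gc => [x|x]; [exact: cvg_cst|rewrite ler01 lexx].
move=> a; pose g n x : R := Num.min 1 (Num.max 0 (n%:R * (x - a))).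
have g01 n x : 0 <= g n x <= 1.
  by rewrite /g le_min ler01/= le_max lexx/= ge_min lexx.
apply: (bp_lim Gbp (f_ := g) (C := 1)).
- move=> n; apply: Gc => // x; apply: cvg_minr; first exact: cvg_cst.
  apply: cvg_maxr; first exact: cvg_cst.
  apply: cvgM; first exact: cvg_cst.
  by apply: cvgB; [exact: cvg_id|exact: cvg_cst].
- by move=> n x; rewrite ger0_norm; case/andP: (g01 n x).
- move=> x; rewrite indicE; have [ax|xa] := ltP a x; last first.
    rewrite memNset; last by rewrite /= in_itv/= andbT ltNge xa.
    rewrite (_ : (fun _ => _) = fun=> 0); first exact: cvg_cst.
    apply/funext => n; rewrite /g (@max_l _ _ 0); last by rewrite mulr_ge0_le0// subr_le0.
    by rewrite min_r.
  rewrite mem_set; last by rewrite /= in_itv/= andbT.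
  apply: cvg_near_cst; near=> n; rewrite /g max_r; last by rewrite mulr_ge0// subr_ge0 ltW.
  rewrite min_l// -ler_pdivrMr ?subr_gt0// div1r.
  by near: n; exact: nbhs_infty_ger.
Unshelve. all: by end_near.
Qed.

(* The Baire classes exhaust the Borel functions, which transfers to all of
   them a property of continuous functions that is only stable under
   limits. *)
Inductive baire : (R -> R) -> Prop :=
| Baire_continuous f of continuous f : baire f
| Baire_limit (f_ : nat -> R -> R) f of (forall n, baire (f_ n)) &
    (forall x, f_ n x @[n --> \oo] --> f x) : baire f.

End BpBorel.

Section Baire.
Variable R : realType.

Lemma baire_bp_closed : bp_closed (@baire R).
Proof.
split=> [a f g Bf Bg|f_ f C Bf _ ff]; last exact: (Baire_limit Bf).
elim: Bf => {f} [f cf|f_ f _ IH ff]; last first.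
  apply: (Baire_limit IH) => x; apply: cvgD; last exact: cvg_cst.
  by apply: cvgM; [exact: cvg_cst|exact: ff].
elim: Bg => {g} [g cg|g_ g _ IH gg]; last first.
  by apply: (Baire_limit IH) => x; apply: cvgD; [exact: cvg_cst|exact: gg].
apply: Baire_continuous => x; apply: cvgD; last exact: cg.
by apply: cvgM; [exact: cvg_cst|exact: cf].
Qed.

(** Baire approximations carry no bounds, so the induction is run on their truncations to [a, b]:
    truncation preserves continuity and limits, and fixes the target function. *)
Lemma borel_ind (a b : R) (P : (R -> R) -> Prop) : a <= b ->
  (forall f, continuous f -> (forall x, a <= f x <= b) -> P f) ->
  (forall (f_ : nat -> measurableTypeR R -> R) f,
    (forall n, measurable_fun setT (f_ n)) ->
    (forall n x, a <= f_ n x <= b) -> (forall n, P (f_ n)) ->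
    (forall x, f_ n x @[n --> \oo] --> f x) -> P f) ->
  forall f : measurableTypeR R -> R, measurable_fun setT f ->
    (forall x, a <= f x <= b) -> P f.
Proof.
move=> ab Pc Pl f mf fab.
pose clamp (g : R -> R) x := Num.max a (Num.min b (g x)).
have cab g x : a <= clamp g x <= b.
  by rewrite le_max lexx/= ge_max ab ge_min lexx.
have -> : f = clamp f.
  by apply/funext => x; rewrite /clamp; case/andP: (fab x) => ? ?; rewrite min_r// max_r.
have Bf : baire f.
  apply: (bp_continuous baire_bp_closed); first by move=> g cg _; exact: Baire_continuous.
  split=> //; exists (`|a| + `|b|) => x; case/andP: (fab x) => h1 h2.
  move: (f x) h1 h2 => c h1 h2; rewrite ler_norml.
  move: (ler_norm (- a)) (ler_norm b) (normr_ge0 a) (normr_ge0 b).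
  by rewrite normrN => *; apply/andP; split; lra.
suff [] : measurable_fun setT (clamp f : measurableTypeR R -> R) /\ P (clamp f) by [].
elim: Bf => {f mf fab} [f cf|f_ f _ IH ff].
  have cc : continuous (clamp f).
    move=> x; apply: cvg_maxr; first exact: cvg_cst.
    by apply: cvg_minr; [exact: cvg_cst|exact: cf].
  by split; [exact: continuous_measurable_fun|exact: Pc].
have fc x : clamp (f_ n) x @[n --> \oo] --> clamp f x.
  apply: cvg_maxr; first exact: cvg_cst.
  by apply: cvg_minr; [exact: cvg_cst|exact: ff].
split; first by apply: (measurable_fun_cvg (fun n => (IH n).1)) => x _; exact: fc.
by apply: (Pl (fun n => clamp (f_ n))) => // n; case: (IH n).
Qed.

End Baire.

(** * Point measures *)

Section PointMeasureTheory.
Variable R : realType.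
Implicit Types (mu nu : pointMeasure R) (s : seq R).
Local Notation mR := (measurableTypeR R).

Lemma ex_invS_lt (e : R) : 0 < e -> exists n, n.+1%:R^-1 < e.
Proof.
move=> e0; exists (Num.truncn e^-1).
by rewrite -[ltRHS]invrK ltf_pV2 ?posrE ?invr_gt0// truncnS_gt.
Qed.

Lemma measure_bigcup_eq0 d (T : measurableType d) (m : {measure set T -> \bar R})
    (F : (set T)^nat) : (forall n, measurable (F n)) ->
  (forall n, m (F n) = 0%E) -> m (\bigcup_n F n) = 0%E.
Proof.
move=> mF F0; apply/negligibleP; first exact: bigcupT_measurable.
by apply: negligible_bigcup => n; exists (F n); split; rewrite ?F0.
Qed.

Lemma pm_ltey mu (A : set mR) : measurable A -> (mu A < +oo)%E.
Proof. by move=> mA; rewrite ltey_eq fin_num_measure. Qed.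

Lemma pm_ge1 mu (A : set mR) : measurable A -> mu A <> 0%E -> (1 <= mu A)%E.
Proof.
move=> mA; have [[|k] ->] := pm_integer mu mA => //= _.
by rewrite lee_fin ler1n.
Qed.

Lemma pm_addE mu nu (A : set mR) : pm_add mu nu A = (mu A + nu A)%E.
Proof. by rewrite /= /pm_add_fun measure_addE. Qed.

Lemma pm_of_seqE s (A : set mR) :
  pm_of_seq s A = ((count (fun x => x \in A) s)%:R)%:E.
Proof.
elim: s => [|x s IH] //=.
by rewrite pm_addE IH/= diracE natrD EFinD.
Qed.

Lemma Rint_pm_eq mu nu (g : mR -> R) :
  (forall A, measurable A -> mu A = nu A) -> \int[mu]_x g x = \int[nu]_x g x.
Proof. by move=> eq_mn; congr fine; apply: eq_measure_integral => A mA _; exact: eq_mn. Qed.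

Lemma Rint_pm_add mu nu (g : mR -> R) : bmeas g ->
  \int[pm_add mu nu]_x g x = \int[mu]_x g x + \int[nu]_x g x.
Proof.
move=> bg; rewrite /Rintegral -fineD; last 2 first.
- by apply: (integrable_fin_num measurableT); apply: bmeas_integrable => //; exact: pm_ltey.
- by apply: (integrable_fin_num measurableT); apply: bmeas_integrable => //; exact: pm_ltey.
congr fine; rewrite -integral_measure_add//.
- by apply: bmeas_integrable => //; exact: pm_ltey.
- by apply: bmeas_integrable => //; exact: pm_ltey.
Qed.

Lemma Rint_pm_dirac x (g : mR -> R) : bmeas g -> \int[pm_dirac x]_y g y = g x.
Proof.
move=> [mg _]; rewrite /Rintegral/= integral_dirac ?diracT ?mul1e//.
exact/measurable_EFinP.
Qed.

Lemma Rint_pm_zero (g : mR -> R) : \int[pm_zero R]_y g y = 0.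
Proof. by rewrite /Rintegral/= integral_measure_zero. Qed.

Lemma Rint_pm_seq s (g : mR -> R) : bmeas g ->
  \int[pm_of_seq s]_x g x = \sum_(x <- s) g x.
Proof.
move=> bg; elim: s => [|x s IH]; first by rewrite big_nil Rint_pm_zero.
by rewrite big_cons/= Rint_pm_add// IH Rint_pm_dirac.
Qed.

Lemma Rint_pm_indic mu (A : set mR) : measurable A ->
  \int[mu]_x \1_A x = fine (mu A).
Proof. by move=> mA; rewrite /Rintegral integral_indic// setIT. Qed.

(** An integer-valued measure is at least 1 where it is nonzero, and this bound survives the
    decreasing limit. *)
Lemma pm_bigcap_neq0 mu (F : (set mR)^nat) : (forall n, measurable (F n)) ->
  nonincreasing_seq F -> (forall n, mu (F n) <> 0%E) -> mu (\bigcap_n F n) <> 0%E.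
Proof.
move=> mF niF F0 F_0.
have mcap : measurable (\bigcap_n F n) by exact: bigcapT_measurable.
have cF : mu (F n) @[n --> \oo] --> 0%E.
  by rewrite -F_0; exact: (nonincreasing_cvg_mu (pm_ltey mu (mF 0%N)) mF mcap niF).
have : (1 <= 0 :> \bar R)%E.
  apply: (cvge_ge _ cF); apply: nearW => n; exact: pm_ge1.
by rewrite lee_fin ler10.
Qed.

(** The atom is the infimum of the a whose ray []-oo, a]] is charged: nothing lies strictly below
    it, while the rays reaching beyond it are all charged and decrease to the closed ray that ends
    there. *)
Lemma pm_atom mu : mu setT <> 0%E -> exists x, mu [set x] <> 0%E.
Proof.
move=> muT; pose S := [set a | mu (`]-oo, a]%classic : set mR) <> 0%E].
have mray (a : R) : measurable (`]-oo, a]%classic : set mR) by exact: measurable_itv.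
have S0 : S !=set0.
  apply/set0P/negP => /eqP S0; apply: muT.
  have nall n : mu (`]-oo, n%:R]%classic : set mR) = 0%E.
    by apply: contrapT => h; have : S n%:R by []; rewrite S0.
  have -> : [set: mR] = \bigcup_n (`]-oo, n%:R]%classic : set mR).
    apply/esym/seteqP; split => // x _; exists (Num.truncn `|x|).+1 => //=.
    by rewrite in_itv/= (le_trans (ler_norm x))// ltW// truncnS_gt.
  by apply: measure_bigcup_eq0 => n; [exact: mray|exact: nall].
(* Otherwise all rays []-oo, -n]] would be charged, although they decrease to the empty set. *)
have lbS : has_lbound S.
  apply: contrapT => nlb.
  have Sn n : S (- n%:R).
    apply: contrapT => nSn; apply: nlb; exists (- n%:R) => a Sa.
    rewrite leNgt; apply/negP => an; apply: Sa; apply/eqP.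
    move/contrapT: nSn => nSn; rewrite -measure_le0 -nSn le_measure ?inE//.
    by apply: subitvPr; rewrite bnd_simp ltW.
  have := @pm_bigcap_neq0 mu (fun n => `]-oo, (- n%:R)]%classic) (fun n => mray _).
  apply => //.
    move=> m n mn; apply/subsetPset; apply: subitvPr; rewrite bnd_simp.
    by rewrite lerN2 ler_nat.
  rewrite (_ : \bigcap_n _ = set0) ?measure0//.
  apply/seteqP; split => // x /(_ (Num.truncn `|x|).+1 Logic.I) /=.
  rewrite in_itv/= => h; have := truncnS_gt `|x|.
  by have := ler_norm (- x); rewrite normrN; lra.
have infS : has_inf S by [].
exists (inf S) => mux.
have mo : mu (`]-oo, inf S[%classic : set mR) = 0%E.
  rewrite (_ : `]-oo, inf S[%classic =
      \bigcup_n (`]-oo, inf S - n.+1%:R^-1]%classic : set mR)).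
    apply: measure_bigcup_eq0 => [n|n]; first exact: mray.
    apply: contrapT => h; have := ge_inf lbS (h : S _).
    by apply/negP; rewrite -ltNge ltrBlDr ltrDl invr_gt0.
  apply/seteqP; split => x /=; rewrite in_itv/=.
    rewrite -subr_gt0 => /ex_invS_lt[k xk]; exists k => //=.
    by rewrite in_itv/= lerBrDr -lerBrDl ltW.
  by move=> [n _ /=]; rewrite in_itv/= => /le_lt_trans; apply; rewrite ltrBlDr ltrDl invr_gt0.
have mc : mu (`]-oo, inf S]%classic : set mR) = 0%E.
  have -> : (`]-oo, inf S]%classic : set mR) = `]-oo, inf S[%classic `|` [set inf S].
    apply/seteqP; split => x /=; rewrite !in_itv/= le_eqVlt.
      by move=> /orP[/eqP|]; [right|left].
    by move=> [->|->]; rewrite ?eqxx ?orbT.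
  apply/eqP; rewrite -measure_le0 (le_trans (measureU2 _ _ _))//.
  by rewrite -[leRHS]adde0 leeD// le_eqVlt; apply/orP; left; apply/eqP; [exact: mo|exact: mux].
have := @pm_bigcap_neq0 mu (fun n => `]-oo, inf S + n.+1%:R^-1]%classic) (fun n => mray _).
apply.
- move=> m n mn; apply/subsetPset; apply: subitvPr; rewrite bnd_simp.
  by rewrite lerD2l lef_pV2 ?posrE// ler_nat.
- move=> n mn0.
  have n0 : 0 < n.+1%:R^-1 :> R by rewrite invr_gt0.
  have [a Sa an] := inf_adherent n0 infS.
  apply: Sa; apply/eqP; rewrite -measure_le0 -mn0 le_measure ?inE//.
  by apply: subitvPr; rewrite bnd_simp ltW.
- rewrite -mc; congr (mu _); apply/seteqP; split => x /=.
    move=> h; rewrite in_itv/=; apply/ler_addgt0Pr => e e0.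
    have [n en] := ex_invS_lt e0.
    have := h n Logic.I; rewrite /= in_itv/= => /le_trans; apply.
    by rewrite lerD2l ltW.
  rewrite in_itv/= => h n _; rewrite /= in_itv/= (le_trans h)//.
  by rewrite lerDl.
Qed.

Definition pm_restr mu (A : set mR) (mA : measurable A) : pointMeasure R.
Proof.
exists (mrestr mu mA : {finite_measure set _ -> \bar R}).
by move=> B mB; apply: pm_integer; exact: measurableI.
Defined.

(* By induction on the total mass, which drops when an atom is removed. *)
Lemma pm_atomic mu : exists s, forall A : set mR, measurable A -> mu A = pm_of_seq s A.
Proof.
have [k] := pm_integer mu measurableT.
elim/ltn_ind: k mu => k IH mu muk.
have [mu0|/pm_atom[x mux]] := pselect (mu setT = 0%E).
  exists [::] => A mA; apply/eqP; rewrite eq_le measure_ge0 andbT.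
  by rewrite -[leRHS]mu0 le_measure// inE.
have m1 : measurable [set x : mR] by exact: measurable_set1.
have mC := measurableC m1.
have split_mu A : measurable A -> mu A = (mu (A `&` [set x]) + mu (A `&` ~` [set x]))%E.
  by move=> mA; rewrite addeC -setDE; exact: measureDI.
have [l mul] := pm_integer mu m1; have [j muj] := pm_integer mu mC.
have kE : k = (l + j)%N.
  apply/eqP; rewrite -(eqr_nat R) -(inj_eq (@EFin_inj R)) natrD EFinD -mul -muj -muk.
  by rewrite (split_mu setT)// !setTI.
have [s sE] : exists s, forall A : set mR, measurable A -> pm_restr mu mC A = pm_of_seq s A.
  apply: (IH j); last by rewrite /= /mrestr setTI.
  by rewrite kE -[ltnLHS]add0n ltn_add2r lt0n; apply/eqP => l0; apply: mux; rewrite mul l0.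
exists (nseq l x ++ s) => A mA.
rewrite pm_of_seqE count_cat count_nseq natrD EFinD -pm_of_seqE -sE// split_mu//=.
congr (_ + _)%E; have [xA|xA] := boolP (x \in A).
  rewrite mul1n -mul; congr (mu _); apply/seteqP; split => y /= => [[]//|->].
  by split=> //; exact: set_mem.
rewrite mul0n (_ : _ `&` _ = set0) ?measure0//.
by apply/seteqP; split => y //= [Ay yx]; move: xA; rewrite -yx mem_set.
Qed.

End PointMeasureTheory.

Section PointMeasureFunctions.
Variable R : realType.
Implicit Types (mu nu : pointMeasure R) (h : R -> R).
Local Notation mR := (measurableTypeR R).

Lemma measurable_pm_continuous (F : pointMeasure R -> R) :
  continuous F -> measurable_fun setT F.
Proof.
move=> /continuousP cF; apply: (measurability _ (RGenOpens.measurableE R)).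
move=> _ [_ [a [b ->] <-]]; rewrite setTI; apply: sub_sigma_algebra.
exact/cF/interval_open.
Qed.

Lemma pm_pairing_continuous (g : bounded_continuous R) :
  continuous (fun mu : pointMeasure R => \int[mu]_x sval g x).
Proof.
move=> mu; apply: (@continuous_comp _ _ _ (@pairing R) (@proj _ _ g) mu).
  exact: (@initial_continuous _ _ (@pairing R)).
exact: proj_continuous.
Qed.

(** For continuous g this is the choice of the topology; bounded limits carry it to Borel g. *)
Lemma measurable_pm_int (g : mR -> R) : bmeas g ->
  measurable_fun setT (fun mu : pointMeasure R => \int[mu]_x g x).
Proof.
move=> bg.
suff [] : bmeas g /\ measurable_fun setT (fun mu : pointMeasure R => \int[mu]_x g x) by [].
move: g bg; apply: bp_continuous.
  split=> [a f g [bf mf] [bg mg]|f_ f C fP fC ff].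
    split; first exact: bmeas_lin.
    rewrite (_ : (fun _ => _) =
      fun mu : pointMeasure R => a * \int[mu]_x f x + \int[mu]_x g x).
      by apply: measurable_funD => //; exact: measurable_funM.
    by apply/funext => mu; apply: Rint_lin => //; exact: pm_ltey.
  have mf n : measurable_fun setT (f_ n : mR -> R) by case: (fP n) => -[].
  split; first exact: (bmeas_cvg mf fC ff).
  apply: (measurable_fun_cvg (fun n => (fP n).2)) => mu _ /=.
  by apply: (Rint_bcvg _ mf fC) => //; exact: pm_ltey.
move=> f cf f01; split.
  split; first exact: continuous_measurable_fun.
  by exists 1 => x; rewrite ger0_norm; case/andP: (f01 x).
have bf : continuous f /\ exists M : R, forall x : R, `|f x| <= M.
  by split=> //; exists 1 => x; rewrite ger0_norm; case/andP: (f01 x).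
apply: measurable_pm_continuous.
exact: (@pm_pairing_continuous (exist _ f bf : bounded_continuous R)).
Qed.

Lemma measurable_pm_eval (A : set mR) : measurable A ->
  measurable_fun setT (fun mu : pointMeasure R => mu A).
Proof.
move=> mA; rewrite (_ : (fun _ => _) = EFin \o (fun mu : pointMeasure R => \int[mu]_x \1_A x)).
  by apply/measurable_EFinP; apply: measurable_pm_int; exact: bmeas_indic.
by apply/funext => mu /=; rewrite Rint_pm_indic// fineK// fin_num_measure.
Qed.

(** The infimum of a range that is not bounded below is 0 by convention, so [0 < inf] does yield a
    positive lower bound. *)
Lemma V0P h : V0 h <-> measurable_fun setT (h : mR -> R) /\
  exists2 e, 0 < e & forall x, e <= h x <= 1.
Proof.
split=> [[mh h0 h1]|[mh [e e0 he]]].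
  split=> //; exists (inf (range h)) => // x; rewrite h1 andbT.
  have [[_ lb]|noinf] := pselect (has_inf (range h)); first by apply: ge_inf => //; exists x.
  by move: h0; rewrite inf_out ?ltxx.
split=> // [|x]; last by case/andP: (he x).
apply: (lt_le_trans e0); apply: lb_le_inf; first by exists (h 0), 0.
by move=> _ [x _ <-]; case/andP: (he x).
Qed.

Lemma V0_bounds h x : V0 h -> 0 < h x <= 1.
Proof.
by case/V0P => _ [e e0 /(_ x)/andP[eh ->]]; rewrite (lt_le_trans e0).
Qed.

Lemma V0_bmeas h : V0 h -> bmeas (h : mR -> R).
Proof.
move=> Vh; split; first by case: Vh.
by exists 1 => x; have /andP[h0 h1] := V0_bounds x Vh; rewrite gtr0_norm.
Qed.

Lemma bmeas_ln h : V0 h -> bmeas ((fun x => ln (h x)) : mR -> R).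
Proof.
case/V0P => mh [e e0 eh]; split.
  by apply: measurableT_comp mh; exact: measurable_ln.
exists (- ln e) => x; have /andP[h1 h2] := eh x.
have h0 := lt_le_trans e0 h1.
by rewrite ler0_norm ?ln_le0// lerN2 ler_ln ?posrE.
Qed.

Lemma V0M h1 h2 : V0 h1 -> V0 h2 -> V0 (fun x => h1 x * h2 x).
Proof.
case/V0P => m1 [e1 e10 eh1] /V0P[m2 [e2 e20 eh2]]; apply/V0P; split.
  exact: measurable_funM.
exists (e1 * e2); first exact: mulr_gt0.
move=> x; have /andP[a1 b1] := eh1 x; have /andP[a2 b2] := eh2 x.
rewrite ler_pM ?(ltW e10) ?(ltW e20)//= mulr_ile1// ?(le_trans _ a1) ?(le_trans _ a2) ?ltW//.
Qed.

Lemma V0_cst c : 0 < c <= 1 -> V0 (fun _ : R => c).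
Proof.
by move=> /andP[c0 c1]; apply/V0P; split=> //; exists c => // _; rewrite lexx.
Qed.

Lemma V0_expR (g : mR -> R) : bmeas g -> (forall x, 0 <= g x) ->
  V0 (fun x => expR (- g x)).
Proof.
move=> [mg [C gC]] g0; apply/V0P; split.
  by apply: measurableT_comp; [exact: measurable_expR|exact: measurable_funN].
exists (expR (- C)); first exact: expR_gt0.
move=> x; rewrite ler_expR lerN2 (le_trans (ler_norm _) (gC x))/=.
by rewrite -[leRHS]expR0 ler_expR oppr_le0.
Qed.

(** The product of the values of [h] over the atoms of [mu], by [pmexp_seq]; its mean under Q is
    G_Q[h]. *)
Definition pmexp h mu : R := expR (\int[mu]_x ln (h x)).

Lemma pmexp_gt0 h mu : 0 < pmexp h mu.
Proof. exact: expR_gt0. Qed.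

Lemma ler_pmexp h1 h2 mu : V0 h1 -> V0 h2 -> (forall x, h1 x <= h2 x) ->
  pmexp h1 mu <= pmexp h2 mu.
Proof.
move=> V1 V2 h12; rewrite ler_expR.
apply: Rint_le; [exact: pm_ltey|exact: bmeas_ln|exact: bmeas_ln|].
by move=> x; rewrite ler_ln ?posrE//; case/andP: (V0_bounds x V1); case/andP: (V0_bounds x V2).
Qed.

Lemma pmexp1 mu : pmexp (fun=> 1) mu = 1.
Proof.
by rewrite /pmexp ln1 Rintegral_cst// mul0r expR0.
Qed.

Lemma pmexp_le1 h mu : V0 h -> pmexp h mu <= 1.
Proof.
move=> Vh; rewrite -(pmexp1 mu); apply: ler_pmexp => //.
  by apply: V0_cst; rewrite ltr01 lexx.
by move=> x; case/andP: (V0_bounds x Vh).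
Qed.

Lemma bmeas_pmexp h : V0 h -> bmeas (pmexp h).
Proof.
move=> Vh; split.
  by apply: measurableT_comp; [exact: measurable_expR|exact: measurable_pm_int (bmeas_ln Vh)].
by exists 1 => mu; rewrite gtr0_norm ?pmexp_gt0// pmexp_le1.
Qed.

Lemma pmexpM h1 h2 mu : V0 h1 -> V0 h2 ->
  pmexp (fun x => h1 x * h2 x) mu = pmexp h1 mu * pmexp h2 mu.
Proof.
move=> V1 V2; rewrite /pmexp -expRD -RintD; [|exact: pm_ltey|exact: bmeas_ln|exact: bmeas_ln].
congr (expR _); apply: eq_Rintegral => x _.
by rewrite lnM ?posrE//; [case/andP: (V0_bounds x V1)|case/andP: (V0_bounds x V2)].
Qed.

Lemma pmexp_add h mu nu : V0 h -> pmexp h (pm_add mu nu) = pmexp h mu * pmexp h nu.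
Proof.
by move=> Vh; rewrite /pmexp Rint_pm_add ?expRD//; exact: bmeas_ln.
Qed.

Lemma pmexp_zero h : pmexp h (pm_zero R) = 1.
Proof. by rewrite /pmexp Rint_pm_zero expR0. Qed.

Lemma pmexp_dirac h x : V0 h -> pmexp h (pm_dirac x) = h x.
Proof.
move=> Vh; rewrite /pmexp Rint_pm_dirac; last exact: bmeas_ln.
by rewrite lnK// posrE; case/andP: (V0_bounds x Vh).
Qed.

Lemma pmexp_seq h s : V0 h -> pmexp h (pm_of_seq s) = \prod_(x <- s) h x.
Proof.
move=> Vh; elim: s => [|x s IH]; first by rewrite big_nil pmexp_zero.
by rewrite big_cons/= pmexp_add// IH pmexp_dirac.
Qed.

Lemma eq_pmexp h mu nu : (forall A : set mR, measurable A -> mu A = nu A) ->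
  pmexp h mu = pmexp h nu.
Proof. by move=> mn; rewrite /pmexp (Rint_pm_eq _ mn). Qed.

(** Exponentials of counts are again of the form [pmexp h]; this is how the monotone class theorem
    reaches the events that [mu B] is at least j. *)
Lemma pmexp_indic mu (B : set mR) : measurable B ->
  pmexp (fun x => expR (- \1_B x)) mu = expR (- fine (mu B)).
Proof.
move=> mB; rewrite /pmexp; congr expR; rewrite -mulN1r -Rint_pm_indic//.
rewrite -RintZ; [|exact: pm_ltey|exact: bmeas_indic].
by apply: eq_Rintegral => x _; rewrite expRK mulN1r.
Qed.

Lemma pmexp_cst c mu : 0 < c -> pmexp (fun=> c) mu = expR (ln c * fine (mu setT)).
Proof. by move=> c0; rewrite /pmexp Rintegral_cst. Qed.

Lemma pmexp_cvg (h_ : nat -> R -> R) h e mu : 0 < e ->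
  (forall n, measurable_fun setT (h_ n : mR -> R)) ->
  (forall n x, e <= h_ n x <= 1) ->
  (forall x, h_ n x @[n --> \oo] --> h x) ->
  pmexp (h_ n) mu @[n --> \oo] --> pmexp h mu.
Proof.
move=> e0 mh eh hh.
have Vh n : V0 (h_ n) by apply/V0P; split => //; exists e.
apply: continuous_cvg; first exact: continuous_expR.
apply: (@Rint_bcvg _ _ _ _ _ _ _ (- ln e)); first exact: pm_ltey.
- by move=> n; case: (bmeas_ln (Vh n)).
- move=> n x; have /andP[h1 h2] := eh n x.
  have h0 := lt_le_trans e0 h1.
  by rewrite ler0_norm ?ln_le0// lerN2 ler_ln ?posrE.
- move=> x; apply: (continuous_cvg _ _ (hh x)); apply: continuous_ln.
  apply: (lt_le_trans e0); apply: (cvgr_to_ge (hh x)).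
  by apply: nearW => n; case/andP: (eh n x).
Qed.

End PointMeasureFunctions.

(** * Counts generate the Borel sigma-algebra of point measures; a monotone class theorem *)

Section PointMeasureMonotoneClass.
Variable R : realType.
Implicit Types (mu nu : pointMeasure R) (h : R -> R).
Local Notation mR := (measurableTypeR R).

(** A list codes a finite intersection of events that [mu B] is at least j, so that concatenation
    makes the family a pi-system. *)
Fixpoint count_set (L : seq (set mR * nat)) : set (pointMeasure R) :=
  if L is (B, j) :: L' then [set mu : pointMeasure R | (j%:R%:E <= mu B)%E] `&` count_set L'
  else setT.

Fixpoint measurable_seq (L : seq (set mR * nat)) : Prop :=
  if L is (B, j) :: L' then measurable B /\ measurable_seq L' else True.

Definition count_sets : set (set (pointMeasure R)) :=
  [set A | exists2 L, measurable_seq L & A = count_set L].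

Lemma count_set_cat L L' : count_set (L ++ L') = count_set L `&` count_set L'.
Proof. by elim: L => [|[B j] L IH] /=; rewrite ?setTI// IH setIA. Qed.

Lemma count_sets_setI : setI_closed count_sets.
Proof.
move=> _ _ [L mL ->] [L' mL' ->]; exists (L ++ L'); last by rewrite count_set_cat.
by elim: L mL => //= -[B j] L IH [mB /IH].
Qed.

Lemma measurable_count_sets A : count_sets A -> measurable A.
Proof.
move=> [L + ->]; elim: L => [|[B j] L IH]/=; first by move=> _; exact: measurableT.
move=> [mB /IH mL]; apply: measurableI => //.
have := emeasurable_fun_c_infty measurableT (measurable_pm_eval mB) (j%:R%:E).
by rewrite setTI.
Qed.

Lemma sigma_count_sets1 B j : measurable B ->
  <<s count_sets >> [set mu : pointMeasure R | (j%:R%:E <= mu B)%E].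
Proof.
move=> mB; apply: sub_sigma_algebra; exists [:: (B, j)] => //=.
by rewrite setIT.
Qed.

Lemma pm_cvg (F : (pointMeasure R)^nat) mu :
  (forall g : bounded_continuous R,
     \int[F n]_x sval g x @[n --> \oo] --> \int[mu]_x sval g x) ->
  F n @[n --> \oo] --> mu.
Proof.
move=> FE.
have Fp : pairing (F n) @[n --> \oo] --> (pairing mu : {ptws bounded_continuous R -> R}).
  apply/cvg_sup => g U [V] [[W] oW <-] Wg WU; apply: (filterS WU).
  by apply: FE; apply: open_nbhs_nbhs.
move=> A /=; rewrite nbhsE => -[B [[W oW <-] Wmu] BA].
have : \forall n \near \oo, W (pairing (F n)).
  by apply: Fp; apply: open_nbhs_nbhs.
by apply: filterS => n; exact: BA.
Qed.

Local Notation q0 := ((0, 0) : rat * rat)%R.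

(** The sorted atoms x_i satisfy a_i < x_i < b_i, for the rational pairs (a_i, b_i) of [L]: at most
    i atoms are <= a_i and at least i + 1 are < b_i. Written with counts, the box is visibly in the
    sigma-algebra they generate; with rational ends, there are countably many boxes. *)
Definition order_box (L : seq (rat * rat)) : set (pointMeasure R) :=
  [set nu : pointMeasure R | ((size L)%:R%:E <= nu setT)%E] `&`
  ~` [set nu : pointMeasure R | ((size L).+1%:R%:E <= nu setT)%E] `&`
  \bigcap_(i in `I_(size L))
    (~` [set nu : pointMeasure R |
         (i.+1%:R%:E <= nu (`]-oo, ratr (nth q0 L i).1]%classic : set mR))%E] `&`
     [set nu : pointMeasure R |
         (i.+1%:R%:E <= nu (`]-oo, ratr (nth q0 L i).2[%classic : set mR))%E]).

Lemma sigma_order_box L : <<s count_sets >> (order_box L).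
Proof.
have S B j := @sigma_count_sets1 B j.
pose T := g_sigma_algebraType count_sets.
suff : measurable (order_box L : set T) by [].
apply: measurableI; first apply: measurableI.
- exact: S.
- by apply: measurableC; exact: S.
- apply: bigcap_measurableType => i _; apply: measurableI.
    by apply: measurableC; apply: S; exact: measurable_itv.
  by apply: S; exact: measurable_itv.
Qed.

Lemma pm_sorted mu : exists s : seq R, sorted <=%O s /\
  forall A : set mR, measurable A -> mu A = pm_of_seq s A.
Proof.
have [s sE] := pm_atomic mu; exists (sort <=%O s); split.
  exact: sort_sorted (@le_total _ _) s.
move=> A mA; rewrite sE// !pm_of_seqE; congr (_%:R%:E).
by apply/esym/permP; rewrite perm_sort.
Qed.

Lemma order_boxP L nu (t : seq R) : sorted <=%O t ->
  (forall A : set mR, measurable A -> nu A = pm_of_seq t A) ->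
  order_box L nu <-> size t = size L /\ forall i, (i < size L)%N ->
    ratr (nth q0 L i).1 < nth 0 t i < ratr (nth q0 L i).2.
Proof.
move=> st nuE.
have nuT : nu setT = (size t)%:R%:E.
  rewrite nuE// pm_of_seqE; congr (_%:R%:E); rewrite -[RHS](count_predT t).
  by apply: eq_count => x; rewrite in_setT.
have nule (a : R) : nu (`]-oo, a]%classic : set mR) = (count (<= a) t)%:R%:E.
  rewrite nuE ?pm_of_seqE; last exact: measurable_itv.
  congr (_%:R%:E); apply: eq_count => x; apply/idP/idP => [/set_mem|h].
    by rewrite /= in_itv.
  by apply/mem_set; rewrite /= in_itv.
have nult (a : R) : nu (`]-oo, a[%classic : set mR) = (count (< a) t)%:R%:E.
  rewrite nuE ?pm_of_seqE; last exact: measurable_itv.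
  congr (_%:R%:E); apply: eq_count => x; apply/idP/idP => [/set_mem|h].
    by rewrite /= in_itv.
  by apply/mem_set; rewrite /= in_itv.
rewrite /order_box; split.
  move=> [[/= h1 h2] h3].
  have st' : size t = size L.
    apply/eqP; rewrite eqn_leq; apply/andP; split.
      by rewrite leqNgt; apply/negP => h; apply: h2; rewrite nuT lee_fin ler_nat.
    by move: h1; rewrite nuT lee_fin ler_nat.
  split=> // i iL; have /= [+ +] := h3 i iL.
  rewrite nule nult !lee_fin !ler_nat => /negP; rewrite -leqNgt => ha hb.
  rewrite (nth_count_lt _ st hb) andbT.
  by apply: (nth_count_gt _ st); rewrite st' iL andbT.
move=> [st' H]; split.
  by split=> /=; rewrite nuT st' lee_fin ler_nat ?leqnn// ltnn.
move=> i /= iL; rewrite nule nult !lee_fin !ler_nat.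
have /andP[Ha Hb] := H i iL; split.
  by move=> ha; have := nth_count_le 0 st ha; rewrite leNgt Ha.
rewrite ltnNge; apply/negP => hb.
have : ratr (nth q0 L i).2 <= nth 0 t i.
  by apply: (nth_count_ge _ st); rewrite hb st' iL.
by rewrite leNgt Hb.
Qed.

(** If no box around [mu] fitted into [U], boxes with ends within 1 / (n + 1) of the atoms would
    contain point measures outside [U] whose sorted atoms converge one by one to those of [mu],
    hence which converge weakly to [mu]. *)
Lemma open_order_box (U : set (pointMeasure R)) mu : open U -> U mu ->
  exists2 L, order_box L mu & order_box L `<=` U.
Proof.
move=> oU Umu; have [s [ss sE]] := pm_sorted mu.
have [qa qaE] : {qa : nat -> R -> rat &
    forall n (x : R), x - n.+1%:R^-1 < ratr (qa n x) < x}.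
  apply: (@choice _ _ (fun n (q : R -> rat) => forall x : R, x - n.+1%:R^-1 < ratr (q x) < x)) => n.
  suff [f fP] : {f : R -> rat & forall x : R, x - n.+1%:R^-1 < ratr (f x) < x} by exists f.
  apply: (@choice _ _ (fun (x : R) (q : rat) => x - n.+1%:R^-1 < ratr q < x)) => x.
  have [|q] := @rat_in_itvoo R (x - n.+1%:R^-1) x; first by rewrite ltrBlDr ltrDl invr_gt0.
  by rewrite in_itv; exists q.
have [qb qbE] : {qb : nat -> R -> rat &
    forall n (x : R), x < ratr (qb n x) < x + n.+1%:R^-1}.
  apply: (@choice _ _ (fun n (q : R -> rat) => forall x : R, x < ratr (q x) < x + n.+1%:R^-1)) => n.
  suff [f fP] : {f : R -> rat & forall x : R, x < ratr (f x) < x + n.+1%:R^-1} by exists f.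
  apply: (@choice _ _ (fun (x : R) (q : rat) => x < ratr q < x + n.+1%:R^-1)) => x.
  have [|q] := @rat_in_itvoo R x (x + n.+1%:R^-1); first by rewrite ltrDl invr_gt0.
  by rewrite in_itv; exists q.
pose L n := [seq (qa n x, qb n x) | x <- s].
have nthL n i : (i < size s)%N -> nth q0 (L n) i = (qa n (nth 0 s i), qb n (nth 0 s i)).
  by move=> si; rewrite (nth_map (0 : R)).
have sL n : size (L n) = size s by rewrite size_map.
have muL n : order_box (L n) mu.
  apply/(order_boxP _ ss sE); rewrite sL; split=> // i si; rewrite nthL//=.
  by have /andP[_ ->] := qaE n (nth 0 s i); have /andP[-> _] := qbE n (nth 0 s i).
apply: contrapT => nLU.
have [nu nuP] : {nu : nat -> pointMeasure R & forall n, order_box (L n) (nu n) /\ ~ U (nu n)}.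
  apply: (@choice _ _ (fun n nu => order_box (L n) nu /\ ~ U nu)) => n.
  apply: contrapT => nex; apply: nLU; exists (L n) => // x Lx.
  by apply: contrapT => nUx; apply: nex; exists x.
have [t tP] : {t : nat -> seq R & forall n, sorted <=%O (t n) /\
    forall A : set mR, measurable A -> nu n A = pm_of_seq (t n) A}.
  apply: (@choice _ _ (fun n t => sorted <=%O t /\
    forall A : set mR, measurable A -> nu n A = pm_of_seq t A)) => n.
  exact: pm_sorted.
have cnu : nu n @[n --> \oo] --> mu.
  apply: pm_cvg => -[g [cg bg]] /=.
  have bmg : bmeas (g : mR -> R) by split=> //; exact: continuous_measurable_fun.
  have intE (m : pointMeasure R) r : size r = size s ->
      (forall A : set mR, measurable A -> m A = pm_of_seq r A) ->
      \int[m]_x g x = \sum_(i < size s) g (nth 0 r i).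
    move=> sr rE; rewrite (Rint_pm_eq _ rE) Rint_pm_seq//.
    by rewrite (big_nth 0) big_mkord sr.
  have tL n : size (t n) = size s /\ forall i, (i < size s)%N ->
      ratr (qa n (nth 0 s i)) < nth 0 (t n) i < ratr (qb n (nth 0 s i)).
    have [st tE] := tP n.
    have [+ H] := (order_boxP (L n) st tE).1 (nuP n).1; rewrite sL => ->; split=> // i si.
    by have := H i; rewrite sL nthL// => /(_ si).
  rewrite (intE mu s)//.
  under eq_fun => n do rewrite (intE (nu n) (t n) (tL n).1 (tP n).2).
  apply: cvg_big => [|i _]; first exact: add_continuous.
  apply: continuous_cvg; first exact: cg.
  have hinv : (fun n => n.+1%:R^-1) @ \oo --> (0 : R) by exact: cvg_harmonic.
  apply: (@squeeze_cvgr _ _ _ _ (fun n => nth 0 s i - n.+1%:R^-1) (fun n => nth 0 s i + n.+1%:R^-1)).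
  - apply: nearW => n; have [_ /(_ i (ltn_ord i))/andP[h1 h2]] := tL n.
    have /andP[h3 _] := qaE n (nth 0 s i); have /andP[_ h4] := qbE n (nth 0 s i).
    by rewrite (ltW (lt_trans h3 h1)) (ltW (lt_trans h2 h4)).
  - by rewrite -[X in _ --> X]subr0; apply: cvgB; [exact: cvg_cst|exact: hinv].
  - by rewrite -[X in _ --> X]addr0; apply: cvgD; [exact: cvg_cst|exact: hinv].
have : \forall n \near \oo, U (nu n) by apply: cnu; apply: open_nbhs_nbhs.
by move=> [n _ /(_ n (leqnn n))]; exact: (nuP n).2.
Qed.

(** An open set is the union of the boxes it contains, enumerated through their codes. *)
Lemma open_sigma_count_sets (U : set (pointMeasure R)) : open U -> <<s count_sets >> U.
Proof.
move=> oU; pose F n := if unpickle n is Some L then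
  (if pselect (order_box L `<=` U) then order_box L else set0) else set0.
have -> : U = \bigcup_n F n.
  apply/seteqP; split => [mu Umu|mu [n _]].
    have [L Lmu LU] := open_order_box oU Umu.
    by exists (pickle L) => //; rewrite /F pickleK; case: pselect.
  by rewrite /F; case: unpickle => // L; case: pselect => // LU; exact: LU.
apply: sigma_algebra_bigcup => n; rewrite /F.
case: unpickle => [L|]; last exact: sigma_algebra0.
by case: pselect => ?; [exact: sigma_order_box|exact: sigma_algebra0].
Qed.

Lemma measurable_pmE : @measurable _ (pointMeasure R) = <<s count_sets >>.
Proof.
apply/seteqP; split => A; last first.
  apply: smallest_sub; first exact: sigma_algebra_measurable.
  exact: measurable_count_sets.
apply: smallest_sub; first exact: smallest_sigma_algebra.
exact: open_sigma_count_sets.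
Qed.

(** Products of [pmexp h] with powers of exp(-mu B) are again of this form, so [bp_indic_lt]
    produces the indicators of the events that [mu B] is at least j. The spare factor [pmexp h] lets
    the induction treat several such events at once. *)
Lemma pm_monotone_class (G : (pointMeasure R -> R) -> Prop) : bp_closed G ->
  (forall h, V0 h -> G (pmexp h)) -> forall F, bmeas F -> G F.
Proof.
move=> Gbp Gh.
have G1 : G (fun=> 1).
  have V1 : V0 (fun _ : R => 1) by apply: V0_cst; rewrite ltr01 lexx.
  by have := Gh _ V1; congr G; apply/funext => mu; rewrite pmexp1.
suff GL L : measurable_seq L -> forall h, V0 h ->
    G (fun mu => pmexp h mu * \1_(count_set L) mu).
  apply: (bp_pi Gbp measurable_pmE count_sets_setI G1) => _ [L mL ->].
  have V1 : V0 (fun _ : R => 1) by apply: V0_cst; rewrite ltr01 lexx.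
  by have := GL L mL _ V1; congr G; apply/funext => mu; rewrite pmexp1 mul1r.
elim: L => [_ h Vh|[B j] L IH /= [mB /IH{}IH] h Vh].
  have := Gh h Vh; congr G; apply/funext => mu.
  by rewrite indicE in_setT mulr1.
pose y mu : R := expR (- fine (mu B)).
have ind01 mu : 0 <= (\1_(count_set L) mu : R) <= 1.
  by rewrite indicE; case: (_ \in _); rewrite ?ler01 ?lexx.
have fB mu : 0 <= fine (mu B) by rewrite fine_ge0// measure_ge0.
(* [mu B] is an integer, so the threshold j - 1/2 separates the values from j on from those up to j
   - 1. *)
have := @bp_indic_lt _ _ G Gbp (fun mu => pmexp h mu * \1_(count_set L) mu) y
  (expR (2^-1 - j%:R)) (expR_gt0 _).
rewrite (_ : (fun mu => _ * (y mu < _)%R%:R) =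
    fun mu => pmexp h mu * \1_(count_set ((B, j) :: L)) mu).
  apply.
  - move=> mu; have /andP[i0 i1] := ind01 mu.
    by rewrite mulr_ge0 ?(ltW (pmexp_gt0 _ _))//= mulr_ile1// ?pmexp_le1// ltW// pmexp_gt0.
  - by move=> mu; rewrite expR_ge0/= -[leRHS]expR0 ler_expR oppr_le0.
  - move=> i.
    have [h' Vh' h'E] : exists2 h', V0 h' & forall mu, pmexp h' mu = pmexp h mu * y mu ^+ i.
      elim: i => [|i [h' Vh' h'E]]; first by exists h => // mu; rewrite mulr1.
      have Vy : V0 (fun x => expR (- \1_B x)).
        by apply: V0_expR; [exact: bmeas_indic|move=> x; rewrite indicE].
      exists (fun x => h' x * expR (- \1_B x)); first exact: V0M.
      by move=> mu; rewrite pmexpM// h'E exprSr mulrA pmexp_indic.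
    have := IH _ Vh'; congr G; apply/funext => mu; rewrite h'E; ring.
apply/funext => mu; rewrite -mulrA; congr (_ * _) => /=.
rewrite !indicE in_setI mulrC.
have -> : (y mu < expR (2^-1 - j%:R)) = (mu \in [set nu : pointMeasure R | (j%:R%:E <= nu B)%E]).
  rewrite /y ltr_expR; have [k kE] := pm_integer mu mB; rewrite kE/=.
  apply/idP/idP => [hk|/set_mem/=]; [apply/mem_set => /=|]; rewrite kE lee_fin ler_nat.
    rewrite leqNgt; apply/negP => kj; move: hk; apply/negP; rewrite -leNgt.
    have : (k.+1%:R <= j%:R :> R) by rewrite ler_nat.
    by rewrite -natr1; lra.
  by rewrite -(ler_nat R) => hk; lra.
by do 2 case: (_ \in _); rewrite ?mulr0 ?mul0r ?mulr1.
Qed.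

End PointMeasureMonotoneClass.

(** * The law of one generation *)

Section PointMeasureMaps.
Variable R : realType.
Local Notation mR := (measurableTypeR R).

Lemma measurable_pmP d (T : measurableType d) (f : T -> pointMeasure R) :
  (forall B : set mR, measurable B -> measurable_fun setT (fun x => f x B)) ->
  measurable_fun setT f.
Proof.
move=> mf; apply: (measurability (@count_sets R)); first exact: measurable_pmE.
move=> _ [_ [L + ->] <-]; elim: L => [_|[B j] L IH /= [mB /IH{}IH]].
  by rewrite preimage_setT setTI; exact: measurableT.
rewrite setTI preimage_setI; rewrite setTI in IH; apply: measurableI => //.
have := emeasurable_fun_c_infty measurableT (mf B mB) (j%:R%:E).
by rewrite setTI.
Qed.

Lemma measurable_pm_add :
  measurable_fun setT (fun mn : pointMeasure R * pointMeasure R => pm_add mn.1 mn.2).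
Proof.
apply: measurable_pmP => B mB; under eq_fun do rewrite pm_addE.
by apply: emeasurable_funD; apply: measurableT_comp (measurable_pm_eval mB) _.
Qed.

Lemma measurable_pm_dirac_add :
  measurable_fun setT (fun zn : mR * pointMeasure R => pm_add (pm_dirac zn.1) zn.2).
Proof.
apply: measurable_pmP => B mB; under eq_fun do rewrite pm_addE.
apply: emeasurable_funD; last exact: measurableT_comp (measurable_pm_eval mB) _.
rewrite (_ : (fun _ => _) = (fun z : mR => (\1_B z)%:E) \o fst).
  apply: measurableT_comp => //; apply/measurable_EFinP; exact: measurable_indic.
by apply/funext => z /=; rewrite diracE indicE.
Qed.

Lemma nonnull_dirac x : nonnull (pm_dirac (x : R)).
Proof. by rewrite /nonnull/= diracT; exact/eqP. Qed.

Lemma measurable_nonnull : measurable (@nonnull R).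
Proof.
have := emeasurable_neq measurableT (measurable_pm_eval (@measurableT _ mR)) 0%E.
by rewrite setTI; congr measurable; apply/seteqP; split=> mu /= /eqP.
Qed.

Lemma pm_nullE (mu : pointMeasure R) : ~ nonnull mu ->
  forall A : set mR, measurable A -> mu A = pm_zero R A.
Proof.
move=> /contrapT mu0 A mA; apply/eqP; rewrite eq_le measure_ge0 andbT.
by rewrite -[leRHS]mu0 le_measure// inE.
Qed.

End PointMeasureMaps.

Section OffspringLaw.
Variables (R : realType) (p : probability nat R).
Variable P : R.-pker (measurableTypeR R) ~> (measurableTypeR R).
Local Notation mR := (measurableTypeR R).
Local Notation gpm := (giry (pointMeasure R) R).

(** A name of its own lets [P y] carry the probability structure that the Giry monad asks for. *)
Definition step_law (y : mR) : set mR -> \bar R := P y.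

HB.instance Definition _ y := Measure.on (step_law y).

HB.instance Definition _ y := Measure_isProbability.Build _ _ _ (step_law y)
  (prob_kernel (s := P) y).

(** Turning the recursive expectations into integrals against measures makes linearity, Fubini and
    dominated convergence available for them. *)
Fixpoint siblings_law (y : R) (j : nat) : gpm :=
  if j is k.+1 then
    giry_map (@measurable_pm_dirac_add R) (giry_prod (step_law y : giry mR R, siblings_law y k))
  else giry_ret (pm_zero R).

Lemma giry_int_map_prod d1 d2 (T1 : measurableType d1) (T2 : measurableType d2)
    (f : T1 * T2 -> pointMeasure R) (mf : measurable_fun setT f)
    (m1 : giry T1 R) (m2 : giry T2 R) (F : pointMeasure R -> \bar R) :
  measurable_fun setT F -> (forall nu, 0 <= F nu)%E ->
  (\int[giry_map mf (giry_prod (m1, m2))]_nu F nu =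
   \int[m1]_x \int[m2]_y F (f (x, y)))%E.
Proof.
move=> mF F0; transitivity (giry_int (giry_prod (m1, m2)) (F \o f)).
  exact: giry_int_map.
by apply: giry_int_prod1; [exact: (measurableT_comp mF mf)|move=> x; exact: F0].
Qed.

Lemma siblings_expectationE y j (F : pointMeasure R -> \bar R) :
  measurable_fun setT F -> (forall nu, 0 <= F nu)%E ->
  siblings_expectation P y j F = (\int[siblings_law y j]_nu F nu)%E.
Proof.
elim: j F => [|j IH] F mF F0 /=; first by rewrite integral_dirac// diracT mul1e.
have mD := @measurable_pm_dirac_add R.
rewrite (giry_int_map_prod mD)//.
apply: eq_integral => z _; apply: IH => //.
apply: (measurableT_comp mF).
exact: (measurable_fun_pair2 z mD).
Qed.

Lemma measurable_siblings_law y : measurable_fun [set: nat] (siblings_law y).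
Proof. by []. Qed.

Definition offspring_law (y : R) : gpm :=
  giry_bind (p : giry nat R) (measurable_siblings_law y).

Arguments offspring_law : simpl never.

Lemma offspring_expectationE y (F : pointMeasure R -> \bar R) :
  measurable_fun setT F -> (forall nu, 0 <= F nu)%E ->
  offspring_expectation p P y F = (\int[offspring_law y]_nu F nu)%E.
Proof.
move=> mF F0; transitivity (giry_int (p : giry nat R) (fun j => giry_int (siblings_law y j) F)).
  by apply: eq_integral => j _; exact: siblings_expectationE.
exact/esym/giry_int_bind.
Qed.

Fixpoint generation_law (s : seq R) : gpm :=
  if s is x :: s' then
    giry_map (@measurable_pm_add R) (giry_prod (offspring_law x, generation_law s'))
  else giry_ret (pm_zero R).

Lemma generation_expectationE s (F : pointMeasure R -> \bar R) :
  measurable_fun setT F -> (forall nu, 0 <= F nu)%E ->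
  generation_expectation p P s F = (\int[generation_law s]_nu F nu)%E.
Proof.
elim: s F => [|x s IH] F mF F0 /=; first by rewrite integral_dirac// diracT mul1e.
rewrite (giry_int_map_prod (@measurable_pm_add R))//.
have mFa := measurableT_comp mF (@measurable_pm_add R).
have inner nu : generation_expectation p P s (fun nu' => F (pm_add nu nu')) =
    (\int[generation_law s]_nu' F (pm_add nu nu'))%E.
  apply: IH => //.
  exact: (measurable_fun_pair2 nu mFa).
rewrite offspring_expectationE.
- by apply: eq_integral => nu _; exact: inner.
- under eq_fun do rewrite inner.
  pose f (mn : pointMeasure R * pointMeasure R) := F (pm_add mn.1 mn.2).
  exact: (@measurable_fun_fubini_tonelli_F _ _ _ _ _ (generation_law s) f mFa (fun mn => F0 _)).
- by move=> nu; rewrite inner; apply: integral_ge0.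
Qed.

Lemma transitionE mu (B : set (pointMeasure R)) : measurable B ->
  transition p P mu B = generation_law (atoms mu) B.
Proof.
move=> mB; rewrite /transition generation_expectationE.
- by rewrite integral_indic// setIT.
- by apply/measurable_EFinP; exact: measurable_indic.
- by move=> nu; rewrite lee_fin.
Qed.

Definition step_op (h : R -> R) (x : R) : R := \int[P x]_y h y.

(** An integral, so that comparison and convergence theorems apply directly; it is matched with the
    series [offspring_gf] only at 0. *)
Definition offspring_pgf (s : R) : R := \int[p]_j s ^+ j.

Definition gen_op (h : R -> R) (x : R) : R := offspring_pgf (step_op h x).

Lemma step_fin x : (P x setT < +oo)%E.
Proof. by rewrite prob_kernel ltry. Qed.

Lemma p_fin : (p setT < +oo)%E.
Proof. by rewrite probability_setT ltry. Qed.

Lemma step_op_cst c x : step_op (fun=> c) x = c.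
Proof. by rewrite /step_op Rintegral_cst// prob_kernel/= mulr1. Qed.

Lemma step_op_le (h1 h2 : mR -> R) x : bmeas h1 -> bmeas h2 ->
  (forall y, h1 y <= h2 y) -> step_op h1 x <= step_op h2 x.
Proof. by move=> b1 b2 h12; apply: Rint_le => //; exact: step_fin. Qed.

Lemma step_op_bounds (h : mR -> R) a b x : bmeas h -> (forall y, a <= h y <= b) ->
  a <= step_op h x <= b.
Proof.
move=> bh hab; apply/andP; split.
  rewrite -(step_op_cst a x); apply: step_op_le => //; first exact: bmeas_cst.
  by move=> y; case/andP: (hab y).
rewrite -(step_op_cst b x); apply: step_op_le => //; first exact: bmeas_cst.
by move=> y; case/andP: (hab y).
Qed.

Lemma bmeas_step_op (h : mR -> R) : bmeas h -> bmeas (step_op h : mR -> R).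
Proof.
move=> bh; have [mh [C hC]] := bh.
have bhC := bmeasD bh (bmeas_cst C).
have hC0 y : 0 <= h y + C by have := hC y; rewrite ler_norml -lerBlDr sub0r => /andP[].
split; last first.
  exists C => x; rewrite ler_norml; apply: step_op_bounds => // y.
  by rewrite -ler_norml.
have -> : step_op h = (fun x => fine (\int[P x]_y (h y + C)%:E)%E - C).
  apply/funext => x; apply/eqP; rewrite -subr_eq opprK; apply/eqP.
  rewrite -[RHS]/(\int[P x]_y (h y + C)) RintD//; [|exact: step_fin|exact: bmeas_cst].
  by congr (_ + _); rewrite [RHS](step_op_cst C x).
apply: measurable_funB => //.
apply: measurableT_comp => //.
apply: (measurable_fun_integral_kernel (l := fun x => P x)).
- by move=> U mU; exact: measurable_kernel.
- by move=> y; rewrite lee_fin.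
- by apply/measurable_EFinP; case: bhC.
Qed.

Lemma bmeas_pow (s : R) : 0 <= s <= 1 -> bmeas (fun j : nat => s ^+ j).
Proof.
move=> /andP[s0 s1]; split => //; exists 1 => j.
by rewrite normrX ger0_norm// exprn_ile1.
Qed.

Lemma offspring_pgf_bounds s : 0 <= s <= 1 -> 0 <= offspring_pgf s <= 1.
Proof.
move=> s01; have /andP[s0 s1] := s01; apply/andP; split.
  by apply: Rintegral_ge0 => j _; rewrite exprn_ge0.
have <- : \int[p]_j (1 : R) = 1 by rewrite Rintegral_cst// mul1r; exact: (congr1 fine (probability_setT p)).
apply: Rint_le; [exact: p_fin|exact: bmeas_pow|exact: bmeas_cst|].
by move=> j; rewrite exprn_ile1.
Qed.

Lemma offspring_pgf_le s t : 0 <= s -> s <= t -> t <= 1 -> offspring_pgf s <= offspring_pgf t.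
Proof.
move=> s0 st t1; apply: Rint_le; [exact: p_fin|apply: bmeas_pow|apply: bmeas_pow|].
- by rewrite s0 (le_trans st).
- by rewrite t1 (le_trans s0).
- by move=> j; rewrite lerXn2r ?nnegrE// (le_trans s0).
Qed.

Lemma offspring_pgf0 : offspring_pgf 0 = offspring_mass p 0.
Proof.
rewrite /offspring_pgf /offspring_mass -(setIT [set 0%N]) -integral_indic//.
congr fine; apply: eq_integral => j _; congr (_%:E).
by rewrite indicE; case: j => [|j]; [rewrite mem_set|rewrite memNset// expr0n].
Qed.

(** f(g x) is the limit of polynomials in g x, namely the integrals of j |-> (g x)^j cut off at
    N. *)
Lemma measurable_offspring_pgf (g : mR -> R) : measurable_fun setT g ->
  (forall x, 0 <= g x <= 1) -> measurable_fun setT (fun x => offspring_pgf (g x)).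
Proof.
move=> mg g01.
have cut N (x : mR) : \int[p]_j (\sum_(i < N) g x ^+ i * \1_[set (i : nat)] j) =
    \sum_(i < N) g x ^+ i * fine (p [set (i : nat)]).
  elim: N => [|N IH].
    rewrite big_ord0 /Rintegral (eq_integral (cst 0%E)) ?integral0// => j _.
    by rewrite big_ord0.
  rewrite big_ord_recr/= -IH.
  have bi i : bmeas (fun j => g x ^+ i * \1_[set (i : nat)] j : R).
    apply: bmeasM; first exact: bmeas_cst.
    exact: bmeas_indic.
  transitivity (\int[p]_j (\sum_(i < N) g x ^+ i * \1_[set (i : nat)] j
      + g x ^+ N * \1_[set N] j)).
    by apply: eq_Rintegral => j _; rewrite big_ord_recr.
  have bS : bmeas (fun j => \sum_(i < N) g x ^+ i * \1_[set (i : nat)] j : R).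
    elim: (N) => [|M IHM].
      by rewrite (_ : (fun _ => _) = fun=> 0); [exact: bmeas_cst|apply/funext => j; rewrite big_ord0].
    rewrite (_ : (fun _ => _) = fun j => \sum_(i < M) g x ^+ i * \1_[set (i : nat)] j
      + g x ^+ M * \1_[set M] j); first exact: bmeasD.
    by apply/funext => j; rewrite big_ord_recr.
  rewrite (RintD p_fin bS (bi N)) (RintZ p_fin); last exact: bmeas_indic.
  by rewrite /Rintegral integral_indic// setIT.
apply: (@measurable_fun_cvg _ _ _ _ (fun N x => \sum_(i < N) g x ^+ i * fine (p [set (i : nat)]))).
  move=> N; apply: measurable_sum => i; apply: measurable_funM => //.
  exact: measurable_funX.
move=> x _; under eq_fun do rewrite -cut.
have sumE N j : \sum_(i < N) g x ^+ i * \1_[set (i : nat)] j = if (j < N)%N then g x ^+ j else 0.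
  have Z (i : 'I_N) : (i : nat) != j -> g x ^+ i * \1_[set (i : nat)] j = 0.
    by move=> ij; rewrite indicE memNset ?mulr0// => /= ji; rewrite ji eqxx in ij.
  case: ltnP => jN; last first.
    by rewrite big1// => i _; apply: Z; rewrite ltn_eqF// (leq_trans _ jN).
  rewrite (bigD1 (Ordinal jN))//= indicE mem_set// mulr1 big1; first by rewrite addr0.
  by move=> i iN; apply: Z; move: iN; apply: contra => /eqP ij; apply/eqP/val_inj.
have /andP[g0 g1] := g01 x.
apply: (@Rint_bcvg _ _ _ _ _ _ _ 1); [exact: p_fin|by []| |].
- move=> N j; rewrite sumE; case: ifP => _; rewrite ?normr0//.
  by rewrite normrX ger0_norm// exprn_ile1.
- move=> j; apply: cvg_near_cst; near=> N; rewrite sumE ifT//.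
  by near: N; exists j.+1.
Unshelve. all: by end_near.
Qed.

End OffspringLaw.

(** * Bounds on the offspring generating function *)

Section OffspringMoments.
Variables (R : realType) (p : probability nat R).
Hypothesis C1p : C1 p.
Local Notation m := (offspring_mean p).
Local Notation p0 := (offspring_mass p 0).
Local Notation f := (offspring_pgf p).

Lemma mean_gt0 : 0 < m. Proof. by case: C1p => /andP[]. Qed.
Lemma mean_lt1 : m < 1. Proof. by case: C1p => /andP[]. Qed.

Lemma integrable_moment (k : nat) :
  p.-integrable setT (EFin \o (fun j : nat => (j%:R : R) ^+ k)).
Proof.
apply/integrableP; split; first by [].
rewrite (eq_integral (fun j : nat => ((j%:R : R) ^+ k)%:E)); first by case: C1p => _ /(_ k).
by move=> j _ /=; rewrite ger0_norm// exprn_ge0.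
Qed.

Definition second_moment : R := \int[p]_j (j%:R : R) ^+ 2.
Local Notation K := second_moment.

Lemma second_moment_ge0 : 0 <= K.
Proof. by apply: Rintegral_ge0 => j _; rewrite exprn_ge0. Qed.

Lemma meanE : m = \int[p]_j (j%:R : R) ^+ 1.
Proof. by apply: eq_Rintegral => j _; rewrite expr1. Qed.

Lemma one_sub_pgf (u : R) : 0 <= u <= 1 ->
  1 - f (1 - u) = \int[p]_j (1 - (1 - u) ^+ j).
Proof.
move=> /andP[u0 u1].
rewrite RintB; [|exact: p_fin|exact: bmeas_cst|apply: bmeas_pow; lra].
congr (_ - _); rewrite Rintegral_cst// mul1r.
by apply/esym; exact: (congr1 fine (probability_setT p)).
Qed.

Lemma integrable_one_sub_pow (u : R) : 0 <= u <= 1 ->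
  p.-integrable setT (EFin \o (fun j => 1 - (1 - u) ^+ j)).
Proof.
move=> /andP[u0 u1]; apply: bmeas_integrable; first exact: p_fin.
by apply: bmeasB; [exact: bmeas_cst|apply: bmeas_pow; lra].
Qed.

(** Bernoulli's inequality and a second-order bound in which the factor 1/2 of Taylor's formula is
    dropped. *)
Lemma pow_bounds (u : R) (j : nat) : 0 <= u <= 1 ->
  1 - j%:R * u <= (1 - u) ^+ j <= 1 - j%:R * u + j%:R ^+ 2 * u ^+ 2.
Proof.
move=> /andP[u0 u1]; elim: j => [|j /andP[IH1 IH2]].
  by rewrite expr0 mul0r expr0n mul0r subr0 addr0 lexx.
have j0 : 0 <= j%:R :> R by [].
rewrite exprS -natr1; apply/andP; split; nra.
Qed.

Lemma pgf_upper (u : R) : 0 <= u <= 1 -> 1 - f (1 - u) <= m * u.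
Proof.
move=> u01; have /andP[u0 u1] := u01.
rewrite one_sub_pgf// mulrC meanE -RintegralZl//; last exact: integrable_moment.
apply: le_Rintegral => //; first exact: integrable_one_sub_pow.
  exact: (integrableZl measurableT u (integrable_moment 1)).
move=> j _; have /andP[h _] := pow_bounds j u01.
by rewrite expr1; lra.
Qed.

Lemma pgf_lower (u : R) : 0 <= u <= 1 -> m * u - K * u ^+ 2 <= 1 - f (1 - u).
Proof.
move=> u01; have /andP[u0 u1] := u01.
rewrite one_sub_pgf// mulrC (mulrC K) meanE.
have i1 : p.-integrable setT (EFin \o (fun j : nat => u * (j%:R : R) ^+ 1)).
  exact: (integrableZl measurableT u (integrable_moment 1)).
have i2 : p.-integrable setT (EFin \o (fun j : nat => u ^+ 2 * (j%:R : R) ^+ 2)).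
  exact: (integrableZl measurableT (u ^+ 2) (integrable_moment 2)).
rewrite -!RintegralZl//; [|exact: integrable_moment|exact: integrable_moment].
rewrite -RintegralB//.
apply: le_Rintegral => //; [exact: (integrableB measurableT i1 i2)|exact: integrable_one_sub_pow|].
move=> j _; have /andP[_ h] := pow_bounds j u01.
by rewrite expr1; lra.
Qed.

Lemma pgf_ge_mass0 (s : R) : 0 <= s <= 1 -> p0 <= f s.
Proof.
move=> /andP[s0 s1]; rewrite -(offspring_pgf0 p); exact: offspring_pgf_le.
Qed.

Lemma mass0_gt0 : 0 < p0.
Proof.
have := pgf_upper (u := 1); rewrite lexx ler01 subrr offspring_pgf0 => /(_ isT).
by have := mean_lt1; lra.
Qed.

(** If p_0 were 1, f would be 1 on [0, 1] and [pgf_lower] would give m u <= K u^2 there, which fails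
    for small u. *)
Lemma mass0_lt1 : p0 < 1.
Proof.
rewrite ltNge; apply/negP => p01.
have H (u : R) : 0 <= u <= 1 -> m * u <= K * u ^+ 2.
  move=> u01; have := pgf_lower u01.
  have := pgf_ge_mass0 (s := 1 - u); have /andP[u0 u1] := u01.
  by move=> /(_ ltac:(lra)); lra.
have m0 := mean_gt0; have K0 := second_moment_ge0.
(* Here m u = (K + 1) u^2, which exceeds K u^2. *)
pose u := m / (K + 1).
have u0 : 0 < u by rewrite divr_gt0//; lra.
have Ku : (K + 1) * u = m by rewrite mulrC divfK//; apply: lt0r_neq0; lra.
have m1 := mean_lt1.
by have [] : 0 <= u <= 1 /\ ~ (m * u <= K * u ^+ 2); [split; nra|move=> /H].
Qed.

(** 1 - (1 - u)^j >= u for every j >= 1. Unlike [pgf_lower], the bound is positive for every u in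
    (0, 1], which keeps extinction probabilities below 1. *)
Lemma pgf_lower_mass0 (u : R) : 0 <= u <= 1 -> (1 - p0) * u <= 1 - f (1 - u).
Proof.
move=> u01; have /andP[u0 u1] := u01.
have -> : (1 - p0) * u = \int[p]_j (u * (1 - 0 ^+ j)).
  have b0 : bmeas (fun j : nat => 1 - (0 : R) ^+ j).
    by apply: bmeasB; [exact: bmeas_cst|apply: bmeas_pow; rewrite lexx ler01].
  rewrite (RintZ (p_fin p) u b0) mulrC -(offspring_pgf0 p).
  have := one_sub_pgf (u := 1); rewrite lexx ler01 subrr => /(_ isT) ->; congr (_ * _).
rewrite one_sub_pgf//; apply: Rint_le; first exact: p_fin.
- apply: bmeasM; first exact: bmeas_cst.
  by apply: bmeasB; [exact: bmeas_cst|apply: bmeas_pow; rewrite lexx ler01].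
- by apply: bmeasB; [exact: bmeas_cst|apply: bmeas_pow; lra].
move=> [|j]; first by rewrite !expr0 subrr mulr0.
rewrite expr0n subr0 mulr1 exprS.
have : (1 - u) ^+ j <= 1 by rewrite exprn_ile1//; lra.
have : 0 <= (1 - u) ^+ j by rewrite exprn_ge0//; lra.
by nra.
Qed.

Lemma offspring_gf0 : offspring_gf p 0 = p0.
Proof.
apply: cvg_lim => //; apply: cvg_near_cst; near=> n.
have n0 : (0 < n)%N by near: n; exists 1%N.
rewrite /series/= big_ltn// expr0 mulr1 big_nat_cond big1 ?addr0// => i /andP[/andP[i0 _] _].
by rewrite expr0n gtn_eqF// mulr0.
Unshelve. all: by end_near.
Qed.

End OffspringMoments.

(** * Generating functionals along the branching chain *)

Section Chain.
Variables (R : realType) (p : probability nat R).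
Variable P : R.-pker (measurableTypeR R) ~> (measurableTypeR R).
Hypothesis C1p : C1 p.
Local Notation mR := (measurableTypeR R).
Local Notation G := (gen_op p P).
Local Notation Pop := (step_op P).

(** The uniform lower bound is p_0, which is positive because the mean is below 1. *)
Lemma V0_gen_op h : V0 h -> V0 (G h).
Proof.
move=> Vh; have /V0P[mh [e e0 eh]] := Vh; have bh := V0_bmeas Vh.
have Pb x : e <= Pop h x <= 1 by exact: step_op_bounds.
have Pb0 x : 0 <= Pop h x <= 1 by case/andP: (Pb x) => ? ->; rewrite (le_trans (ltW e0)).
have mP : measurable_fun setT (Pop h : mR -> R) by case: (bmeas_step_op P bh).
apply/V0P; split; first exact: (measurable_offspring_pgf p mP Pb0).
exists (offspring_mass p 0); first exact: mass0_gt0.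
move=> x; rewrite pgf_ge_mass0//=.
by case/andP: (offspring_pgf_bounds p (Pb0 x)).
Qed.

Lemma V0_iter_gen_op n h : V0 h -> V0 (iter n G h).
Proof. by move=> Vh; elim: n => //= n IH; exact: V0_gen_op. Qed.

Lemma measurable_pmexpE h : V0 h ->
  measurable_fun setT (fun mu : pointMeasure R => (pmexp h mu)%:E).
Proof. by move=> Vh; apply/measurable_EFinP; case: (bmeas_pmexp Vh). Qed.

Lemma pmexpE_ge0 h (mu : pointMeasure R) : (0 <= (pmexp h mu)%:E)%E.
Proof. by rewrite lee_fin ltW// pmexp_gt0. Qed.

Lemma siblings_pmexp h (y : R) j : V0 h ->
  (\int[siblings_law P y j]_nu (pmexp h nu)%:E = ((Pop h y) ^+ j)%:E)%E.
Proof.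
move=> Vh; elim: j => [|j IH].
  rewrite /= integral_dirac//; last exact: measurable_pmexpE.
  by rewrite diracT mul1e pmexp_zero.
have mD := @measurable_pm_dirac_add R.
rewrite [LHS](giry_int_map_prod mD _ _ (measurable_pmexpE Vh) (pmexpE_ge0 h)).
have bh := V0_bmeas Vh.
have h0 z : 0 <= h z by case/andP: (V0_bounds z Vh) => /ltW.
have P0 : 0 <= Pop h y by apply: Rintegral_ge0 => z _.
transitivity (\int[P y]_z ((h z)%:E * ((Pop h y) ^+ j)%:E))%E.
  apply: eq_integral => z _ /=.
  under eq_integral do rewrite pmexp_add// pmexp_dirac// EFinM.
  rewrite ge0_integralZl//; first by rewrite IH.
  - exact: measurable_pmexpE.
  - by move=> nu _; exact: pmexpE_ge0.
  - by rewrite lee_fin.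
rewrite ge0_integralZr//.
- by rewrite (Rint_EFin (step_fin P y) bh) -EFinM exprS.
- by apply/measurable_EFinP; case: bh.
- by move=> z _; rewrite lee_fin.
- by rewrite lee_fin exprn_ge0.
Qed.

Lemma offspring_pmexp h (y : R) : V0 h ->
  (\int[offspring_law p P y]_nu (pmexp h nu)%:E = (G h y)%:E)%E.
Proof.
move=> Vh.
transitivity (giry_int (p : giry nat R)
    (fun j => giry_int (siblings_law P y j) (fun nu => (pmexp h nu)%:E))).
  by apply: giry_int_bind; [exact: measurable_pmexpE|exact: pmexpE_ge0].
rewrite /giry_int; under eq_integral do rewrite siblings_pmexp//.
apply: Rint_EFin; first exact: p_fin.
apply: bmeas_pow; apply: step_op_bounds; first exact: V0_bmeas.
by move=> z; case/andP: (V0_bounds z Vh) => /ltW -> ->.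
Qed.

Lemma generation_pmexp h (s : seq R) : V0 h ->
  (\int[generation_law p P s]_nu (pmexp h nu)%:E = (\prod_(x <- s) G h x)%:E)%E.
Proof.
move=> Vh; elim: s => [|x s IH].
  rewrite /= integral_dirac//; last exact: measurable_pmexpE.
  by rewrite diracT mul1e pmexp_zero big_nil.
rewrite [LHS](giry_int_map_prod (@measurable_pm_add R) _ _ (measurable_pmexpE Vh) (pmexpE_ge0 h)).
have G0 z : 0 <= G h z by case/andP: (V0_bounds z (V0_gen_op Vh)) => /ltW.
have p0 : 0 <= \prod_(x <- s) G h x by apply: prodr_ge0.
transitivity (\int[offspring_law p P x]_nu ((pmexp h nu)%:E * (\prod_(x <- s) G h x)%:E))%E.
  apply: eq_integral => nu _ /=.
  under eq_integral do rewrite pmexp_add// EFinM.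
  rewrite ge0_integralZl//; first by rewrite IH.
  - exact: measurable_pmexpE.
  - by move=> nu' _; exact: pmexpE_ge0.
  - exact: pmexpE_ge0.
rewrite ge0_integralZr//.
- by rewrite offspring_pmexp// -EFinM big_cons.
- exact: measurable_pmexpE.
- by move=> nu _; exact: pmexpE_ge0.
Qed.

Lemma atomsP (mu : pointMeasure R) (A : set mR) : measurable A -> mu A = pm_of_seq (atoms mu) A.
Proof. by move: A; rewrite /atoms; case: xgetP => [s _ //|] /(_ _); have [s sE] := pm_atomic mu => /(_ s). Qed.

Definition transition_law (mu : pointMeasure R) : giry (pointMeasure R) R :=
  generation_law p P (atoms mu).

Lemma transition_pmexp h (mu : pointMeasure R) : V0 h ->
  (\int[transition_law mu]_nu (pmexp h nu)%:E = (pmexp (G h) mu)%:E)%E.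
Proof.
move=> Vh; rewrite generation_pmexp// -pmexp_seq; last exact: V0_gen_op.
by congr (_%:E); apply: eq_pmexp => A mA; rewrite -atomsP.
Qed.

Lemma giry_fin (mu : giry (pointMeasure R) R) : (mu setT < +oo)%E.
Proof. by rewrite (le_lt_trans (sprobability_setT (s := mu)))// ltry. Qed.

(** [atoms] is a choice, with no measurability to rely on. For [pmexp h], however, the integral is
    [pmexp (G h) mu], which is measurable, and the monotone class theorem extends this to all
    bounded F. *)
Lemma measurable_transition_int (F : pointMeasure R -> R) : bmeas F ->
  measurable_fun setT (fun mu => \int[transition_law mu]_nu F nu).
Proof.
move=> bF.
suff [] : bmeas F /\ measurable_fun setT (fun mu => \int[transition_law mu]_nu F nu) by [].
move: F bF; apply: pm_monotone_class.
  split=> [a f g [bf mf] [bg mg]|f_ f C fP fC ff].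
    split; first exact: bmeas_lin.
    rewrite (_ : (fun _ => _) = fun mu => a * \int[transition_law mu]_x f x
        + \int[transition_law mu]_x g x).
      by apply: measurable_funD => //; exact: measurable_funM.
    by apply/funext => mu; apply: Rint_lin => //; exact: giry_fin.
  have mf n : measurable_fun setT (f_ n) by case: (fP n) => -[].
  split; first exact: (bmeas_cvg mf fC ff).
  apply: (measurable_fun_cvg (fun n => (fP n).2)) => mu _ /=.
  by apply: (Rint_bcvg _ mf fC) => //; exact: giry_fin.
move=> h Vh; split; first exact: bmeas_pmexp.
rewrite (_ : (fun _ => _) = pmexp (G h)).
  by case: (bmeas_pmexp (V0_gen_op Vh)).
by apply/funext => mu; rewrite /Rintegral transition_pmexp.
Qed.

Lemma measurable_transition_law : measurable_fun setT transition_law.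
Proof.
apply: measurable_giry_codensity => // B mB.
rewrite (_ : (fun _ => _) = (fun mu => (\int[transition_law mu]_nu \1_B nu)%:E)).
  by apply/measurable_EFinP; apply: measurable_transition_int; exact: bmeas_indic.
apply/funext => mu; rewrite -Rint_EFin; [|exact: giry_fin|exact: bmeas_indic].
by rewrite integral_indic// setIT.
Qed.

Variables (d : measure_display) (Omega : measurableType d).
Variable PP : pointMeasure R -> probability Omega R.
Variable Z : nat -> {mfun Omega >-> pointMeasure R}.
Hypothesis bmc : branching_markov_chain p P PP Z.

Lemma measurable_Z n : measurable_fun setT (Z n).
Proof. exact: measurable_funPT. Qed.

Lemma chain_pmexp_step mu n h : nonnull mu -> V0 h ->
  (\int[PP mu]_w (pmexp h (Z n.+1 w))%:E = \int[PP mu]_w (pmexp (G h) (Z n w))%:E)%E.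
Proof.
move=> mu0 Vh; have [_ /(_ n)bmcS] := bmc mu0.
pose law : giry (pointMeasure R) R := giry_map (measurable_Z n) (PP mu : giry Omega R).
pose law1 : giry (pointMeasure R) R := giry_bind law measurable_transition_law.
transitivity (\int[law1]_nu (pmexp h nu)%:E)%E.
  transitivity (\int[pushforward (PP mu) (Z n.+1)]_nu (pmexp h nu)%:E)%E.
    rewrite ge0_integral_pushforward//.
    - exact: measurable_pmexpE.
    - by move=> nu _; exact: pmexpE_ge0.
  apply: eq_measure_integral => B mB _.
  (* The chain is specified on cylinders; here only the last coordinate is constrained. *)
  transitivity (PP mu [set w | forall i, (i <= n.+1)%N ->
      (if i == n.+1 then B else setT) (Z i w)]).
    congr (PP mu _); apply/seteqP; split => w /=.
      by move=> Bw i _; case: eqP => // ->.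
    by move=> /(_ n.+1 (leqnn _)); rewrite eqxx.
  rewrite (bmcS (fun i => if i == n.+1 then B else setT)); last first.
    by move=> i; case: ifP => // _; exact: measurableT.
  rewrite eqxx (_ : [set w | _] = setT); last first.
    by apply/seteqP; split => // w _ i ile; rewrite ltn_eqF// ltnS.
  under eq_integral do rewrite transitionE//.
  transitivity (giry_int law (fun nu => transition_law nu B)).
    apply/esym/(giry_int_map (measurable_Z n)).
      exact: measurableT_comp (measurable_giry_ev mB) measurable_transition_law.
    by move=> nu; exact: measure_ge0.
  apply/esym/(giry_int_map measurable_transition_law); last by move=> nu; exact: measure_ge0.
  exact: measurable_giry_ev.
transitivity (giry_int law (fun nu => giry_int (transition_law nu) (fun nu => (pmexp h nu)%:E))).
  by apply: giry_int_bind; [exact: measurable_pmexpE|exact: pmexpE_ge0].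
have -> : (fun nu => giry_int (transition_law nu) (fun nu => (pmexp h nu)%:E)) =
    (fun nu => (pmexp (G h) nu)%:E).
  by apply/funext => nu; exact: transition_pmexp.
apply: (giry_int_map (measurable_Z n)); last exact: pmexpE_ge0.
by apply: measurable_pmexpE; exact: V0_gen_op.
Qed.

Lemma chain_pmexp mu n h : nonnull mu -> V0 h ->
  \int[PP mu]_w pmexp h (Z n w) = pmexp (iter n G h) mu.
Proof.
move=> mu0 Vh; rewrite /Rintegral; elim: n h Vh => [|n IH] h Vh.
  have [bmc0 _] := bmc mu0.
  transitivity (fine (\int[pushforward (PP mu) (Z 0%N)]_nu (pmexp h nu)%:E)%E).
    rewrite ge0_integral_pushforward//.
    - exact: measurable_pmexpE.
    - by move=> nu _; exact: pmexpE_ge0.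
  rewrite (eq_measure_integral (\d_mu : {measure set _ -> \bar R})); last first.
    by move=> B mB _; exact: bmc0.
  by rewrite integral_dirac ?diracT ?mul1e//; exact: measurable_pmexpE.
by rewrite chain_pmexp_step// IH ?iterSr//; exact: V0_gen_op.
Qed.

End Chain.

(** * Convergence of the renormalised iterates *)

Section Rate.
Variables (R : realType) (p : probability nat R).
Variable P : R.-pker (measurableTypeR R) ~> (measurableTypeR R).
Hypothesis C1p : C1 p.
Local Notation mR := (measurableTypeR R).
Local Notation G := (gen_op p P).
Local Notation Pop := (step_op P).
Local Notation m := (offspring_mean p).
Local Notation K := (second_moment p).
Let m0 : 0 < m := mean_gt0 C1p.
Let m1 : m < 1 := mean_lt1 C1p.

Definition unit_fun (h : mR -> R) := bmeas h /\ forall x, 0 <= h x <= 1.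

Lemma V0_unit_fun h : V0 h -> unit_fun h.
Proof.
move=> Vh; split; first exact: V0_bmeas.
by move=> x; case/andP: (V0_bounds x Vh) => /ltW -> ->.
Qed.

Lemma unit_fun_cst c : 0 <= c <= 1 -> unit_fun (fun=> c).
Proof. by move=> c01; split=> //; exact: bmeas_cst. Qed.

Lemma unit_fun_step h : unit_fun h -> unit_fun (Pop h).
Proof. by move=> [bh h01]; split; [exact: bmeas_step_op|move=> x; exact: step_op_bounds]. Qed.

Lemma unit_fun_gen_op h : unit_fun h -> unit_fun (G h).
Proof.
move=> Uh; have [bP P01] := unit_fun_step Uh.
have G01 x : 0 <= G h x <= 1 by exact: offspring_pgf_bounds.
split=> //; split; first by apply: (measurable_offspring_pgf p _ P01); case: bP.
by exists 1 => x; case/andP: (G01 x) => ? ?; rewrite ger0_norm.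
Qed.

Lemma unit_fun_iter n h : unit_fun h -> unit_fun (iter n G h).
Proof. by move=> Uh; elim: n => //= n IH; exact: unit_fun_gen_op. Qed.

Lemma unit_fun_iter_step k h : unit_fun h -> unit_fun (iter k Pop h).
Proof. by move=> Uh; elim: k => //= n IH; exact: unit_fun_step. Qed.

Lemma step_opB (h : mR -> R) x : bmeas h -> Pop (fun y => 1 - h y) x = 1 - Pop h x.
Proof.
move=> bh; rewrite /step_op (RintB (step_fin P x) (bmeas_cst 1) bh).
by rewrite [X in X - _](step_op_cst P 1 x).
Qed.

Lemma step_opZ (a : R) (h : mR -> R) x : bmeas h -> Pop (fun y => a * h y) x = a * Pop h x.
Proof. by move=> bh; rewrite /step_op (RintZ (step_fin P x)). Qed.

(* If a particle at y is marked with probability 1 - h y, then [m ^+ n * defect n h x]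
   is the probability that generation n of the tree rooted at x has a marked
   particle. *)
Definition defect n (h : R -> R) (x : R) : R := m ^- n * (1 - iter n G h x).

Lemma defectK n h x : 1 - iter n G h x = m ^+ n * defect n h x.
Proof. by rewrite /defect mulrA divff ?mul1r// expf_neq0// gt_eqF. Qed.

Lemma defect_gen_op n h x : defect n (G h) x = m * defect n.+1 h x.
Proof.
rewrite /defect -iterSr exprS invfM mulrA mulrA.
by rewrite divff ?mul1r// gt_eqF.
Qed.

Lemma bmeas_defect n h : unit_fun h -> bmeas (defect n h : mR -> R).
Proof.
move=> Uh; apply: bmeasM; first exact: bmeas_cst.
by apply: bmeasB; [exact: bmeas_cst|case: (unit_fun_iter n Uh)].
Qed.

Let mn0 n : 0 < m ^+ n. Proof. by rewrite exprn_gt0. Qed.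

Lemma defect_ge0 n h x : unit_fun h -> 0 <= defect n h x.
Proof.
move=> Uh; have [_ /(_ x)/andP[_ h1]] := unit_fun_iter n Uh.
by rewrite mulr_ge0 ?invr_ge0 ?(ltW (mn0 n))// subr_ge0.
Qed.

(** 1 - f(1 - u) lies between m u - K u^2 and m u; with u = m^n P(defect n h), division by m^(n+1)
    leaves an error of order m^n. *)
Lemma defect_step n h x : unit_fun h ->
  Pop (defect n h) x - K / m * m ^+ n * Pop (defect n h) x ^+ 2 <= defect n.+1 h x
  <= Pop (defect n h) x.
Proof.
move=> Uh; have [bi i01] := unit_fun_iter n Uh.
have Pd0 : 0 <= Pop (defect n h) x.
  by apply: Rintegral_ge0 => y _; exact: defect_ge0.
have PE : Pop (iter n G h) x = 1 - m ^+ n * Pop (defect n h) x.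
  rewrite -step_opZ; last exact: bmeas_defect.
  rewrite -step_opB; last by apply: bmeasM; [exact: bmeas_cst|exact: bmeas_defect].
  by congr step_op; apply/funext => y; rewrite -defectK opprB addrC subrK.
have [_ /(_ x)/andP[Pi0 Pi1]] := unit_fun_step (unit_fun_iter n Uh).
have u01 : 0 <= m ^+ n * Pop (defect n h) x <= 1 by move: Pi0 Pi1; rewrite PE; lra.
have E : 1 - iter n.+1 G h x = m * m ^+ n * defect n.+1 h x by rewrite defectK exprS.
have up := pgf_upper C1p u01; have lo := pgf_lower C1p u01.
have Gf : iter n.+1 G h x = offspring_pgf p (1 - m ^+ n * Pop (defect n h) x) by rewrite -PE.
rewrite Gf in E; rewrite E in up lo.
set d := defect n.+1 h x in E up lo *; set v := Pop (defect n h) x in E up lo *.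
have mm : 0 < m * m ^+ n by rewrite mulr_gt0.
apply/andP; split; last first.
  by rewrite -(ler_pM2l mm) (le_trans up)// mulrA.
rewrite -(ler_pM2l mm) (le_trans _ lo)//.
have -> : m * m ^+ n * (v - K / m * m ^+ n * v ^+ 2) =
    m * (m ^+ n * v) - (m / m) * (K * (m ^+ n * v) ^+ 2) by field; rewrite gt_eqF.
by rewrite divff ?gt_eqF// mul1r.
Qed.

Lemma defect_le1 n h x : unit_fun h -> defect n h x <= 1.
Proof.
move=> Uh; elim: n x => [|n IH] x.
  have [_ /(_ x)/andP[h0 _]] := Uh.
  by rewrite /defect/= expr0 invr1 mul1r lerBlDr lerDl.
have /andP[_ h2] := defect_step n x Uh; apply: (le_trans h2).
rewrite -(step_op_cst P 1 x); apply: step_op_le => //; first exact: bmeas_defect.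
exact: bmeas_cst.
Qed.

Lemma unit_fun_defect n h : unit_fun h -> unit_fun (defect n h).
Proof.
move=> Uh; split; first exact: bmeas_defect.
by move=> x; rewrite defect_ge0// defect_le1.
Qed.

(** The sum over k >= n of the one-step errors (K / m) m^k of [defect_step]. *)
Definition defect_error n : R := K / (m * (1 - m)) * m ^+ n.

Lemma defect_error_ge0 n : 0 <= defect_error n.
Proof.
rewrite mulr_ge0 ?(ltW (mn0 n))// divr_ge0//; first exact: second_moment_ge0.
by rewrite mulr_ge0 ?(ltW m0)// subr_ge0 ltW.
Qed.

Lemma cvg_defect_error : defect_error n @[n --> \oo] --> 0.
Proof.
rewrite -[X in _ --> X](mulr0 (K / (m * (1 - m)))).
by apply: cvgM; [exact: cvg_cst|apply: cvg_expr; rewrite ger0_norm// ltW].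
Qed.

Lemma ex_defect_error_lt (e : R) : 0 < e -> exists n, defect_error n < e.
Proof.
move=> e0; have [n _ H] := cvgr_lt _ cvg_defect_error _ e0.
by exists n; apply: H => /=.
Qed.

(** From generation n on, replacing G by its linear part costs at most the factor 1 -
    [defect_error n], whatever the number k of further steps. *)
Lemma defect_steps n k h x : unit_fun h ->
  (1 - defect_error n) * iter k Pop (defect n h) x <= defect (n + k) h x
  <= iter k Pop (defect n h) x.
Proof.
move=> Uh; have Ud := unit_fun_defect n Uh.
(* The induction carries the partial geometric sum of the errors in place of the whole sum. *)
suff /andP[H1 H2] : (1 - defect_error n * (1 - m ^+ k)) * iter k Pop (defect n h) x
    <= defect (n + k) h x <= iter k Pop (defect n h) x.
  rewrite H2 andbT (le_trans _ H1)//; have [_ /(_ x)/andP[i0 _]] := unit_fun_iter_step k Ud.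
  rewrite ler_wpM2r// lerD2l lerN2 ler_piMr ?defect_error_ge0//.
  by have := mn0 k; lra.
elim: k x => [|k IH] x; first by rewrite expr0 subrr mulr0 subr0 mul1r addn0/= lexx.
have [bi i01] := unit_fun_iter_step k Ud.
have [bi1 /(_ x)/= i101] := unit_fun_iter_step k.+1 Ud.
have bd := bmeas_defect (n + k) Uh.
have /andP[s1 s2] := defect_step (n + k) x Uh.
have up : Pop (defect (n + k) h) x <= Pop (iter k Pop (defect n h)) x.
  by apply: step_op_le => // y; case/andP: (IH y).
have lo : (1 - defect_error n * (1 - m ^+ k)) * Pop (iter k Pop (defect n h)) x <= Pop (defect (n + k) h) x.
  rewrite -step_opZ//; apply: step_op_le => //; last by move=> y; case/andP: (IH y).
  by apply: bmeasM => //; exact: bmeas_cst.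
rewrite addnS; apply/andP; split; last exact: (le_trans s2).
apply: le_trans s1.
have Pd0 : 0 <= Pop (defect (n + k) h) x.
  by apply: Rintegral_ge0 => y _; exact: defect_ge0.
have b0 : 0 <= K / m * m ^+ (n + k).
  by rewrite mulr_ge0 ?(ltW (mn0 _))// divr_ge0 ?(ltW m0)//; exact: second_moment_ge0.
have EE : defect_error n * (1 - m ^+ k.+1) =
    defect_error n * (1 - m ^+ k) + K / m * m ^+ (n + k).
  rewrite /defect_error exprS exprD; field.
  by rewrite gt_eqF// subr_eq0 eq_sym lt_eqF.
rewrite EE; move: (K / m * m ^+ (n + k)) b0 lo => b b0 lo.
move: (defect_error n * (1 - m ^+ k)) lo => E lo.
move: (Pop (iter k Pop (defect n h)) x) (Pop (defect (n + k) h) x) i101 up lo Pd0 => a v.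
move=> /andP[a0 a1] va lo v0.
(* As v <= a <= 1, the quadratic error is at most a multiple of a, so the bound stays relative. *)
have : b * v ^+ 2 <= b * a.
  rewrite ler_wpM2l// expr2 (le_trans _ va)// ler_piMr// (le_trans va)//.
by nra.
Qed.

(** On indicators this is the definition of the composed kernel; [bp_simple] extends it. *)
Lemma iter_step_nstep k (h : mR -> R) x : bmeas h ->
  iter k Pop h x = \int[nstep P k x]_y h y.
Proof.
have fin n y : (nstep P n y setT < +oo)%E.
  by rewrite (le_lt_trans (sprob_kernel_le1 _ _))// ltry.
elim: k h x => [|k IH] h x bh.
  rewrite /= /Rintegral integral_dirac// ?diracT ?mul1e//.
  by apply/measurable_EFinP; case: bh.
have bI (g : mR -> R) : bmeas g -> bmeas (iter k Pop g : mR -> R).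
  by move=> bg; elim: (k) => //= j IHj; exact: bmeas_step_op.
suff [] : bmeas h /\ forall x, iter k.+1 Pop h x = \int[nstep P k.+1 x]_y h y by move=> _ ->.
move: h bh {x}; apply: bp_simple.
  split=> [a f g [bf ef] [bg eg]|f_ f C fP fC ff].
    split=> [|x]; first exact: bmeas_lin.
    rewrite (Rint_lin (fin _ _))// -ef -eg !iterS.
    rewrite -(Rint_lin (step_fin P x) a (bI _ bf) (bI _ bg)).
    congr step_op; apply/funext => y; rewrite !IH//; last exact: bmeas_lin.
    by rewrite (Rint_lin (fin _ _)).
  have mf n : measurable_fun setT (f_ n) by case: (fP n) => -[].
  have bf := bmeas_cvg mf fC ff.
  split=> // x.
  have c1 : iter k.+1 Pop (f_ n) x @[n --> \oo] --> \int[nstep P k.+1 x]_y f y.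
    under eq_fun => n do rewrite (fP n).2.
    exact: (Rint_bcvg (fin _ _) mf fC).
  have c2 : iter k.+1 Pop (f_ n) x @[n --> \oo] --> iter k.+1 Pop f x.
    have bC (g : mR -> R) : bmeas g -> (forall y, `|g y| <= C) ->
        forall y, `|iter k Pop g y| <= C.
      move=> bg gC; elim: (k) => //= j IHj y; rewrite ler_norml.
      apply: step_op_bounds => [|z]; last by rewrite -ler_norml.
      by elim: (j) => //= i IHi; exact: bmeas_step_op.
    rewrite iterS; apply: (@Rint_bcvg _ _ _ _ (step_fin P x) (fun n => iter k Pop (f_ n)) _ C).
    - by move=> n; case: (bI (f_ n) (fP n).1).
    - by move=> n; apply: bC => //; case: (fP n).
    - move=> y; rewrite IH//; under eq_fun => n do rewrite (IH (f_ n) y (fP n).1).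
      exact: (Rint_bcvg (fin _ _) mf fC).
  exact: (cvg_unique _ c2 c1).
move=> A mA; split=> [|x]; first exact: bmeas_indic.
rewrite iterS /Rintegral integral_indic// setIT.
rewrite -[RHS]/(fine (\int[P x]_y nstep P k y A)%E) /step_op.
congr fine; apply: eq_integral => y _; rewrite IH; last exact: bmeas_indic.
rewrite -Rint_EFin; [|exact: fin|exact: bmeas_indic].
by rewrite integral_indic// setIT.
Qed.

Variable pi : probability mR R.
Hypothesis C4pi : forall h : R -> R, measurable_fun setT (h : mR -> R) ->
  (forall x, 0 <= h x) -> (exists M : R, forall x, h x <= M) ->
  forall e : R, 0 < e -> \forall n \near \oo, forall x : R,
    `| \int[nstep P n x]_y h y - \int[pi]_y h y | < e.

Lemma pi_fin : (pi setT < +oo)%E.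
Proof. by rewrite probability_setT ltry. Qed.

Lemma Rint_pi_cst (c : R) : \int[pi]_x c = c.
Proof.
rewrite Rintegral_cst// -[RHS]mulr1; congr (_ * _).
exact: (congr1 fine (probability_setT pi)).
Qed.

Definition mean_defect n h : R := \int[pi]_x defect n h x.

(** The limit of [defect n h], by [cvg_defect]; as an infimum it makes sense before any convergence
    is known. *)
Definition rate h : R := inf (range (fun n => mean_defect n h)).

Lemma mean_defect_bounds n h : unit_fun h -> 0 <= mean_defect n h <= 1.
Proof.
move=> /(unit_fun_defect n)[bd d01]; apply/andP; split.
  by apply: Rintegral_ge0 => x _; case/andP: (d01 x).
rewrite -[leRHS](Rint_pi_cst 1); apply: Rint_le => //; [exact: pi_fin|exact: bmeas_cst|].
by move=> x; case/andP: (d01 x).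
Qed.

Lemma has_inf_mean_defect h : unit_fun h -> has_inf (range (fun n => mean_defect n h)).
Proof.
move=> Uh; split; first by exists (mean_defect 0 h), 0%N.
by exists 0 => _ [n _ <-]; case/andP: (mean_defect_bounds n Uh).
Qed.

Lemma rate_le_mean_defect n h : unit_fun h -> rate h <= mean_defect n h.
Proof.
by move=> Uh; apply: ge_inf; [case: (has_inf_mean_defect Uh)|exists n].
Qed.

(** [defect_steps] reduces the defects after generation n to iterates of P on one fixed function,
    and these converge uniformly to its mean under [pi]. *)
Lemma defect_near n h (e : R) : unit_fun h -> 0 < e -> \forall N \near \oo, forall x,
  (1 - defect_error n) * mean_defect n h - e <= defect N h x <= mean_defect n h + e.
Proof.
move=> Uh e0; have Ud := unit_fun_defect n Uh.
(* An error e' on the iterate of P becomes at most e once multiplied by |1 - [defect_error n]|. *)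
pose e' := e / (1 + defect_error n).
have E0 := defect_error_ge0 n.
have e'0 : 0 < e' by rewrite divr_gt0// ltr_pwDl.
have e'E : e' * (1 + defect_error n) = e by rewrite divfK// gt_eqF// ltr_pwDl.
have [k0 _ H] : \forall k \near \oo, forall x, `|iter k Pop (defect n h) x - mean_defect n h| < e'.
  have md : measurable_fun setT (defect n h : mR -> R) by case: Ud => -[].
  have d1 : exists M : R, forall x, defect n h x <= M by exists 1 => x; exact: defect_le1.
  have := C4pi md (fun x => defect_ge0 n x Uh) d1 e'0; apply: filterS => k Hk x.
  by rewrite iter_step_nstep//; case: Ud.
exists (n + k0)%N => // N /= nN x.
have -> : N = (n + (N - n))%N by rewrite subnKC// (leq_trans _ nN)// leq_addr.
have /(_ (N - n)%N) := H; rewrite /= leq_subRL ?(leq_trans (leq_addr _ _) nN)// => /(_ nN x).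
rewrite ltr_norml => /andP[a1 a2].
have /andP[d1 d2] := defect_steps n (N - n) x Uh.
move: (iter _ _ _ _) d1 d2 a1 a2 => i d1 d2 a1 a2.
apply/andP; split; last first.
  rewrite (le_trans d2)//; have : e' <= e by nra.
  by lra.
rewrite (le_trans _ d1)//.
have : `|1 - defect_error n| * `|i - mean_defect n h| <= (1 + defect_error n) * e'.
  rewrite ler_pM//; first by rewrite (le_trans (ler_normB _ _))// normr1 ger0_norm.
  by rewrite ltW// ltr_norml a1 a2.
rewrite -normrM [leRHS]mulrC e'E mulrBr ler_norml => /andP[b1 _]; lra.
Qed.

Lemma mean_defect_near n h (e : R) : unit_fun h -> 0 < e -> \forall N \near \oo,
  (1 - defect_error n) * mean_defect n h - e <= mean_defect N h <= mean_defect n h + e.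
Proof.
move=> Uh e0; have := defect_near n Uh e0; apply: filterS => N H.
have bN := bmeas_defect N Uh.
rewrite -[X in X <= _](Rint_pi_cst ((1 - defect_error n) * mean_defect n h - e)).
rewrite -[X in _ && (_ <= X)](Rint_pi_cst (mean_defect n h + e)).
apply/andP; split; apply: Rint_le => //; try exact: pi_fin; try exact: bmeas_cst.
  by move=> x; case/andP: (H x).
by move=> x; case/andP: (H x).
Qed.

(** Generations n and k are compared through a late common generation N, whose mean defect is nearly
    above (1 - [defect_error n]) [mean_defect n h] and nearly below [mean_defect k h]. *)
Lemma rate_ge n h : unit_fun h -> (1 - defect_error n) * mean_defect n h <= rate h.
Proof.
move=> Uh; apply/ler_addgt0Pr => e e0.
rewrite -lerBlDr; apply: lb_le_inf; first by case: (has_inf_mean_defect Uh).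
move=> _ [k _ <-]; have e20 : 0 < e / 2 by rewrite divr_gt0.
have [N [h1 h2]] : exists N,
    (1 - defect_error n) * mean_defect n h - e / 2 <= mean_defect N h /\
    mean_defect N h <= mean_defect k h + e / 2.
  have [N1 _ H1] := mean_defect_near n Uh e20; have [N2 _ H2] := mean_defect_near k Uh e20.
  exists (maxn N1 N2); have /andP[? _] := H1 _ (leq_maxl N1 N2).
  by have /andP[_ ?] := H2 _ (leq_maxr N1 N2).
by lra.
Qed.

Lemma rate_dist n h : unit_fun h -> `|rate h - mean_defect n h| <= defect_error n.
Proof.
move=> Uh; have h1 := rate_ge n Uh; have h2 := rate_le_mean_defect n Uh.
have /andP[a0 a1] := mean_defect_bounds n Uh; have E0 := defect_error_ge0 n.
by rewrite ler0_norm ?subr_le0// opprB; nra.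
Qed.

Lemma rate_unif h (e : R) : unit_fun h -> 0 < e ->
  \forall n \near \oo, forall x, `|defect n h x - rate h| <= e.
Proof.
move=> Uh e0; have e20 : 0 < e / 2 by rewrite divr_gt0.
have [n nE] := ex_defect_error_lt e20.
have := defect_near n Uh e20; apply: filterS => N H x; have /andP[h1 h2] := H x.
have := rate_dist n Uh; rewrite ler_norml => /andP[h3 h4].
have /andP[a0 a1] := mean_defect_bounds n Uh; have E0 := defect_error_ge0 n.
have h5 := rate_ge n Uh; have h6 := rate_le_mean_defect n Uh.
by rewrite ler_norml; apply/andP; split; nra.
Qed.

Lemma cvg_defect h x : unit_fun h -> defect n h x @[n --> \oo] --> rate h.
Proof.
move=> Uh; apply/cvgrPdist_le => e e0; have := rate_unif Uh e0.
by apply: filterS => n /(_ x); rewrite distrC.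
Qed.

Lemma rate_ge0 h : unit_fun h -> 0 <= rate h.
Proof.
move=> Uh; apply: lb_le_inf; first by case: (has_inf_mean_defect Uh).
by move=> _ [n _ <-]; case/andP: (mean_defect_bounds n Uh).
Qed.

Lemma rate_gen_op h : unit_fun h -> rate (G h) = m * rate h.
Proof.
move=> Uh; have c1 := cvg_defect 0 (unit_fun_gen_op Uh).
apply: (cvg_unique _ c1) => //=; under eq_fun do rewrite defect_gen_op.
apply: cvgM; first exact: cvg_cst.
by rewrite (cvg_shiftS (fun n => defect n h 0)); exact: cvg_defect.
Qed.

Lemma gen_op_cst c : G (fun=> c) = fun=> offspring_pgf p c.
Proof. by apply/funext => x; rewrite /gen_op step_op_cst. Qed.

Lemma iter_gen_op_cst n c : iter n G (fun=> c) = fun=> iter n (offspring_pgf p) c.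
Proof. by elim: n => //= n ->; rewrite gen_op_cst. Qed.

Lemma iter_pgf0_lt1 n : 0 <= iter n (offspring_pgf p) 0 < 1.
Proof.
elim: n => [|n /andP[IH0 IH1]] /=; first by rewrite lexx ltr01.
have i01 : 0 <= iter n (offspring_pgf p) 0 <= 1 by rewrite IH0 ltW.
case/andP: (offspring_pgf_bounds p i01) => -> _ /=.
have u01 : 0 <= 1 - iter n (offspring_pgf p) 0 <= 1 by lra.
have := pgf_lower_mass0 p u01; rewrite subKr.
have := mass0_lt1 C1p.
move: (iter n _ 0) (offspring_pgf p _) IH1 => q fq IH1 q0 h.
have : 0 < (1 - offspring_mass p 0) * (1 - q) by rewrite mulr_gt0// subr_gt0.
by move: h; lra.
Qed.

Lemma unit_fun0 : unit_fun (fun=> 0).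
Proof. by apply: unit_fun_cst; rewrite lexx ler01. Qed.

Lemma defect0_gt0 n x : 0 < defect n (fun=> 0) x.
Proof.
rewrite /defect iter_gen_op_cst mulr_gt0 ?invr_gt0// subr_gt0.
by case/andP: (iter_pgf0_lt1 n).
Qed.

(** For some n the cumulated error is below 1, and then only a fixed proportion of the positive
    defect of generation n can be lost. *)
Lemma rate0_gt0 : 0 < rate (fun=> 0).
Proof.
have [n nE] := ex_defect_error_lt ltr01.
apply: lt_le_trans (rate_ge n unit_fun0).
rewrite mulr_gt0 ?subr_gt0// /mean_defect.
rewrite (_ : (fun x => _) = fun=> defect n (fun=> 0) 0).
  by rewrite Rint_pi_cst; exact: defect0_gt0.
by apply/funext => x; rewrite /defect iter_gen_op_cst.
Qed.

Lemma cvg_offspring_pgf (s : nat -> R) (t : R) : (forall n, 0 <= s n <= 1) -> 0 <= t <= 1 ->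
  s n @[n --> \oo] --> t -> offspring_pgf p (s n) @[n --> \oo] --> offspring_pgf p t.
Proof.
move=> s01 t01 st; apply: (@Rint_bcvg _ _ _ _ (p_fin p) _ _ 1) => //.
- move=> n j; have /andP[a b] := s01 n.
  by rewrite normrX ger0_norm// exprn_ile1.
- move=> j; elim: j => [|j IH]; first by under eq_fun do rewrite expr0; exact: cvg_cst.
  by under eq_fun do rewrite exprS; rewrite exprS; exact: cvgM.
Qed.

Lemma cvg_step_op (h_ : nat -> mR -> R) h x : (forall n, unit_fun (h_ n)) ->
  (forall y, h_ n y @[n --> \oo] --> h y) -> Pop (h_ n) x @[n --> \oo] --> Pop h x.
Proof.
move=> Uh hh; apply: (@Rint_bcvg _ _ _ _ (step_fin P x) _ _ 1) => //.
- by move=> n; case: (Uh n) => -[].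
- by move=> n y; have [_ /(_ y)/andP[a b]] := Uh n; rewrite ger0_norm.
Qed.

Lemma unit_fun_cvg (h_ : nat -> mR -> R) h : (forall n, unit_fun (h_ n)) ->
  (forall y, h_ n y @[n --> \oo] --> h y) -> unit_fun h.
Proof.
move=> Uh hh; split.
  apply: (bmeas_cvg (f_ := h_) (C := 1)) => //; first by move=> n; case: (Uh n) => -[].
  by move=> n y; have [_ /(_ y)/andP[a b]] := Uh n; rewrite ger0_norm.
move=> y; apply/andP; split.
  by apply: (cvgr_to_ge (hh y)); apply: nearW => n; have [_ /(_ y)/andP[]] := Uh n.
by apply: (cvgr_to_le (hh y)); apply: nearW => n; have [_ /(_ y)/andP[]] := Uh n.
Qed.

Lemma cvg_iter_gen_op (h_ : nat -> mR -> R) h k x : (forall n, unit_fun (h_ n)) ->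
  (forall y, h_ n y @[n --> \oo] --> h y) ->
  iter k G (h_ n) x @[n --> \oo] --> iter k G h x.
Proof.
move=> Uh hh; elim: k x => [|k IH] x /=; first exact: hh.
have Ui n := unit_fun_iter k (Uh n).
have Ul := unit_fun_iter k (unit_fun_cvg Uh hh).
apply: cvg_offspring_pgf.
- by move=> n; have [_ /(_ x)] := unit_fun_step (Ui n).
- by have [_ /(_ x)] := unit_fun_step Ul.
- exact: cvg_step_op.
Qed.

(** [rate_dist] is uniform in h, so that it is enough to pass to the limit in one fixed generation
    k. *)
Lemma cvg_rate (h_ : nat -> mR -> R) h : (forall n, unit_fun (h_ n)) ->
  (forall y, h_ n y @[n --> \oo] --> h y) -> rate (h_ n) @[n --> \oo] --> rate h.
Proof.
move=> Uh hh; have Ul := unit_fun_cvg Uh hh.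
apply/cvgrPdist_le => e e0; have e30 : 0 < e / 3 by rewrite divr_gt0.
have [k kE] := ex_defect_error_lt e30.
have ca : mean_defect k (h_ n) @[n --> \oo] --> mean_defect k h.
  apply: (@Rint_bcvg _ _ _ _ pi_fin _ _ 1).
  - by move=> n; case: (bmeas_defect k (Uh n)).
  - by move=> n x; rewrite ger0_norm ?defect_le1// defect_ge0.
  - move=> x; apply: cvgM; first exact: cvg_cst.
    by apply: cvgB; [exact: cvg_cst|exact: cvg_iter_gen_op].
have /cvgrPdist_le/(_ _ e30) := ca; apply: filterS => n.
have := rate_dist k Ul; have := rate_dist k (Uh n).
by rewrite !ler_norml => /andP[? ?] /andP[? ?] /andP[? ?]; apply/andP; split; lra.
Qed.

End Rate.

(** * Generating functionals and the Yaglom limit *)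

Section PgflTheory.
Variable R : realType.
Implicit Types (Q : probability (pointMeasure R) R) (h : R -> R).
Local Notation mR := (measurableTypeR R).

Lemma bmeas_comp d1 d2 (T1 : measurableType d1) (T2 : measurableType d2)
    (F : T2 -> R) (g : T1 -> T2) :
  bmeas F -> measurable_fun setT g -> bmeas (fun x => F (g x)).
Proof.
move=> [mF [C FC]] mg; split; first exact: measurableT_comp mF mg.
by exists C.
Qed.

Lemma prob_fin d (T : measurableType d) (Q : probability T R) : (Q setT < +oo)%E.
Proof. by rewrite probability_setT ltry. Qed.

Lemma Rint_prob_cst d (T : measurableType d) (Q : probability T R) (c : R) : \int[Q]_x c = c.
Proof.
rewrite Rintegral_cst// -[RHS]mulr1; congr (_ * _).
exact: (congr1 fine (probability_setT Q)).
Qed.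

Lemma pgflE Q h : pgfl Q h = \int[Q]_mu pmexp h mu. Proof. by []. Qed.

Lemma pgfl1 Q : pgfl Q (fun=> 1) = 1.
Proof. by rewrite pgflE; under eq_fun do rewrite pmexp1; exact: Rint_prob_cst. Qed.

Lemma ler_pgfl Q h1 h2 : V0 h1 -> V0 h2 -> (forall x, h1 x <= h2 x) ->
  pgfl Q h1 <= pgfl Q h2.
Proof.
move=> V1 V2 h12; apply: Rint_le; [exact: prob_fin|exact: bmeas_pmexp|exact: bmeas_pmexp|].
by move=> mu; exact: ler_pmexp.
Qed.

Lemma pgfl_bounds Q h : V0 h -> 0 <= pgfl Q h <= 1.
Proof.
move=> Vh; rewrite Rintegral_ge0/=; last by move=> mu _; rewrite expR_ge0.
rewrite -[leRHS](pgfl1 Q); apply: ler_pgfl => //.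
  by apply: V0_cst; rewrite ltr01 lexx.
by move=> x; case/andP: (V0_bounds x Vh).
Qed.

Lemma cvg_pgfl Q (h_ : nat -> R -> R) h (e : R) : 0 < e ->
  (forall n, measurable_fun setT (h_ n : mR -> R)) ->
  (forall n x, e <= h_ n x <= 1) ->
  (forall x, h_ n x @[n --> \oo] --> h x) ->
  pgfl Q (h_ n) @[n --> \oo] --> pgfl Q h.
Proof.
move=> e0 mh eh hh.
have Vh n : V0 (h_ n) by apply/V0P; split => //; exists e.
apply: (@Rint_bcvg _ _ _ _ (prob_fin Q) (fun n => pmexp (h_ n)) (pmexp h) 1).
- by move=> n; case: (bmeas_pmexp (Vh n)).
- by move=> n mu; rewrite gtr0_norm ?pmexp_gt0// pmexp_le1.
- by move=> mu; exact: (@pmexp_cvg _ h_ h e mu e0 mh eh hh).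
Qed.

(** Constants in [V0] standing for the function 0, at which G_Q would be the mass of the null
    measure. *)
Definition small (j : nat) : R := j.+2%:R^-1.

Lemma small_gt0 j : 0 < small j. Proof. by rewrite invr_gt0. Qed.

Lemma small_le1 j : small j <= 1. Proof. by rewrite invf_le1// ler1n. Qed.

Lemma cvg_small : small j @[j --> \oo] --> (0 : R).
Proof. by rewrite (cvg_shiftS (@harmonic R)); exact: cvg_harmonic. Qed.

Lemma V0_small j : V0 (fun _ : R => small j).
Proof. by apply: V0_cst; rewrite small_gt0 small_le1. Qed.

Lemma cvg_pmexp_small (nu : pointMeasure R) :
  pmexp (fun=> small j) nu @[j --> \oo] --> (\1_(~` @nonnull R) nu : R).
Proof.
have [k kE] := pm_integer nu measurableT.
have E j : pmexp (fun=> small j) nu = expR (ln (small j) * k%:R).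
  rewrite pmexp_cst ?small_gt0//; congr expR; congr (_ * _); exact: (congr1 fine kE).
under eq_fun do rewrite E.
rewrite indicE; case: k kE {E} => [|k] kE.
  rewrite mem_set; last by apply; exact: kE.
  by under eq_fun do rewrite mulr0 expR0; exact: cvg_cst.
rewrite memNset; last first.
  apply; rewrite /nonnull/= => k0; have : (k.+1%:R%:E = 0 :> \bar R)%E by rewrite -k0 -kE.
  by move=> /eqP; rewrite eqe pnatr_eq0.
apply: (@squeeze_cvgr _ _ _ _ (fun=> 0) small); [|exact: cvg_cst|exact: cvg_small].
apply: nearW => j; rewrite expR_ge0/=.
rewrite -[leRHS](lnK (small_gt0 j)) ler_expR ler_neMr ?ler1n//.
by rewrite ln_le0// small_le1.
Qed.

Lemma cvg_pgfl_small Q : pgfl Q (fun=> small j) @[j --> \oo] -->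
  \int[Q]_mu (\1_(~` @nonnull R) mu : R).
Proof.
apply: (@Rint_bcvg _ _ _ _ (prob_fin Q) (fun j => pmexp (fun=> small j)) _ 1).
- by move=> j; case: (bmeas_pmexp (V0_small j)).
- by move=> j mu; rewrite gtr0_norm ?pmexp_gt0// pmexp_le1//; exact: V0_small.
- exact: cvg_pmexp_small.
Qed.

Lemma prob_null Q : prob_on_nonnull Q -> Q (~` @nonnull R) = 0%E.
Proof.
move=> Q1; transitivity (1 - Q (@nonnull R))%E; last by rewrite Q1 subee.
exact: (probability_setC Q (@measurable_nonnull R)).
Qed.

Lemma Rint_nonnull Q (F : pointMeasure R -> R) : prob_on_nonnull Q -> bmeas F ->
  (\int[Q]_(mu in @nonnull R) (F mu)%:E = (\int[Q]_mu F mu)%:E)%E.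
Proof.
move=> Q1 bF; have iF := bmeas_integrable (prob_fin Q) bF.
have mN := measurableC (@measurable_nonnull R).
rewrite -(Rint_EFin (prob_fin Q) bF) [RHS](negligible_integral mN measurableT iF).
  by rewrite setTD setCK.
exact: prob_null.
Qed.

Lemma prob_on_nonnull_small Q : prob_on_nonnull Q ->
  pgfl Q (fun=> small j) @[j --> \oo] --> (0 : R).
Proof.
move=> Q1; have := @cvg_pgfl_small Q.
rewrite (_ : \int[Q]_mu _ = 0)//; have mN := @measurable_nonnull R.
rewrite /Rintegral integral_indic ?setIT//; last exact: measurableC.
exact: (congr1 fine (prob_null Q1)).
Qed.

Lemma pgfl_unique Q Q' : (forall h, V0 h -> pgfl Q h = pgfl Q' h) ->
  forall B, measurable B -> Q B = Q' B.
Proof.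
move=> QQ' B mB.
suff [_ H] : bmeas (\1_B : pointMeasure R -> R) /\ \int[Q]_x (\1_B x : R) = \int[Q']_x (\1_B x : R).
  have := congr1 EFin H; rewrite -!Rint_EFin; try exact: prob_fin; try exact: bmeas_indic.
  by rewrite !integral_indic// setIT.
apply: (pm_monotone_class (G := fun F => bmeas F /\ \int[Q]_x F x = \int[Q']_x F x)); last exact: bmeas_indic.
  split=> [a f g [bf ef] [bg eg]|f_ f C fP fC ff].
    split; first exact: bmeas_lin.
    by rewrite (Rint_lin (prob_fin Q) a bf bg) (Rint_lin (prob_fin Q') a bf bg) ef eg.
  have mf n : measurable_fun setT (f_ n) by case: (fP n) => -[].
  split; first exact: (bmeas_cvg mf fC ff).
  have c1 := Rint_bcvg (prob_fin Q) mf fC ff; have c2 := Rint_bcvg (prob_fin Q') mf fC ff.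
  apply: (cvg_unique _ c1) => //; rewrite (_ : (fun n => \int[Q]_x f_ n x) = fun n => \int[Q']_x f_ n x)//.
  by apply/funext => n; case: (fP n).
by move=> h Vh; split; [exact: bmeas_pmexp|exact: QQ'].
Qed.

End PgflTheory.

(** * Survival probabilities and the generating functional of the Yaglom limit *)

Section Survival.
Variables (R : realType) (p : probability nat R).
Variable P : R.-pker (measurableTypeR R) ~> (measurableTypeR R).
Hypothesis C1p : C1 p.
Local Notation mR := (measurableTypeR R).
Local Notation G := (gen_op p P).
Local Notation m := (offspring_mean p).
Variables (d : measure_display) (Omega : measurableType d).
Variable PP : pointMeasure R -> probability Omega R.
Variable Z : nat -> {mfun Omega >-> pointMeasure R}.
Hypothesis bmc : branching_markov_chain p P PP Z.
Implicit Types (mu : pointMeasure R) (Q : probability (pointMeasure R) R).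

Lemma bmeas_chain (F : pointMeasure R -> R) n : bmeas F -> bmeas (fun w => F (Z n w)).
Proof. by move=> bF; apply: bmeas_comp bF _; exact: measurable_Z. Qed.

Lemma one_step_pgflE h : V0 h -> one_step_pgfl PP Z h = G h.
Proof.
move=> Vh; apply/funext => x.
rewrite /one_step_pgfl -[LHS]/(\int[PP (pm_dirac x)]_w pmexp h (Z 1%N w)).
rewrite (chain_pmexp C1p bmc 1 (@nonnull_dirac R x) Vh)/= pmexp_dirac//.
exact: V0_gen_op.
Qed.

Lemma cvg_extinction mu n : nonnull mu ->
  pmexp (iter n G (fun=> small R j)) mu @[j --> \oo] -->
  \int[PP mu]_w (\1_(~` @nonnull R) (Z n w) : R).
Proof.
move=> mu0; under eq_fun => j do rewrite -(chain_pmexp C1p bmc n mu0 (V0_small R j)).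
apply: (@Rint_bcvg _ _ _ _ (prob_fin (PP mu)) (fun j w => pmexp (fun=> small R j) (Z n w)) _ 1).
- by move=> j; case: (bmeas_chain n (bmeas_pmexp (V0_small R j))).
- by move=> j w; rewrite gtr0_norm ?pmexp_gt0// pmexp_le1//; exact: V0_small.
- by move=> w; exact: cvg_pmexp_small.
Qed.

(** Both sides are limits of the two members of [chain_pmexp] along the constants [small j]. *)
Lemma extinction_dirac x n :
  \int[PP (pm_dirac x)]_w (\1_(~` @nonnull R) (Z n w) : R) = iter n G (fun=> 0) x.
Proof.
apply: (cvg_unique _ (@cvg_extinction (pm_dirac x) n (@nonnull_dirac R x))) => //=.
have -> : (fun j => pmexp (iter n G (fun=> small R j)) (pm_dirac x)) =
    (fun j => iter n G (fun=> small R j) x).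
  apply/funext => j; rewrite pmexp_dirac//.
  by apply: V0_iter_gen_op => //; exact: V0_small.
apply: cvg_iter_gen_op => [j|y]; last exact: cvg_small.
exact/V0_unit_fun/V0_small.
Qed.

Lemma indic_chain (B : set (pointMeasure R)) mu n : measurable B ->
  PP mu (Z n @^-1` B) = (\int[PP mu]_w (\1_B (Z n w) : R))%:E.
Proof.
move=> mB; rewrite -(Rint_EFin (prob_fin (PP mu))); last exact/bmeas_chain/bmeas_indic.
have mZB : measurable (Z n @^-1` B).
  by rewrite -[X in measurable X]setTI; exact: (measurable_Z Z n).
transitivity (\int[PP mu]_w (\1_(Z n @^-1` B) w)%:E)%E; first by rewrite integral_indic// setIT.
by [].
Qed.

Lemma surviving_dirac x n :
  fine (PP (pm_dirac x) (surviving Z n)) = 1 - iter n G (fun=> 0) x.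
Proof.
rewrite -extinction_dirac (indic_chain _ _ (@measurable_nonnull R))/=.
rewrite -(Rint_prob_cst (PP (pm_dirac x)) 1).
rewrite -RintB; [|exact: prob_fin|exact: bmeas_cst|].
  apply: eq_Rintegral => w _; rewrite !indicE in_setC.
  by case: (_ \in _); rewrite ?subr0 ?subrr.
by apply: bmeas_chain; apply: bmeas_indic; apply: measurableC; exact: measurable_nonnull.
Qed.

Section Yaglom.
Variables (pi : probability mR R) (Qmin : probability (pointMeasure R) R).
Hypothesis C4pi : forall h : R -> R, measurable_fun setT (h : mR -> R) ->
  (forall x, 0 <= h x) -> (exists M : R, forall x, h x <= M) ->
  forall e : R, 0 < e -> \forall n \near \oo, forall x : R,
    `| \int[nstep P n x]_y h y - \int[pi]_y h y | < e.
Hypothesis yaglom : yaglom_limit PP Z Qmin.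
Local Notation rate := (rate p P pi).

(** For continuous h, [pmexp h] is a bounded continuous functional. Its mean given survival to
    generation n is 1 - defect n h / defect n 0, the powers of m cancelling, and both defects
    converge. *)
Lemma pgfl_Qmin_continuous h : continuous h -> V0 h ->
  pgfl Qmin h = 1 - rate h / rate (fun=> 0).
Proof.
move=> ch Vh; have [Q1 Hy] := yaglom.
have Uh := V0_unit_fun Vh; have r0 := rate0_gt0 C1p C4pi.
have bln : continuous (fun x => ln (h x)) /\ exists M : R, forall x, `|ln (h x)| <= M.
  split; last by case: (bmeas_ln Vh).
  move=> x; apply: (@continuous_comp _ _ _ h (@ln R)); first exact: ch.
  by apply: continuous_ln; case/andP: (V0_bounds x Vh).
have cF : continuous (pmexp h).
  move=> mu; have H := @pm_pairing_continuous _ (exist _ _ bln : bounded_continuous R) mu.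
  exact: (@continuous_cvg _ _ _ _ _ (fun nu : pointMeasure R => \int[nu]_x ln (h x)) (@expR R) _
    (@continuous_expR R _) H).
have := Hy (pm_dirac 0) (@nonnull_dirac R 0) (pmexp h) (continuous_subspaceT cF).
have bF : exists M : R, forall nu, nonnull nu -> `|pmexp h nu| <= M.
  by exists 1 => nu _; rewrite gtr0_norm ?pmexp_gt0// pmexp_le1.
move=> /(_ bF){bF} c1.
have -> : pgfl Qmin h = \int[Qmin]_(nu in @nonnull R) pmexp h nu.
  exact/esym/(congr1 fine (Rint_nonnull Q1 (bmeas_pmexp Vh))).
apply: (cvg_unique _ c1) => //=.
have -> : (fun n => (\int[PP (pm_dirac 0)]_(w in surviving Z n) pmexp h (Z n w)) /
    fine (PP (pm_dirac 0) (surviving Z n))) =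
    (fun n => 1 - defect p P n h 0 / defect p P n (fun=> 0) 0).
  apply/funext => n; rewrite surviving_dirac.
  have -> : \int[PP (pm_dirac 0)]_(w in surviving Z n) pmexp h (Z n w) =
      iter n G h 0 - iter n G (fun=> 0) 0.
    rewrite -extinction_dirac -(pmexp_dirac 0 (V0_iter_gen_op P C1p n Vh)).
    rewrite -(chain_pmexp C1p bmc n (@nonnull_dirac R 0) Vh).
    rewrite -RintB; [|exact: prob_fin|exact/bmeas_chain/bmeas_pmexp|]; last first.
      by apply: bmeas_chain; apply: bmeas_indic; apply: measurableC; exact: measurable_nonnull.
    (* On extinction [pmexp h] is 1, so subtracting the indicator of extinction restricts the
       integral to survival. *)
    rewrite Rintegral_mkcond; apply: eq_Rintegral => w _ /=.
    rewrite patchE indicE in_setC.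
    have -> : (w \in surviving Z n) = (Z n w \in @nonnull R).
      by apply/idP/idP => /set_mem h1; apply/mem_set.
    case: ifPn => [_|/negP nZ]; first by rewrite subr0.
    have {}nZ : ~ nonnull (Z n w) by move=> H; apply: nZ; exact/mem_set.
    by rewrite (eq_pmexp h (pm_nullE nZ)) pmexp_zero subrr.
  have d0 := defect0_gt0 P C1p n 0.
  have m0 : 0 < m ^+ n by rewrite exprn_gt0// mean_gt0.
  have := defectK P C1p n h 0; have := defectK P C1p n (fun=> 0) 0.
  move=> E0 Eh; have -> : iter n G h 0 - iter n G (fun=> 0) 0 =
    (1 - iter n G (fun=> 0) 0) - (1 - iter n G h 0) by ring.
  by rewrite E0 Eh; field; rewrite !gt_eqF.
apply: cvgB; first exact: cvg_cst.
apply: cvgM; first exact: cvg_defect.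
by apply: cvgV; [rewrite gt_eqF|apply: cvg_defect => //; exact: unit_fun0].
Qed.

(** Both sides are continuous under pointwise limits of functions with values in [e, 1], but not
    linear in h, whence the induction over Baire classes. *)
Lemma pgfl_Qmin h : V0 h -> pgfl Qmin h = 1 - rate h / rate (fun=> 0).
Proof.
move=> /V0P[mh [e e0 eh]].
have e1 : e <= 1 by have /andP[a b] := eh 0; exact: le_trans b.
have VE (g : mR -> R) : measurable_fun setT g -> (forall x, e <= g x <= 1) -> V0 g.
  by move=> mg ge; apply/V0P; split=> //; exists e.
apply: (borel_ind e1 (P := fun h => pgfl Qmin h = 1 - rate h / rate (fun=> 0))) => //.
  move=> g cg ge; apply: pgfl_Qmin_continuous => //.
  by apply: VE => //; exact: continuous_measurable_fun.
move=> g_ g mg ge gP gg.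
have Vg n : V0 (g_ n) by exact: VE.
apply: (cvg_unique _ (cvg_pgfl (Q := Qmin) e0 mg ge gg)) => //=.
under eq_fun do rewrite gP.
apply: cvgB; first exact: cvg_cst.
apply: cvgM; last exact: cvg_cst.
by apply: cvg_rate => // n; exact: V0_unit_fun.
Qed.

Lemma pgfl_Qmin_gen_op h : V0 h -> 1 - pgfl Qmin (G h) = m * (1 - pgfl Qmin h).
Proof.
move=> Vh; rewrite !pgfl_Qmin//; last exact: V0_gen_op.
rewrite (rate_gen_op C1p C4pi (V0_unit_fun Vh)); ring.
Qed.

End Yaglom.
End Survival.

(** * The eigenvalue equation *)

Section LaplaceExponent.
Variable R : realType.
Implicit Types (Q : probability (pointMeasure R) R).

Definition mass (mu : pointMeasure R) : R := fine (mu setT).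

Lemma mass_ge0 mu : 0 <= mass mu.
Proof. by rewrite fine_ge0// measure_ge0. Qed.

Lemma measurable_mass : measurable_fun setT mass.
Proof.
apply: measurableT_comp => //.
exact: (measurable_pm_eval (@measurableT _ (measurableTypeR R))).
Qed.

Lemma V0_expRN (s : R) : 0 <= s -> V0 (fun _ : R => expR (- s)).
Proof. by move=> s0; apply: V0_cst; rewrite expR_gt0/= expR_le1 oppr_le0. Qed.

Lemma pmexp_expRN (s : R) mu : pmexp (fun=> expR (- s)) mu = expR (- (s * mass mu)).
Proof. by rewrite pmexp_cst ?expR_gt0// expRK mulNr. Qed.

Definition lap Q (s : R) : R := 1 - pgfl Q (fun=> expR (- s)).

Lemma lapE Q s : 0 <= s -> lap Q s = \int[Q]_mu (1 - expR (- (s * mass mu))).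
Proof.
move=> s0; have bs := bmeas_pmexp (V0_expRN s0).
rewrite /lap pgflE -{1}(Rint_prob_cst Q 1) -(RintB (prob_fin Q) (bmeas_cst 1) bs).
by apply: eq_Rintegral => mu _; rewrite pmexp_expRN.
Qed.

Lemma bmeas_lap s : 0 <= s -> bmeas (fun mu => 1 - expR (- (s * mass mu))).
Proof.
move=> s0; apply: bmeasB; first exact: bmeas_cst.
have := bmeas_pmexp (V0_expRN s0); congr bmeas.
by apply/funext => mu; rewrite pmexp_expRN.
Qed.

Lemma lap_ge0 Q s : 0 <= s -> 0 <= lap Q s.
Proof.
move=> s0; rewrite subr_ge0.
by case/andP: (pgfl_bounds Q (V0_expRN s0)).
Qed.

Lemma ler_lap Q s t : 0 <= s -> s <= t -> lap Q s <= lap Q t.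
Proof.
move=> s0 st; rewrite lerD2l lerN2; apply: ler_pgfl.
- exact/V0_expRN/(le_trans s0).
- exact: V0_expRN.
- by move=> _; rewrite ler_expR lerN2.
Qed.

(** The tangent bound 1 + x <= exp(x) at x = -(1 - a) y and at x = a y, with weights a and 1 - a:
    the terms linear in y cancel. *)
Lemma expR_concave (a y : R) : 0 <= a <= 1 -> a * (1 - expR (- y)) <= 1 - expR (- (a * y)).
Proof.
move=> /andP[a0 a1].
have h1 : expR (- (a * y)) * (1 + (- y + a * y)) <= expR (- y).
  have -> : expR (- y) = expR (- (a * y)) * expR (- y + a * y).
    by rewrite -expRD; congr expR; ring.
  by rewrite ler_wpM2l ?expR_ge0// expR_ge1Dx.
have h2 : expR (- (a * y)) * (1 + a * y) <= 1.
  have E1 : expR (- (a * y)) * expR (a * y) = 1 by rewrite -expRD addNr expR0.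
  by rewrite -[leRHS]E1 ler_wpM2l ?expR_ge0// expR_ge1Dx.
have h3 := ler_wpM2l a0 h1.
have h4 : (1 - a) * (expR (- (a * y)) * (1 + a * y)) <= (1 - a) * 1.
  by rewrite ler_wpM2l// subr_ge0.
move: h3 h4; move: (expR (- y)) (expR (- (a * y))) => e f h3 h4.
have -> : f = a * (f * (1 + (- y + a * y))) + (1 - a) * (f * (1 + a * y)) by ring.
by lra.
Qed.

Lemma lap_concave Q (a s : R) : 0 <= a <= 1 -> 0 <= s -> a * lap Q s <= lap Q (a * s).
Proof.
move=> a01 s0; have /andP[a0 a1] := a01.
rewrite !lapE ?mulr_ge0// -(RintZ (prob_fin Q) a (bmeas_lap s0)).
apply: Rint_le; first exact: prob_fin.
- by apply: bmeasM; [exact: bmeas_cst|exact: bmeas_lap].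
- by apply: bmeas_lap; rewrite mulr_ge0.
- by move=> mu; rewrite -mulrA; exact: expR_concave.
Qed.

(** Concavity at s = (s / t) t, cleared of denominators: L(s) / s is nonincreasing. *)
Lemma lap_ratio Q (s t : R) : 0 < s -> s <= t -> s * lap Q t <= t * lap Q s.
Proof.
move=> s0 st; have t0 : 0 < t by exact: lt_le_trans st.
have st1 : 0 <= s / t <= 1 by rewrite divr_ge0 ?(ltW s0) ?(ltW t0)//= ler_pdivrMr// mul1r.
have Est : s / t * t = s by rewrite divfK// gt_eqF.
have := lap_concave Q st1 (ltW t0); rewrite Est.
move: (lap Q t) (lap Q s) => L L' H.
by rewrite -Est (mulrC _ t) -mulrA ler_pM2l.
Qed.

(** G_Q falls below 1 at some constant because Q does not charge the null measure; concavity brings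
    positivity of L down to every s > 0. *)
Lemma lap_gt0 Q s : prob_on_nonnull Q -> 0 < s -> 0 < lap Q s.
Proof.
move=> Q1 s0.
have [j] : exists j, pgfl Q (fun=> small R j) < 1.
  have [j _ H] := cvgr_lt _ (prob_on_nonnull_small Q1) _ ltr01.
  by exists j; apply: H => /=.
set t := - ln (small R j).
have -> : (fun=> small R j) = (fun _ : R => expR (- t)).
  by apply/funext => _; rewrite /t opprK lnK// posrE small_gt0.
rewrite -subr_gt0 -/(lap Q t) => Lt.
have [ts|st] := leP t s.
  apply: lt_le_trans Lt _; apply: ler_lap => //.
  by rewrite oppr_ge0 ln_le0// small_le1.
have := lap_ratio Q s0 (ltW st); have t0 : 0 < t by exact: lt_trans st.
move=> H; rewrite -(pmulr_rgt0 _ t0); apply: lt_le_trans H.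
by rewrite mulr_gt0.
Qed.

End LaplaceExponent.

Section QSD.
Variables (R : realType) (p : probability nat R).
Variable P : R.-pker (measurableTypeR R) ~> (measurableTypeR R).
Hypothesis C1p : C1 p.
Local Notation mR := (measurableTypeR R).
Local Notation G := (gen_op p P).
Local Notation m := (offspring_mean p).
Variables (d : measure_display) (Omega : measurableType d).
Variable PP : pointMeasure R -> probability Omega R.
Variable Z : nat -> {mfun Omega >-> pointMeasure R}.
Hypothesis bmc : branching_markov_chain p P PP Z.
Implicit Types (mu : pointMeasure R) (Q : probability (pointMeasure R) R).

Definition pgfl_eigen Q (lam : R) : Prop :=
  forall h, V0 h -> 1 - pgfl Q (G h) = lam * (1 - pgfl Q h).

Lemma V01 : V0 (fun _ : R => 1 : R).
Proof. by apply: V0_cst; rewrite ltr01 lexx. Qed.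

Lemma gen_op1 : G (fun=> 1) = fun=> 1.
Proof.
rewrite gen_op_cst; apply/funext => _.
rewrite /offspring_pgf; under eq_fun do rewrite expr1n.
exact: Rint_prob_cst.
Qed.

(** The constant 1 is fixed by G, so the equation at h = 1 evaluates G_Q[f(0)] as 1 - m^alpha and
    eliminates it. *)
Lemma QSD_eigen_pgfl alpha Q : is_QSD_eigen p PP Z alpha Q -> pgfl_eigen Q (m `^ alpha).
Proof.
move=> [_ H] h Vh; have := H _ V01.
rewrite (one_step_pgflE C1p bmc V01) gen_op1 pgfl1 mulr1 => H1.
have := H h Vh; rewrite (one_step_pgflE C1p bmc Vh) => H2.
move: (m `^ alpha) (pgfl Q (cst _)) (pgfl Q (G h)) (pgfl Q h) H1 H2 => a x y z H1 H2.
have -> : y = a * z + x by rewrite -H2 subrK.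
by rewrite -H1; ring.
Qed.

Lemma pgfl_eigen_iter Q lam n h : pgfl_eigen Q lam -> V0 h ->
  1 - pgfl Q (iter n G h) = lam ^+ n * (1 - pgfl Q h).
Proof.
move=> E Vh; elim: n => [|n IH]; first by rewrite mul1r.
rewrite exprS -mulrA -IH.
exact: E (V0_iter_gen_op P C1p n Vh).
Qed.

(* PP is only constrained at nonnull mu, so the null measure is made absorbing. *)
Definition chain_mean n (F : pointMeasure R -> R) mu : R :=
  if pselect (nonnull mu) then \int[PP mu]_w F (Z n w) else F (pm_zero R).

Lemma chain_mean_pmexp n h mu : V0 h -> chain_mean n (pmexp h) mu = pmexp (iter n G h) mu.
Proof.
move=> Vh; rewrite /chain_mean; case: pselect => mu0 /=; first exact: (chain_pmexp C1p bmc).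
by rewrite (eq_pmexp _ (pm_nullE mu0)) !pmexp_zero.
Qed.

(** For [pmexp h] this is the iterated eigenvalue equation, the value at the null measure accounting
    for extinction. Extended to indicators, it gives the law of Z_n on survival, hence
    quasi-stationarity. *)
Lemma chain_mean_eigen Q lam n (F : pointMeasure R -> R) : pgfl_eigen Q lam -> bmeas F ->
  bmeas (chain_mean n F) /\
  \int[Q]_mu chain_mean n F mu = lam ^+ n * \int[Q]_mu F mu + (1 - lam ^+ n) * F (pm_zero R).
Proof.
move=> E bF.
suff [] : bmeas F /\ (bmeas (chain_mean n F) /\
    \int[Q]_mu chain_mean n F mu = lam ^+ n * \int[Q]_mu F mu + (1 - lam ^+ n) * F (pm_zero R)) by [].
move: F bF; apply: pm_monotone_class.
  split=> [a f g [bf [bcf ef]] [bg [bcg eg]]|f_ f C fP fC ff].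
    have linE : chain_mean n (fun mu => a * f mu + g mu) =
        (fun mu => a * chain_mean n f mu + chain_mean n g mu).
      apply/funext => mu; rewrite /chain_mean; case: pselect => //= mu0.
      exact: (Rint_lin (prob_fin (PP mu)) a (bmeas_chain Z n bf) (bmeas_chain Z n bg)).
    split; first exact: bmeas_lin.
    rewrite linE; split; first exact: bmeas_lin.
    by rewrite !(Rint_lin (prob_fin Q))// ef eg; ring.
  have mf k : measurable_fun setT (f_ k) by case: (fP k) => -[].
  have bf := bmeas_cvg mf fC ff.
  have mc k : measurable_fun setT (chain_mean n (f_ k)) by case: (fP k) => _ [[]].
  have cC k mu : `|chain_mean n (f_ k) mu| <= C.
    rewrite /chain_mean; case: pselect => mu0 /=; last exact: fC.
    have bk := bmeas_chain Z n (fP k).1.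
    rewrite (le_trans (le_normr_Rintegral _ _))//.
      by apply: bmeas_integrable => //; exact: prob_fin.
    rewrite -[leRHS](Rint_prob_cst (PP mu) C); apply: Rint_le; [exact: prob_fin| |exact: bmeas_cst|by []].
    split; first exact: measurableT_comp bk.1.
    by exists C => w; rewrite normr_id.
  have cc mu : chain_mean n (f_ k) mu @[k --> \oo] --> chain_mean n f mu.
    rewrite /chain_mean; case: pselect => mu0; last exact: ff.
    apply: (@Rint_bcvg _ _ _ _ (prob_fin (PP mu)) (fun k w => f_ k (Z n w)) _ C) => //.
    by move=> k; case: (bmeas_chain Z n (fP k).1).
  split=> //; split; first exact: bmeas_cvg mc cC cc.
  have c1 := Rint_bcvg (prob_fin Q) mc cC cc; have c2 := Rint_bcvg (prob_fin Q) mf fC ff.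
  apply: (cvg_unique _ c1) => //=.
  rewrite (_ : (fun k => \int[Q]_x chain_mean n (f_ k) x) = fun k =>
    lam ^+ n * (\int[Q]_x f_ k x) + (1 - lam ^+ n) * f_ k (pm_zero R)).
    apply: cvgD; apply: cvgM; first exact: cvg_cst.
    - exact: c2.
    - exact: cvg_cst.
    - exact: ff.
  by apply/funext => k; case: (fP k) => _ [].
move=> h Vh; have -> : chain_mean n (pmexp h) = pmexp (iter n G h).
  by apply/funext => mu; exact: chain_mean_pmexp.
split; first exact: bmeas_pmexp.
split; first exact/bmeas_pmexp/V0_iter_gen_op.
have := pgfl_eigen_iter n E Vh; rewrite -!pgflE pmexp_zero => H.
by rewrite mulr1; move: H; set a := lam ^+ n; move: (pgfl _ _) (pgfl _ _) => x y; lra.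
Qed.

Lemma mixture_eigen Q lam n (B : set (pointMeasure R)) : prob_on_nonnull Q ->
  pgfl_eigen Q lam -> measurable B -> B `<=` @nonnull R ->
  mixture PP Q (Z n @^-1` B) = (lam ^+ n * fine (Q B))%:E.
Proof.
move=> Q1 E mB Bn; have bB := bmeas_indic R mB.
have [bc ec] := chain_mean_eigen n E bB.
rewrite /mixture; transitivity (\int[Q]_(mu in @nonnull R) (chain_mean n \1_B mu)%:E)%E.
  apply: eq_integral => mu /set_mem mu0; rewrite indic_chain// /chain_mean.
  by case: pselect.
rewrite (Rint_nonnull Q1 bc) ec; congr (_%:E).
have -> : (\1_B (pm_zero R) : R) = 0.
  by rewrite indicE memNset// => /Bn; rewrite /nonnull/= /mzero.
rewrite mulr0 addr0; congr (_ * _).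
by rewrite /Rintegral integral_indic ?setIT.
Qed.

Lemma pgfl_eigen_QSD Q lam : prob_on_nonnull Q -> 0 < lam -> pgfl_eigen Q lam -> is_QSD PP Z Q.
Proof.
move=> Q1 lam0 E; split=> // n B mB Bn.
have -> : (Z n @^-1` B) `&` surviving Z n = Z n @^-1` B.
  by apply/seteqP; split => w /= => [[]//|Bw]; split=> //; exact: Bn.
have -> : mixture PP Q (surviving Z n) = (lam ^+ n * fine (Q (@nonnull R)))%:E.
  by apply: (mixture_eigen n Q1 E) => //; exact: measurable_nonnull.
rewrite (mixture_eigen n Q1 E mB Bn) Q1/= mulr1 mulrAC divff ?mul1r//.
by rewrite expf_neq0// gt_eqF.
Qed.

(** The limit of the eigenvalue equation along constants tending to 0, where G_Q tends to 0. *)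
Lemma pgfl_gf0 Q lam : prob_on_nonnull Q -> pgfl_eigen Q lam ->
  pgfl Q (cst (offspring_gf p 0)) = 1 - lam.
Proof.
move=> Q1 E; rewrite offspring_gf0.
have p00 := mass0_gt0 C1p.
have small01 j : 0 <= small R j <= 1 by rewrite ltW ?small_gt0// small_le1.
have c1 : pgfl Q (G (fun=> small R j)) @[j --> \oo] --> pgfl Q (cst (offspring_mass p 0)).
  apply: (@cvg_pgfl _ Q _ _ (offspring_mass p 0)) => //.
  - by move=> j; rewrite gen_op_cst.
  - move=> j x; rewrite gen_op_cst (pgf_ge_mass0 p (small01 j))/=.
    by case/andP: (offspring_pgf_bounds p (small01 j)).
  - move=> x; rewrite /cst -(offspring_pgf0 p).
    under eq_fun do rewrite gen_op_cst.
    by apply: cvg_offspring_pgf => //; [rewrite lexx ler01|exact: cvg_small].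
apply: (cvg_unique _ c1) => //=.
rewrite (_ : (fun j => pgfl Q _) = (fun j => 1 - lam * (1 - pgfl Q (fun=> small R j)))).
  have c2 : 1 - lam * (1 - pgfl Q (fun=> small R j)) @[j --> \oo] --> 1 - lam * (1 - 0).
    apply: cvgB; first exact: cvg_cst.
    apply: cvgM; first exact: cvg_cst.
    by apply: cvgB; [exact: cvg_cst|exact: prob_on_nonnull_small].
  by rewrite subr0 mulr1 in c2.
by apply/funext => j; rewrite -E ?subKr//; exact: V0_small.
Qed.

Lemma pgfl_eigen_QSD_eigen Q alpha : prob_on_nonnull Q ->
  pgfl_eigen Q (m `^ alpha) -> is_QSD_eigen p PP Z alpha Q.
Proof.
move=> Q1 E; split.
  by apply: (pgfl_eigen_QSD Q1 _ E); rewrite powR_gt0// mean_gt0.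
move=> h Vh; rewrite (one_step_pgflE C1p bmc Vh) (pgfl_gf0 Q1 E).
have := E h Vh; set a := m `^ alpha; move: (pgfl _ _) (pgfl _ _) => x y; lra.
Qed.

(** * Comparison of an eigenvalue with the mean *)

Section Rates.
Variables (pi : probability mR R).
Hypothesis C4pi : forall h : R -> R, measurable_fun setT (h : mR -> R) ->
  (forall x, 0 <= h x) -> (exists M : R, forall x, h x <= M) ->
  forall e : R, 0 < e -> \forall n \near \oo, forall x : R,
    `| \int[nstep P n x]_y h y - \int[pi]_y h y | < e.
Local Notation rate := (rate p P pi).

(** For large n, G^n h is uniformly at least the constant exp(-m^n (rate h + e)), and G_Q is
    monotone. *)
Lemma pgfl_le_lap Q lam h (e : R) : pgfl_eigen Q lam -> V0 h -> 0 < e ->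
  \forall n \near \oo, lam ^+ n * (1 - pgfl Q h) <= lap Q (m ^+ n * (rate h + e)).
Proof.
move=> E Vh e0; have Uh := V0_unit_fun Vh.
have m0 := mean_gt0 C1p; have m1 := mean_lt1 C1p.
have e20 : 0 < e / 2 by rewrite divr_gt0.
have r0 := rate_ge0 P C1p pi Uh.
(* Half of e covers the error on the rate, the other half the second-order term of the exponential,
   which is small for large n. *)
have c0 : m ^+ n * ((rate h + e) * (rate h + e)) @[n --> \oo] --> 0.
  rewrite -(mul0r ((rate h + e) * (rate h + e))).
  by apply: cvgM; [apply: cvg_expr; rewrite ger0_norm// ltW|exact: cvg_cst].
have RU := rate_unif C1p C4pi Uh e20.
near=> n; rewrite -(pgfl_eigen_iter n E Vh) lerD2l lerN2.
have mn : 0 < m ^+ n by rewrite exprn_gt0.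
have U'0 : 0 <= m ^+ n * (rate h + e) by rewrite mulr_ge0 ?(ltW mn)// addr_ge0 ?(ltW e0).
apply: ler_pgfl; [exact: V0_expRN|exact: V0_iter_gen_op|move=> x].
have H1 : `|defect p P n h x - rate h| <= e / 2.
  by move: x; near: n; exact: RU.
have H2 : m ^+ n * ((rate h + e) * (rate h + e)) < e / 2.
  by near: n; exact: (cvgr_lt _ c0).
have := defectK P C1p n h x; move: H1; rewrite ler_norml => /andP[_ H1] Dx.
rewrite expRN -div1r ler_pdivrMr ?expR_gt0//.
have G0 : 0 <= iter n G h x by case/andP: (V0_bounds x (V0_iter_gen_op P C1p n Vh)) => /ltW.
apply: le_trans (ler_wpM2l G0 (expR_ge1Dx _)).
have -> : iter n G h x = 1 - m ^+ n * defect p P n h x by rewrite -Dx subKr.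
have d0 := defect_ge0 P C1p n x Uh.
move: (defect p P n h x) (rate h) (m ^+ n) mn U'0 H1 H2 d0 r0 => D r M M0 U0 H1 H2 d0 r0.
have a1 : M * D <= M * (r + e / 2) by rewrite ler_pM2l//; lra.
have a2 : M * D * (M * (r + e)) <= M * (r + e) * (M * (r + e)).
  by rewrite ler_wpM2r// ler_pM2l//; lra.
have a3 : M * (M * ((r + e) * (r + e))) <= M * (e / 2) by rewrite ler_pM2l// ltW.
have -> : (1 - M * D) * (1 + M * (r + e)) = 1 - M * D + M * (r + e) - M * D * (M * (r + e)) by ring.
have a4 : M * (r + e) * (M * (r + e)) = M * (M * ((r + e) * (r + e))) by ring.
have a5 : M * (r + e / 2) + M * (e / 2) = M * (r + e) by field.
lra.
Unshelve. all: by end_near.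
Qed.

(** The companion of [pgfl_le_lap]; here 1 - x <= exp(-x) does without a second-order correction. *)
Lemma lap_le_pgfl Q lam h (e : R) : pgfl_eigen Q lam -> V0 h -> 0 < e -> e <= rate h ->
  \forall n \near \oo, lap Q (m ^+ n * (rate h - e)) <= lam ^+ n * (1 - pgfl Q h).
Proof.
move=> E Vh e0 er; have Uh := V0_unit_fun Vh.
have m0 := mean_gt0 C1p.
have RU := rate_unif C1p C4pi Uh e0.
near=> n; rewrite -(pgfl_eigen_iter n E Vh) lerD2l lerN2.
have mn : 0 < m ^+ n by rewrite exprn_gt0.
have U'0 : 0 <= m ^+ n * (rate h - e) by rewrite mulr_ge0 ?(ltW mn)// subr_ge0.
apply: ler_pgfl; [exact: V0_iter_gen_op|exact: V0_expRN|move=> x].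
have H1 : `|defect p P n h x - rate h| <= e by move: x; near: n; exact: RU.
have := defectK P C1p n h x; move: H1; rewrite ler_norml => /andP[H1 _] Dx.
have -> : iter n G h x = 1 - m ^+ n * defect p P n h x by rewrite -Dx subKr.
apply: le_trans (expR_ge1Dx _); rewrite lerD2l lerN2 ler_pM2l//; lra.
Unshelve. all: by end_near.
Qed.

Lemma ex_rate_gt0 : exists j, 0 < rate (fun=> small R j).
Proof.
have c1 : rate (fun=> small R j) @[j --> \oo] --> rate (fun=> 0).
  by apply: (cvg_rate C1p C4pi) => // [j|x]; [exact/V0_unit_fun/V0_small|exact: cvg_small].
have [j _ H] := cvgr_gt _ c1 _ (rate0_gt0 C1p C4pi).
by exists j; apply: H => /=.
Qed.

(** Concavity gives L(m^n r / 2) >= m^n L(r / 2), and the eigenvalue equation bounds the left side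
    by a multiple of lam^n; if lam < m this forces L(r / 2) = 0. *)
Lemma no_eigen_gt1 Q lam : prob_on_nonnull Q -> 0 < lam -> lam < m -> ~ pgfl_eigen Q lam.
Proof.
move=> Q1 l0 lm E; have [j r0] := ex_rate_gt0; have m0 := mean_gt0 C1p.
have Vj := V0_small R j; set r := rate _ in r0.
have r20 : 0 < r / 2 by rewrite divr_gt0.
have H := lap_le_pgfl E Vj r20 (ltac:(rewrite -/r; lra)).
have L0 := lap_gt0 Q1 r20.
have c0 : (lam / m) ^+ n * (1 - pgfl Q (fun=> small R j)) @[n --> \oo] --> 0.
  rewrite -(mul0r (1 - pgfl Q (fun=> small R j))).
  apply: cvgM; last exact: cvg_cst.
  apply: cvg_expr; rewrite ger0_norm ?divr_ge0 ?ltW//.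
  by rewrite ltr_pdivrMr ?mul1r.
have : \forall n \near \oo, False.
  near=> n.
  have mn : 0 < m ^+ n by rewrite exprn_gt0.
  have h1 : lap Q (m ^+ n * (r - r / 2)) <= lam ^+ n * (1 - pgfl Q (fun=> small R j)).
    by near: n.
  have h2 : (lam / m) ^+ n * (1 - pgfl Q (fun=> small R j)) < lap Q (r / 2).
    by near: n; exact: (cvgr_lt _ c0).
  have h3 : m ^+ n * lap Q (r / 2) <= lap Q (m ^+ n * (r / 2)).
    apply: lap_concave; last exact: ltW.
    by rewrite ltW//= exprn_ile1// ?ltW// mean_lt1.
  move: h2; rewrite expr_div_n -(ltr_pM2l mn) mulrA mulrCA mulfV ?gt_eqF// mulr1.
  have r2E : r - r / 2 = r / 2 by field.
  rewrite r2E in h1.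
  move: (lap _ (r / 2)) (lap _ (m ^+ n * _)) (1 - pgfl _ _) h1 h3 => L L' A h1 h3.
  by rewrite ltNge (le_trans h3).
by case=> n _ /(_ n (leqnn n)).
Unshelve. all: by end_near.
Qed.

(** Algebra for [eigen_mean_cross], with M = m^n and K = m^k: the two bounds on L and its concavity
    combine into an inequality free of n and k. *)
Lemma cross_mult (M K x y A A' L L' : R) : 0 < M -> 0 < K -> 0 < x -> 0 < y ->
  M * A <= L -> L' <= M * K * A' -> M * K * y * L <= M * x * L' -> A * y <= x * A'.
Proof.
move=> M0 K0 x0 y0 h1 h2 h3.
have MK : 0 < M * K by rewrite mulr_gt0.
have b1 : M * K * y * (M * A) <= M * K * y * L by rewrite ler_wpM2l// mulr_ge0 ?ltW.
have b2 : M * x * L' <= M * x * (M * K * A').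
  by rewrite ler_wpM2l// mulr_ge0 ?(ltW M0) ?(ltW x0).
have b3 := le_trans b1 (le_trans h3 b2).
have MMK : 0 < M * M * K by rewrite !mulr_gt0.
rewrite -(ler_pM2l MMK).
have -> : M * M * K * (A * y) = M * K * y * (M * A) by ring.
by have -> : M * M * K * (x * A') = M * x * (M * K * A') by ring.
Qed.

Lemma cross_limit (r r' A A' : R) : 0 <= A -> 0 <= A' -> 0 < r' ->
  (forall e : R, 0 < e -> e < r' -> A * (r' - e) <= (r + e) * A') -> A * r' <= r * A'.
Proof.
move=> A0 A'0 r'0 step; apply/ler_addgt0Pr => e e0.
pose S := A + A' + 1.
have S0 : 0 < S by rewrite ltr_wpDl ?addr_ge0.
(* The first term makes both error terms together at most e; the second keeps e' below r'. *)
pose e' := Num.min (e / S) (r' / 2).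
have e'0 : 0 < e' by rewrite lt_min !divr_gt0.
have e'r : e' < r' by rewrite gt_min; apply/orP; right; lra.
have e'S : e' * S <= e by rewrite -ler_pdivlMr// ge_min lexx.
have := step e' e'0 e'r.
have eA : 0 <= e' * A by rewrite mulr_ge0// ltW.
have eA' : 0 <= e' * A' by rewrite mulr_ge0// ltW.
move: (eA) (eA').
have -> : A * (r' - e') = A * r' - e' * A by ring.
have -> : (r + e') * A' = r * A' + e' * A' by ring.
have eS : e' * S = e' * A + e' * A' + e' by rewrite /S; ring.
by rewrite eS in e'S; lra.
Qed.

(** With lam = m the powers on both sides match, and L(s) / s being nonincreasing compares h with
    h'. Exchanging the two functions yields the reverse inequality, hence proportionality to the
    rate. *)
Lemma eigen_mean_cross Q h h' : pgfl_eigen Q m -> V0 h -> V0 h' -> 0 < rate h' ->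
  (1 - pgfl Q h) * rate h' <= rate h * (1 - pgfl Q h').
Proof.
move=> E Vh Vh' r'0; have m0 := mean_gt0 C1p; have m1 := mean_lt1 C1p.
have r0 := rate_ge0 P C1p pi (V0_unit_fun Vh).
have A'0 : 0 <= 1 - pgfl Q h' by rewrite subr_ge0; case/andP: (pgfl_bounds Q Vh').
have A0 : 0 <= 1 - pgfl Q h by rewrite subr_ge0; case/andP: (pgfl_bounds Q Vh).
have step e : 0 < e -> e < rate h' ->
    (1 - pgfl Q h) * (rate h' - e) <= (rate h + e) * (1 - pgfl Q h').
  move=> e0 er; have [N1 _ H1] := pgfl_le_lap E Vh e0.
  have [N2 _ H2] := lap_le_pgfl E Vh' e0 (ltW er).
  have x0 : 0 < rate h + e by rewrite ltr_wpDl.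
  have y0 : 0 < rate h' - e by rewrite subr_gt0.
  (* k further generations push the argument for h' below that for h, where L(s) / s is at least as
     large. *)
  have [k mk] : exists k, m ^+ k * (rate h' - e) <= rate h + e.
    have c0 : m ^+ k * (rate h' - e) @[k --> \oo] --> 0.
      rewrite -(mul0r (rate h' - e)).
      by apply: cvgM; [apply: cvg_expr; rewrite ger0_norm// ltW|exact: cvg_cst].
    have [k _ Hk] := cvgr_le _ c0 _ x0.
    by exists k; apply: Hk => /=.
  pose n := maxn N1 N2.
  have h1 := H1 n (leq_maxl _ _).
  have h2 := H2 (n + k)%N (leq_trans (leq_maxr N1 N2) (leq_addr _ _)).
  have mn : 0 < m ^+ n by rewrite exprn_gt0.
  have mnk : 0 < m ^+ k by rewrite exprn_gt0.
  have h3 : m ^+ (n + k) * (rate h' - e) * lap Q (m ^+ n * (rate h + e)) <=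
      m ^+ n * (rate h + e) * lap Q (m ^+ (n + k) * (rate h' - e)).
    apply: lap_ratio; first by rewrite mulr_gt0// exprn_gt0.
    by rewrite exprD -mulrA ler_pM2l.
  rewrite exprD in h2 h3.
  exact: (cross_mult mn mnk x0 y0 h1 h2 h3).
exact: (cross_limit A0 A'0 r'0 step).
Qed.

Variable Qmin : probability (pointMeasure R) R.
Hypothesis yaglom : yaglom_limit PP Z Qmin.

(** The factor of proportionality is read off along the constants [small j], where 1 - G_Q tends to
    1 and the rate to [rate 0]. *)
Lemma eigen_mean_unique Q : prob_on_nonnull Q -> pgfl_eigen Q m ->
  forall h, V0 h -> pgfl Q h = pgfl Qmin h.
Proof.
move=> Q1 E h Vh; rewrite (pgfl_Qmin C1p bmc C4pi yaglom Vh).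
have r00 := rate0_gt0 C1p C4pi.
have c1 : rate (fun=> small R j) @[j --> \oo] --> rate (fun=> 0).
  by apply: (cvg_rate C1p C4pi) => // [j|x]; [exact/V0_unit_fun/V0_small|exact: cvg_small].
have ca : 1 - pgfl Q (fun=> small R j) @[j --> \oo] --> (1 : R).
  rewrite -[X in _ --> X](subr0 1); apply: cvgB; first exact: cvg_cst.
  exact: prob_on_nonnull_small.
have cross : \forall j \near \oo,
    (1 - pgfl Q h) * rate (fun=> small R j) = rate h * (1 - pgfl Q (fun=> small R j)).
  near=> j; have rj : 0 < rate (fun=> small R j) by near: j; exact: (cvgr_gt _ c1).
  apply/eqP; rewrite eq_le (eigen_mean_cross E Vh (V0_small R j) rj)/=.
  have [rh|rh] := leP (rate h) 0.
    apply: (@le_trans _ _ 0).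
      apply: mulr_le0_ge0; first exact: rh.
      by rewrite subr_ge0; case/andP: (pgfl_bounds Q (V0_small R j)).
    apply: mulr_ge0; last exact: ltW.
    by rewrite subr_ge0; case/andP: (pgfl_bounds Q Vh).
  have swap (a b c e : R) : a * b <= c * e -> b * a <= e * c by rewrite mulrC [leRHS]mulrC.
  exact: swap (eigen_mean_cross E (V0_small R j) Vh rh).
have d1 : (1 - pgfl Q h) * rate (fun=> small R j) @[j --> \oo] --> rate h * 1.
  have c2 : rate h * (1 - pgfl Q (fun=> small R j)) @[j --> \oo] --> rate h * 1.
    by apply: cvgM; [exact: cvg_cst|exact: ca].
  by apply: cvg_trans c2; apply: near_eq_cvg; apply: filterS cross => j ->.
have d2 : (1 - pgfl Q h) * rate (fun=> small R j) @[j --> \oo] --> (1 - pgfl Q h) * rate (fun=> 0).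
  by apply: cvgM; [exact: cvg_cst|exact: c1].
have d12 := cvg_unique (@norm_hausdorff _ R) d1 d2; rewrite mulr1 in d12.
by rewrite d12 mulfK ?gt_eqF// subKr.
Unshelve. all: by end_near.
Qed.

End Rates.
End QSD.

(** * Limit laws through quantile functions *)

Section UniformLaw.
Variable R : realType.
Local Notation mR := (measurableTypeR R).

Definition unif : probability mR R := uniform_prob (@ltr01 R).

Lemma bmeas_le (x : R) : bmeas (fun u : mR => (u <= x)%R%:R : R).
Proof.
have -> : (fun u : mR => (u <= x)%R%:R : R) = \1_(`]-oo, x]%classic : set R).
  by apply/funext => u; rewrite indicE mem_setE in_itv.
by apply: bmeas_indic; exact: measurable_itv.
Qed.

Lemma Rint_unif_le (x : R) : 0 <= x <= 1 -> \int[unif]_u ((u <= x)%R%:R : R) = x.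
Proof.
move=> /andP[x0 x1]; rewrite /Rintegral integral_uniform//.
- rewrite subr0 invr1 mul1e.
  have -> : (fun u : R => ((u <= x)%R%:R : R)%:E) = (fun u => (\1_(`]-oo, x]%classic : set R) u)%:E).
    by apply/funext => u; rewrite indicE mem_setE in_itv.
  rewrite integral_indic//.
  have -> : `]-oo, x]%classic `&` `[0, 1]%classic = `[0, x]%classic :> set R.
    apply/seteqP; split => u /=; rewrite !in_itv/=.
      by move=> [-> /andP[->]].
    by move=> /andP[-> ux]; rewrite ux (le_trans ux).
  transitivity (fine (@lebesgue_measure R `[0, x])); first by [].
  rewrite lebesgue_measure_itv/= lte_fin.
  by move: x0; rewrite le_eqVlt => /predU1P[<-|x0]; rewrite ?ltxx// x0/= subr0.
by apply/measurable_EFinP; case: (bmeas_le x).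
Qed.

Lemma bmeas_nondecreasing (phi : R -> R) : {homo phi : u v / u <= v} ->
  (forall u, 0 <= phi u <= 1) -> bmeas (phi : mR -> R).
Proof.
move=> nd phi01; split; last first.
  by exists 1 => u; have /andP[p0 p1] := phi01 u; rewrite ger0_norm.
apply: (measurability _ (@RGenOInfty.measurableE R)) => _ [_ [a ->] <-].
rewrite setTI; apply: is_interval_measurable => u v /=.
rewrite !in_itv/= !andbT => au _ w /andP[uw _].
by rewrite in_itv/= andbT (lt_le_trans au)// nd.
Qed.

Lemma bmeas_sum d (T : measurableType d) (I : Type) (r : seq I) (F : I -> T -> R) :
  (forall i, bmeas (F i)) -> bmeas (fun x => \sum_(i <- r) F i x).
Proof.
move=> bF; elim: r => [|i r IH].
  by under eq_fun do rewrite big_nil; exact: bmeas_cst.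
by under eq_fun do rewrite big_cons; exact: bmeasD.
Qed.

Lemma Rint_sum d (T : measurableType d) (mu : {measure set T -> \bar R}) (I : Type) (r : seq I)
    (F : I -> T -> R) : (mu setT < +oo)%E ->
  (forall i, bmeas (F i)) ->
  \int[mu]_x (\sum_(i <- r) F i x) = \sum_(i <- r) \int[mu]_x F i x.
Proof.
move=> mufin bF; elim: r => [|i r IH].
  by under eq_Rintegral do rewrite big_nil; rewrite big_nil Rintegral_cst// mul0r.
under eq_Rintegral do rewrite big_cons.
by rewrite big_cons (RintD mufin (bF i) (bmeas_sum _ bF)) IH.
Qed.

(** Step functions on the cells ]x_i, x_(i+1)] enclose phi, and the gap between their sums
    telescopes to phi 1 - phi 0 <= 1. *)
Lemma Rint_unif_riemann (phi : R -> R) (N : nat) : {homo phi : u v / u <= v} ->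
  (forall u, 0 <= phi u <= 1) ->
  `|\int[unif]_u phi u - N.+1%:R^-1 * \sum_(0 <= i < N.+1) phi (i%:R / N.+1%:R)| <= N.+1%:R^-1.
Proof.
move=> nd phi01; have ufin := prob_fin unif.
pose x i : R := i%:R / N.+1%:R.
have N0 : (0 : R) < N.+1%:R by rewrite ltr0n.
have x0 : x 0%N = 0 by rewrite /x mul0r.
have xN : x N.+1 = 1 by rewrite /x divff// gt_eqF.
have xle i j : (i <= j)%N -> x i <= x j by move=> ij; rewrite ler_pM2r ?invr_gt0// ler_nat.
have x01 i : (i <= N.+1)%N -> 0 <= x i <= 1 by move=> iN; rewrite -x0 -xN !xle.
pose J i (u : R) : R := (u <= x i.+1)%R%:R - (u <= x i)%R%:R.
have J0 i u : 0 <= J i u.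
  rewrite subr_ge0 ler_nat; case: (leP u (x i)) => // /le_trans ->//.
  exact: xle.
have bJ i : bmeas (J i : mR -> R) by apply: bmeasB; exact: bmeas_le.
have sJ u : \sum_(0 <= i < N.+1) J i u = (u <= 1)%R%:R - (u <= 0)%R%:R.
  by rewrite (telescope_sumr (fun i => (u <= x i)%R%:R))// xN x0.
have sJ1 u : \sum_(0 <= i < N.+1) J i u <= 1.
  by rewrite sJ lerBlDr ler_wpDr// ?ler0n// lern1 leq_b1.
have IJ i : (i < N.+1)%N -> \int[unif]_u J i u = N.+1%:R^-1.
  move=> iN; rewrite (RintB ufin (bmeas_le _) (bmeas_le _)) !Rint_unif_le ?x01 ?(ltnW iN)//.
  by rewrite /x -mulrBl -natr1 addrAC subrr add0r mul1r.
have bphi := bmeas_nondecreasing nd phi01.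
have blow : bmeas (fun u : mR => \sum_(0 <= i < N.+1) phi (x i) * J i u).
  by apply: bmeas_sum => i; apply: bmeasM; [exact: bmeas_cst|exact: bJ].
have bup : bmeas (fun u : mR => \sum_(0 <= i < N.+1) phi (x i.+1) * J i u).
  by apply: bmeas_sum => i; apply: bmeasM; [exact: bmeas_cst|exact: bJ].
have Ilow : \int[unif]_u (\sum_(0 <= i < N.+1) phi (x i) * J i u) =
    N.+1%:R^-1 * \sum_(0 <= i < N.+1) phi (x i).
  rewrite (Rint_sum _ ufin) => [|i]; last by apply: bmeasM; [exact: bmeas_cst|exact: bJ].
  rewrite mulr_sumr; apply: eq_big_nat => i /andP[_ iN].
  by rewrite (RintZ ufin _ (bJ i)) IJ// mulrC.
have Iup : \int[unif]_u (\sum_(0 <= i < N.+1) phi (x i.+1) * J i u) =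
    N.+1%:R^-1 * \sum_(0 <= i < N.+1) phi (x i.+1).
  rewrite (Rint_sum _ ufin) => [|i]; last by apply: bmeasM; [exact: bmeas_cst|exact: bJ].
  rewrite mulr_sumr; apply: eq_big_nat => i /andP[_ iN].
  by rewrite (RintZ ufin _ (bJ i)) IJ// mulrC.
have Jphi i u : phi (x i) * J i u <= phi u * J i u <= phi (x i.+1) * J i u.
  rewrite /J; case: (leP u (x i)) => ui.
    by rewrite (le_trans ui (xle _ _ (leqnSn i))) subrr !mulr0 lexx.
  case: (leP u (x i.+1)) => ui1; last by rewrite subrr !mulr0 lexx.
  by rewrite subr0 !mulr1 !nd// ltW.
have lowphi : \int[unif]_u (\sum_(0 <= i < N.+1) phi (x i) * J i u) <= \int[unif]_u phi u.
  apply: (Rint_le ufin blow bphi) => u; have /andP[p0 p1] := phi01 u.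
  apply: (@le_trans _ _ (phi u * \sum_(0 <= i < N.+1) J i u)).
    by rewrite mulr_sumr; apply: ler_sum => i _; case/andP: (Jphi i u).
  by rewrite ler_piMr.
have upphi : \int[unif]_u phi u <= \int[unif]_u (\sum_(0 <= i < N.+1) phi (x i.+1) * J i u).
  (* The indicator of the complement of ]0, 1], a null set for the uniform law; adding it makes the
     upper bound hold at every u. *)
  pose r (u : R) : R := 1 - ((u <= 1)%R%:R - (u <= 0)%R%:R).
  have br : bmeas (r : mR -> R).
    by do 2!(apply: bmeasB; try exact: bmeas_cst); exact: bmeas_le.
  have Ir : \int[unif]_u r u = 0.
    rewrite (RintB ufin (bmeas_cst 1) (bmeasB (bmeas_le _) (bmeas_le _))).
    rewrite (RintB ufin (bmeas_le _) (bmeas_le _)) Rint_prob_cst !Rint_unif_le ?lexx ?ler01//.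
    by rewrite subr0 subrr.
  suff H : \int[unif]_u phi u <= \int[unif]_u (\sum_(0 <= i < N.+1) phi (x i.+1) * J i u + r u).
    by apply: (le_trans H); rewrite (RintD ufin bup br) Ir addr0.
  apply: (Rint_le ufin bphi (bmeasD bup br)) => u; have /andP[p0 p1] := phi01 u.
  apply: (@le_trans _ _ (phi u * (\sum_(0 <= i < N.+1) J i u) + r u)); last first.
    by rewrite lerD2r mulr_sumr; apply: ler_sum => i _; case/andP: (Jphi i u).
  rewrite /r -sJ; have := sJ1 u; move: (\sum_(0 <= i < N.+1) J i u) => c c1.
  have : 0 <= (1 - c) * (1 - phi u) by rewrite mulr_ge0// subr_ge0.
  lra.
move: lowphi upphi; rewrite Ilow Iup => lo up.
have tel : \sum_(0 <= i < N.+1) phi (x i.+1) - \sum_(0 <= i < N.+1) phi (x i) <= 1.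
  rewrite -sumrB (telescope_sumr (fun i => phi (x i)))// xN x0.
  have /andP[p0 p1] := phi01 0; have /andP[q0 q1] := phi01 1; lra.
rewrite ger0_norm ?subr_ge0//.
have iN0 : 0 <= (N.+1%:R : R)^-1 by rewrite invr_ge0 ltW.
have := ler_wpM2l iN0 tel; rewrite mulrBr mulr1; move: lo up; rewrite /x.
move: (N.+1%:R^-1 * \sum_(0 <= i < N.+1) phi (i%:R / _)) => a lo up H.
by rewrite lerBlDl (le_trans up)// -lerBlDl.
Qed.

(* Pointwise convergence along an ultrafilter is no substitute for dominated
   convergence, but for monotone functions Riemann sums are uniformly close to
   the integral. *)
Lemma Rint_unif_cvg (F : set_system nat) {FF : ProperFilter F} (phi_ : nat -> R -> R) (phi : R -> R) :
  (forall n, {homo phi_ n : u v / u <= v}) -> (forall n u, 0 <= phi_ n u <= 1) ->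
  {homo phi : u v / u <= v} -> (forall u, 0 <= phi u <= 1) ->
  (forall u, phi_ n u @[n --> F] --> phi u) ->
  \int[unif]_u phi_ n u @[n --> F] --> \int[unif]_u phi u.
Proof.
move=> nd_ phi_01 nd phi01 cphi; apply/cvgrPdist_le => /= e e0.
have e30 : 0 < e / 3 by rewrite divr_gt0.
have [N] := ex_invS_lt e30; move kE : N.+1%:R^-1 => k Ne.
pose S (f : R -> R) : R := N.+1%:R^-1 * \sum_(0 <= i < N.+1) f (i%:R / N.+1%:R).
have cS : S (phi_ n) @[n --> F] --> S phi.
  apply: cvgM; first exact: cvg_cst.
  elim: (index_iota _ _) => [|i r IH].
    by under eq_fun do rewrite big_nil; rewrite big_nil; exact: cvg_cst.
  by under eq_fun do rewrite big_cons; rewrite big_cons; apply: cvgD; [exact: cphi|exact: IH].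
near=> n.
have := Rint_unif_riemann N (nd_ n) (phi_01 n).
have := Rint_unif_riemann N nd phi01.
have : `|S phi - S (phi_ n)| <= e / 3 by near: n; move/cvgrPdist_le: cS; exact.
rewrite -/(S phi) -/(S (phi_ n)) kE; move: (S phi) (S (phi_ n)) => a b.
move: (\int[unif]_u phi_ n u) (\int[unif]_u phi u) => c d.
rewrite !ler_norml => /andP[? ?] /andP[? ?] /andP[? ?]; apply/andP; split; lra.
Unshelve. all: by end_near.
Qed.

End UniformLaw.

(** * Images of measures with a density *)

Section WeightedLaw.
Variable R : realType.
Local Notation mR := (measurableTypeR R).
Context d (T : measurableType d) (mu : {measure set T -> \bar R}).
Variables (X : T -> mR) (k : T -> R).

(* The proofs are arguments so that the measure instance below can be inferred. *)
Definition wlaw (mX : measurable_fun setT X) (mk : measurable_fun setT k)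
    (k0 : forall t, 0 <= k t) (B : set mR) : \bar R :=
  (\int[mu]_(t in X @^-1` B) (k t)%:E)%E.

Hypotheses (mX : measurable_fun setT X) (mk : measurable_fun setT k).
Hypothesis k0 : forall t, 0 <= k t.
Local Notation nu := (wlaw mX mk k0).

Let wlaw0 : nu set0 = 0%E.
Proof. by rewrite /wlaw preimage_set0 integral_set0. Qed.

Let wlaw_ge0 B : (0 <= nu B)%E.
Proof. by apply: integral_ge0 => t _; rewrite lee_fin. Qed.

Let wlaw_sigma_additive : semi_sigma_additive nu.
Proof.
move=> /= F mF tF mUF; rewrite /wlaw; apply: cvg_toP.
  apply: ereal_nondecreasing_is_cvgn => m n mn.
  apply: lee_sum_nneg_natr => // j _ _.
  by apply: integral_ge0 => t _; rewrite lee_fin.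
rewrite preimage_bigcup ge0_integral_bigcup//=.
- by move=> j; rewrite -[X in measurable X]setTI; exact: mX.
- by apply/measurable_EFinP/measurable_funTS.
- by move=> t _; rewrite lee_fin.
- apply/trivIsetP => i j _ _ ij; rewrite -preimage_setI.
  by move/trivIsetP: tF => /(_ i j Logic.I Logic.I ij) ->; rewrite preimage_set0.
Qed.

HB.instance Definition _ := isMeasure.Build _ _ _ nu wlaw0 wlaw_ge0 wlaw_sigma_additive.

Import HBNNSimple.

(** Change of variables, by monotone convergence from simple functions; the density may be
    unbounded, as it is in [levy]. *)
Lemma ge0_integral_wlaw (f : mR -> \bar R) : measurable_fun setT f ->
  (forall x, 0 <= f x)%E ->
  (\int[nu]_x f x = \int[mu]_t (f (X t) * (k t)%:E))%E.
Proof.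
move=> mf f0; have mkE : measurable_fun setT (fun t => (k t)%:E) by exact/measurable_EFinP.
pose f_ := nnsfun_approx measurableT mf.
have fcv x : (f_ n x)%:E @[n --> \oo] --> f x by exact: cvg_nnsfun_approx.
have fnd x m n : (m <= n)%N -> ((f_ m x)%:E <= (f_ n x)%:E)%E.
  by move=> mn; rewrite lee_fin; exact/lefP/nd_nnsfun_approx.
transitivity (limn (fun n => \int[nu]_x (f_ n x)%:E))%E.
  rewrite -monotone_convergence//.
  - by apply: eq_integral => y _; apply/esym/cvg_lim.
  - by move=> n; exact/measurable_EFinP/measurable_funP.
  - by move=> n y _; rewrite lee_fin.
  - by move=> y _ m n mn; exact: fnd.
transitivity (limn (fun n => \int[mu]_t ((f_ n (X t))%:E * (k t)%:E)))%E; last first.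
  rewrite -monotone_convergence//; last 3 first.
    - move=> n; apply: emeasurable_funM => //; apply/measurable_EFinP.
      by apply: measurableT_comp mX; exact: measurable_funP.
    - by move=> n t _; rewrite -EFinM lee_fin mulr_ge0.
    - by move=> t _ m n mn; rewrite lee_wpmul2r ?lee_fin//; exact: fnd.
  apply: eq_integral => t _; apply/cvg_lim => //.
  rewrite muleC; under eq_fun do rewrite muleC.
  by apply: cvgeZl => //; exact: fcv.
congr (limn _); apply/funext => n.
have mfX r : measurable (X @^-1` (f_ n @^-1` [set r])).
  by rewrite -[X in measurable X]setTI; exact: mX.
transitivity (\sum_(r \in range (f_ n)) \int[mu]_t (r * \1_(X @^-1` (f_ n @^-1` [set r])) t * k t)%:E)%E.
  under eq_integral do rewrite fimfunE -fsumEFin//.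
  rewrite ge0_integral_fsum//; last 2 first.
  - by move=> r; exact/measurable_EFinP/measurable_funM.
  - by move=> r x _; rewrite nnfun_muleindic_ge0.
  apply: eq_fsbigr => r /set_mem[x _ rx]; have r0 : 0 <= r by rewrite -rx.
  rewrite integralZl_indic_nnsfun// integral_indic//= setIT /wlaw integral_mkcond.
  rewrite -ge0_integralZl//; last 2 first.
  - by apply/(measurable_restrictT _ _).1 => //; exact: measurable_funTS.
  - by move=> t _; rewrite patchE; case: ifP; rewrite ?lee_fin.
  apply: eq_integral => t _; rewrite patchE indicE.
  by case: ifP => _; rewrite ?mulr1 ?mulr0 ?mul0r ?mule0// EFinM.
rewrite -ge0_integral_fsum//.
- by apply: eq_integral => t _; rewrite -EFinM [f_ n (X t)]fimfunE mulr_fsuml -fsumEFin.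
- by move=> r; apply/measurable_EFinP; do 2 apply: measurable_funM => //.
- move=> r t _; rewrite lee_fin mulr_ge0//.
  by have := nnfun_muleindic_ge0 (f_ n) r (X t); rewrite -EFinM lee_fin.
Qed.

End WeightedLaw.

Section WeightedLawUnique.
Variable R : realType.
Local Notation mR := (measurableTypeR R).
Context d1 (T1 : measurableType d1) (mu1 : {measure set T1 -> \bar R})
  d2 (T2 : measurableType d2) (mu2 : {measure set T2 -> \bar R}).
Variables (X1 : T1 -> mR) (k1 : T1 -> R) (X2 : T2 -> mR) (k2 : T2 -> R).
Hypotheses (fin1 : (mu1 setT < +oo)%E) (fin2 : (mu2 setT < +oo)%E).
Hypotheses (mX1 : measurable_fun setT X1) (mX2 : measurable_fun setT X2).
Hypotheses (bk1 : bmeas k1) (bk2 : bmeas k2).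

(** Equality of the two weighted images tested on one function; with boundedness included it is a
    [bp_closed] class. *)
Definition same_law (g : R -> R) : Prop := bmeas (g : mR -> R) /\
  \int[mu1]_t (g (X1 t) * k1 t) = \int[mu2]_t (g (X2 t) * k2 t).

Lemma bmeas_wcomp d (T : measurableType d) (X : T -> mR) (k : T -> R) (g : mR -> R) :
  measurable_fun setT X -> bmeas k -> bmeas g -> bmeas (fun t => g (X t) * k t).
Proof. by move=> mX bk bg; apply: bmeasM => //; exact: bmeas_comp bg mX. Qed.

Lemma same_law_bp_closed : bp_closed same_law.
Proof.
have lin d (T : measurableType d) (mu : {measure set T -> \bar R}) (X : T -> mR) (k : T -> R)
    (a : R) (f g : mR -> R) : (mu setT < +oo)%E -> measurable_fun setT X -> bmeas k ->
    bmeas f -> bmeas g -> \int[mu]_t ((a * f (X t) + g (X t)) * k t) =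
      a * \int[mu]_t (f (X t) * k t) + \int[mu]_t (g (X t) * k t).
  move=> fin mX bk bf bg; rewrite -(Rint_lin fin a (bmeas_wcomp mX bk bf) (bmeas_wcomp mX bk bg)).
  by apply: eq_Rintegral => t _; rewrite mulrDl mulrA.
have lim d (T : measurableType d) (mu : {measure set T -> \bar R}) (X : T -> mR) (k : T -> R)
    (f_ : nat -> mR -> R) (f : mR -> R) (C : R) : (mu setT < +oo)%E -> measurable_fun setT X -> bmeas k ->
    (forall n, bmeas (f_ n)) -> (forall n x, `|f_ n x| <= C) ->
    (forall x, f_ n x @[n --> \oo] --> f x) ->
    \int[mu]_t (f_ n (X t) * k t) @[n --> \oo] --> \int[mu]_t (f (X t) * k t).
  move=> fin mX bk bf fC ff; have [_ [K kK]] := bk.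
  apply: (Rint_bcvg fin (C := C * K)).
  - by move=> n; case: (bmeas_wcomp mX bk (bf n)).
  - by move=> n t; rewrite normrM ler_pM.
  - by move=> t; apply: cvgM; [exact: ff|exact: cvg_cst].
split=> [a f g [bf ef] [bg eg]|f_ f C Ff fC ff].
  by split; [exact: bmeas_lin|rewrite !lin// ef eg].
have bf_ n : bmeas (f_ n : mR -> R) by case: (Ff n).
split; first by apply: (@bmeas_cvg _ mR _ f_ f C) => // n; case: (bf_ n).
have c1 := lim _ _ _ _ _ _ _ _ fin1 mX1 bk1 bf_ fC ff.
have c2 := lim _ _ _ _ _ _ _ _ fin2 mX2 bk2 bf_ fC ff.
apply: (cvg_unique _ c1) => //.
rewrite (_ : (fun n => _) = fun n => \int[mu2]_t (f_ n (X2 t) * k2 t))//.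
by apply/funext => n; case: (Ff n).
Qed.

Lemma same_law_rays : same_law (fun=> 1) ->
  (forall a, same_law \1_(`]a, +oo[%classic : set R)) ->
  forall g : mR -> R, bmeas g -> same_law g.
Proof. by move=> H1 Hray; exact: (bp_rays same_law_bp_closed H1 Hray). Qed.

End WeightedLawUnique.

(** * Quantile functions of weighted laws on [0, 1] *)

Section Quantile.
Variable R : realType.
Local Notation mR := (measurableTypeR R).
Context d (T : measurableType d) (mu : {measure set T -> \bar R}).
Variables (y w : T -> R).
Hypotheses (fin : (mu setT < +oo)%E) (my : measurable_fun setT (y : T -> mR)) (bw : bmeas w).
Hypotheses (w0 : forall t, 0 <= w t) (w1 : \int[mu]_t w t = 1).
Hypothesis y01 : forall t, 0 <= y t <= 1.

Let cdf (a : R) : R := \int[mu]_t ((y t <= a)%R%:R * w t).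
Let level (u : R) : set R := [set a | 0 <= a <= 1 /\ (u <= cdf a \/ a = 1)].
Definition quantile (u : R) : R := inf (level u).

Let bcdf (a : R) : bmeas (fun t => (y t <= a)%R%:R * w t).
Proof. exact: (bmeas_wcomp my bw (bmeas_le a)). Qed.

Let cdf01 a : 0 <= cdf a <= 1.
Proof.
rewrite -w1; apply/andP; split.
  by apply: Rintegral_ge0 => t _; rewrite mulr_ge0.
apply: (Rint_le fin (bcdf a) bw) => t.
by rewrite ler_piMl// lern1 leq_b1.
Qed.

Let cdf_nd a b : a <= b -> cdf a <= cdf b.
Proof.
move=> ab; apply: (Rint_le fin (bcdf a) (bcdf b)) => t.
rewrite ler_wpM2r// ler_nat; case: (leP (y t) a) => // /le_trans ->//.
Qed.

Let cdf_rcont a : cdf (a + n.+1%:R^-1) @[n --> \oo] --> cdf a.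
Proof.
have [_ [C wC]] := bw.
apply: (Rint_bcvg fin (C := C)).
- by move=> n; case: (bcdf (a + n.+1%:R^-1)).
- move=> n t; rewrite normrM (le_trans _ (wC t))// ler_piMl//.
  by rewrite normr_nat lern1 leq_b1.
- move=> t; apply: cvgM; last exact: cvg_cst.
  have [ya|ay] := leP (y t) a.
    rewrite (_ : (fun n => _) = fun=> 1); first exact: cvg_cst.
    by apply/funext => n; rewrite (le_trans ya)// lerDl.
  have : 0 < y t - a by rewrite subr_gt0.
  move=> /ex_invS_lt[N Ny]; apply: cvg_near_cst.
  exists N => // n /= Nn; rewrite leNgt; suff -> : a + n.+1%:R^-1 < y t by [].
  rewrite -ltrBrDl (le_lt_trans _ Ny)// lef_pV2 ?posrE ?ltr0n// ler_nat.
  by rewrite ltnS.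
Qed.

Let level1 u : level u 1. Proof. by split; [rewrite ler01 lexx|right]. Qed.

Let has_inf_level u : has_inf (level u).
Proof. by split; [exists 1; exact: level1|exists 0 => a [/andP[]]]. Qed.

Lemma quantile01 u : 0 <= quantile u <= 1.
Proof.
apply/andP; split; first by apply: lb_le_inf; [exists 1; exact: level1|move=> a [/andP[]]].
by apply: ge_inf; [exact: (has_inf_level u).2|exact: level1].
Qed.

Lemma quantile_nd : {homo quantile : u v / u <= v}.
Proof.
move=> u v uv; apply: lb_le_inf; first by exists 1; exact: level1.
move=> a [a01 ua]; apply: ge_inf; first exact: (has_inf_level u).2.
by split=> //; case: ua => [/(le_trans uv)|->]; [left|right].
Qed.

(** The Galois relation, from right-continuity of the distribution function. It fails at a = 1 for u
    > 1, as quantiles never exceed 1. *)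
Lemma quantile_le u a : 0 <= a < 1 -> (quantile u <= a) = (u <= cdf a).
Proof.
move=> /andP[a0 a1]; apply/idP/idP => H; last first.
  by apply: ge_inf; [exact: (has_inf_level u).2|split; [rewrite a0 ltW|left]].
rewrite leNgt; apply/negP => au.
have : 0 < 1 - a by rewrite subr_gt0.
move=> /ex_invS_lt[N Na].
have [M _ HM] := cvgr_lt _ (@cdf_rcont a) _ au.
(* M brings the distribution function below u at a + 1 / (n + 1); N keeps that point below 1, which
   rules out the default element of [level u]. *)
have := HM (maxn M N) (leq_maxl M N); rewrite ltNge => /negP; apply.
have e0 : (0 : R) < (maxn M N).+1%:R^-1 by rewrite invr_gt0.
have [b [b01 ub] bq] := inf_adherent e0 (has_inf_level u).
have ba : b < a + (maxn M N).+1%:R^-1 by rewrite (lt_le_trans bq)// lerD2r.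
case: ub => [ub|b1]; first by rewrite (le_trans ub)// cdf_nd// ltW.
exfalso; move: ba; rewrite b1 -ltrBlDl ltNge => /negP; apply.
by rewrite (le_trans _ (ltW Na))// lef_pV2 ?posrE ?ltr0n// ler_nat ltnS leq_maxr.
Qed.

(** Inverse transform sampling: on rays it is the Galois relation, and rays determine the law. *)
Lemma Rint_quantile (g : mR -> R) : bmeas g ->
  \int[unif R]_u g (quantile u) = \int[mu]_t (g (y t) * w t).
Proof.
have mq : measurable_fun setT (quantile : mR -> mR).
  by case: (bmeas_nondecreasing quantile_nd quantile01).
suff H : forall g : mR -> R, bmeas g ->
    same_law (unif R) mu (quantile : mR -> mR) (fun=> 1) (y : T -> mR) w g.
  move=> /H[_ <-]; by apply: eq_Rintegral => u _; rewrite mulr1.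
apply: same_law_rays => //; [exact: prob_fin|exact: bmeas_cst| |].
  split; first exact: bmeas_cst.
  under [RHS]eq_Rintegral do rewrite mul1r.
  by rewrite w1; under eq_Rintegral do rewrite mulr1; rewrite Rint_prob_cst.
move=> a; split; first exact: bmeas_indic.
have ray (x : R) : \1_(`]a, +oo[%classic : set R) x = (a < x)%R%:R :> R.
  by rewrite indicE mem_setE in_itv/= andbT.
under eq_Rintegral do rewrite mulr1 ray; under [RHS]eq_Rintegral do rewrite ray.
have [a0|a0] := ltP a 0.
  transitivity (\int[unif R]_u (1 : R)).
    apply: eq_Rintegral => u _; rewrite (lt_le_trans a0)//.
    by case/andP: (quantile01 u).
  rewrite Rint_prob_cst; transitivity (\int[mu]_t w t); first by rewrite w1.
  apply: eq_Rintegral => t _; by have /andP[yt0 _] := y01 t; rewrite (lt_le_trans a0 yt0) mul1r.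
have [a1|a1] := leP 1 a.
  transitivity (\int[unif R]_u (0 : R)).
    apply: eq_Rintegral => u _; rewrite ltNge (le_trans _ a1)//.
    by case/andP: (quantile01 u).
  rewrite Rint_prob_cst -(mul0r (\int[mu]_t w t)) -(RintZ fin 0 bw); apply: eq_Rintegral => t _.
  by have /andP[_ yt1] := y01 t; rewrite ltNge (le_trans yt1 a1) !mul0r.
transitivity (\int[unif R]_u (1 - (u <= cdf a)%R%:R : R)).
  apply: eq_Rintegral => u _; rewrite ltNge quantile_le ?a0//.
  by case: (u <= cdf a); rewrite ?subrr ?subr0.
rewrite (RintB (prob_fin (unif R)) (bmeas_cst 1) (bmeas_le _)) Rint_prob_cst Rint_unif_le//.
transitivity (\int[mu]_t w t - cdf a); first by rewrite w1.
rewrite -(RintB fin bw (bcdf a)); apply: eq_Rintegral => t _.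
by rewrite ltNge; case: (y t <= a); rewrite ?mul0r ?mul1r ?subrr ?subr0.
Qed.

End Quantile.

Section UltraLimit.

Lemma ultra_fmap (S T : Type) (f : S -> T) (U : set_system S) :
  UltraFilter U -> UltraFilter (f @ U).
Proof.
move=> UU; split; first exact: fmap_proper_filter.
move=> G GG UG; apply/seteqP; split => [A GA|]; last exact: UG.
have [//|UnA] := in_ultra_setVsetC (f @^-1` A) UU.
have : G (~` A) by apply: UG.
move=> GnA; have G0 : G (A `&` ~` A) by exact: filterI.
by have [t []] := filter_ex G0.
Qed.

Lemma ultra_cvg01 (R : realType) (S : Type) (U : set_system S) (f : S -> R) : UltraFilter U ->
  (forall s, 0 <= f s <= 1) -> exists2 l : R, 0 <= l <= 1 & f s @[s --> U] --> l.
Proof.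
move=> UU f01.
have := @segment_compact R 0 1; rewrite compact_ultra => /(_ (f @ U) (ultra_fmap f UU)).
case=> [|l [/= l01 fl]].
  by rewrite /fmap/=; apply: filterS filterT => s _; rewrite /= in_itv/=.
by exists l => //; rewrite in_itv/= in l01.
Qed.

End UltraLimit.

(** * A limit law with prescribed Laplace transform *)

Section LimitLaw.
Variable R : realType.
Local Notation mR := (measurableTypeR R).

Lemma cvg_powR (S : Type) (F : set_system S) {FF : Filter F} (f : S -> R) (l s : R) : 0 < s ->
  (forall x, 0 <= f x) -> 0 <= l -> f x @[x --> F] --> l -> f x `^ s @[x --> F] --> l `^ s.
Proof.
move=> s0 f0; rewrite le_eqVlt => /predU1P[<-|l0] fl.
  rewrite powR0 ?gt_eqF//; apply/cvgrPdist_lt => /= e e0.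
  have es0 : 0 < e `^ s^-1 by rewrite powR_gt0.
  near=> x; rewrite sub0r normrN ger0_norm ?powR_ge0//.
  have -> : e = (e `^ s^-1) `^ s by rewrite -powRrM mulVf ?gt_eqF// powRr1// ltW.
  apply: gt0_ltr_powR; rewrite ?nnegrE ?f0 ?powR_ge0//.
  by near: x; exact: (cvgr_lt _ fl).
rewrite {2}/powR gt_eqF//.
have c : expR (s * ln (f x)) @[x --> F] --> expR (s * ln l).
  apply: continuous_cvg; first exact: continuous_expR.
  apply: cvgM; first exact: cvg_cst.
  by apply: continuous_cvg fl; exact: continuous_ln.
apply: cvg_trans c; apply: near_eq_cvg; near=> x.
by rewrite /powR gt_eqF//; near: x; exact: (cvgr_gt _ fl).
Unshelve. all: by end_near.
Qed.

Lemma bmeas_powR (s : R) : 0 <= s -> bmeas (fun y : mR => (Num.max 0 (Num.min 1 y)) `^ s : R).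
Proof.
move=> s0; have c01 (y : R) : 0 <= Num.max 0 (Num.min 1 y) <= 1.
  by rewrite le_max lexx/= ge_max ler01/= ge_min lexx.
apply: bmeas_nondecreasing => [u v uv|u].
  apply: ge0_ler_powR => //; rewrite ?nnegrE; [by case/andP: (c01 u)|by case/andP: (c01 v)|].
  rewrite ge_max le_max lexx/= le_max; apply/orP; right.
  by rewrite le_min ge_min lexx/= ge_min uv orbT.
have /andP[a0 a1] := c01 u; rewrite powR_ge0/=.
by have := @ge0_ler_powR R s s0 _ 1 _ _ a1; rewrite powR1; apply; rewrite nnegrE.
Qed.

Lemma Rint_indic d (T : measurableType d) (Q : probability T R) (A : set T) :
  measurable A -> \int[Q]_x (\1_A x : R) = fine (Q A).
Proof. by move=> mA; rewrite /Rintegral integral_indic// setIT. Qed.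

Lemma Rint_eq_null d (T : measurableType d) (Q : probability T R) (f g : T -> R) (N : set T) :
  bmeas f -> bmeas g -> measurable N -> Q N = 0%E -> (forall t, ~ N t -> f t = g t) ->
  \int[Q]_t f t = \int[Q]_t g t.
Proof.
move=> bf bg mN N0 fg; rewrite /Rintegral; congr fine; apply: ae_eq_integral => //.
- by apply/measurable_EFinP; case: bf.
- by apply/measurable_EFinP; case: bg.
- exists N; split=> // t /= ntfg; apply: contrapT => nN; apply: ntfg => _.
  by rewrite fg.
Qed.

Context d (T : measurableType d) (mu : {measure set T -> \bar R}).
Hypothesis fin : (mu setT < +oo)%E.
Variables (x_ : nat -> T -> R) (c_ : nat -> R) (psi : R -> R).
Hypotheses (mx : forall n, measurable_fun setT (x_ n)) (x0 : forall n t, 0 <= x_ n t).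
Hypothesis c0 : forall n, 0 <= c_ n.
Let Psi n (s : R) : R := c_ n * \int[mu]_t (1 - expR (- (s * x_ n t))).
Hypothesis cPsi : forall s : R, 0 <= s -> Psi n s @[n --> \oo] --> psi s.
Hypothesis psi1 : psi 1 = 1.
Hypothesis psi_nd : forall s t : R, 0 <= s -> s <= t -> psi s <= psi t.
Hypothesis psi_at0 : forall e : R, 0 < e -> exists2 s : R, 0 < s & psi s < e.
Hypothesis psi_diff : forall e : R, 0 < e -> exists2 s : R, 0 < s & psi (s + 1) - psi s < e.

Let b_exp n (s : R) : 0 <= s -> bmeas (fun t => expR (- (s * x_ n t))).
Proof.
move=> s0; split.
  apply: measurableT_comp => //; apply: measurableT_comp => //.
  by apply: measurable_funM => //.
by exists 1 => t; rewrite ger0_norm ?expR_ge0// expR_le1 oppr_le0 mulr_ge0.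
Qed.

(** The density 1 - exp(-x_n), normalised to mass 1, for the variable exp(-x_n). The latter lives in
    the compact [0, 1], so limits exist without tightness; mass at the ends is excluded
    afterwards. *)
Let w n t : R := c_ n / Psi n 1 * (1 - expR (- (1 * x_ n t))).
Let y n t : R := expR (- x_ n t).
Let q n : R -> R := quantile mu (y n) (w n).

(** exp(-s x) (1 - exp(-x)) = (1 - exp(-(s + 1) x)) - (1 - exp(-s x)). *)
Let moment n (s : R) : 0 <= s -> 0 < Psi n 1 ->
  \int[unif R]_u (q n u `^ s) = (Psi n (s + 1) - Psi n s) / Psi n 1.
Proof.
move=> s0 P1.
have by_ : forall t, 0 <= y n t <= 1.
  by move=> t; rewrite expR_ge0/= expR_le1 oppr_le0.
have my : measurable_fun setT (y n : T -> mR).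
  by have [] := b_exp n ler01; under eq_fun do rewrite mul1r.
have b1 : bmeas (fun t => 1 - expR (- (1 * x_ n t))).
  by apply: bmeasB; [exact: bmeas_cst|exact: b_exp].
have bw : bmeas (w n) by apply: bmeasM; [exact: bmeas_cst|].
have w0 t : 0 <= w n t.
  rewrite mulr_ge0//; first by rewrite divr_ge0// ltW.
  by rewrite subr_ge0 expR_le1 oppr_le0 mul1r.
have w1 : \int[mu]_t w n t = 1.
  by rewrite (RintZ fin _ b1) mulrAC -/(Psi n 1) divff// gt_eqF.
have := Rint_quantile fin my bw w0 w1 by_ (bmeas_powR s0).
have cl (a : R) : 0 <= a <= 1 -> Num.max 0 (Num.min 1 a) = a.
  by move=> /andP[a0 a1]; rewrite min_r// max_r.
under eq_Rintegral do rewrite cl ?quantile01//.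
under [RHS]eq_Rintegral do rewrite cl//.
rewrite -/(q n) => ->.
have bs1 : bmeas (fun t => 1 - expR (- ((s + 1) * x_ n t))).
  by apply: bmeasB; [exact: bmeas_cst|apply: b_exp; rewrite addr_ge0].
have bs : bmeas (fun t => 1 - expR (- (s * x_ n t))).
  by apply: bmeasB; [exact: bmeas_cst|exact: b_exp].
transitivity (\int[mu]_t (c_ n / Psi n 1 *
  ((1 - expR (- ((s + 1) * x_ n t))) - (1 - expR (- (s * x_ n t)))))).
  apply: eq_Rintegral => t _; rewrite /w /y -expRM.
  have -> : - ((s + 1) * x_ n t) = - x_ n t * s + - x_ n t by ring.
  rewrite expRD mul1r; have -> : - (s * x_ n t) = - x_ n t * s by ring.
  by ring.
rewrite (RintZ fin _ (bmeasB bs1 bs)) (RintB fin bs1 bs) /Psi.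
by rewrite mulrBr mulrBl mulrAC -[X in _ - X]mulrAC -!mulrA.
Qed.

(* Helly's selection principle: quantile functions are monotone with values in
   [0, 1], so a pointwise limit along an ultrafilter does. *)
Lemma ex_limit_quantile : exists2 Y : R -> R,
  {homo Y : u v / u <= v} /\ (forall u, 0 <= Y u <= 1) &
  forall s : R, 0 < s -> \int[unif R]_u (Y u `^ s) = psi (s + 1) - psi s.
Proof.
have [U [UU oU]] := @ultraFilterLemma nat \oo _.
have /choice[Y HY] : forall u, exists l : R, 0 <= l <= 1 /\ q n u @[n --> U] --> l.
  move=> u; have [l l01 cl] := ultra_cvg01 UU (fun n => quantile01 mu (y n) (w n) u).
  by exists l.
have Ynd : {homo Y : u v / u <= v}.
  move=> u v uv; have [_ cu] := HY u; have [_ cv] := HY v.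
  by apply: (ler_cvg_to cu cv); apply: nearW => n; exact: quantile_nd.
have Y01 u : 0 <= Y u <= 1 by case: (HY u).
exists Y; first by [].
move=> s s0; have s0' := ltW s0.
have pw01 (a : R) : 0 <= a <= 1 -> 0 <= a `^ s <= 1.
  move=> /andP[a0 a1]; rewrite powR_ge0/=.
  by have := @ge0_ler_powR R s s0' _ 1 _ _ a1; rewrite powR1; apply; rewrite nnegrE.
have pwnd (f : R -> R) : {homo f : u v / u <= v} -> (forall u, 0 <= f u <= 1) ->
    {homo (fun u => f u `^ s) : u v / u <= v}.
  move=> fnd f01 u v uv; have /andP[u0 _] := f01 u; have /andP[v0 _] := f01 v.
  by apply: ge0_ler_powR; rewrite ?nnegrE ?fnd.
have c1 : \int[unif R]_u (q n u `^ s) @[n --> U] --> \int[unif R]_u (Y u `^ s).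
  apply: (@Rint_unif_cvg R U _ (fun n u => q n u `^ s) (fun u => Y u `^ s)).
  - by move=> n; apply: pwnd => [|u]; [exact: quantile_nd|exact: quantile01].
  - by move=> n u; apply: pw01; exact: quantile01.
  - exact: pwnd.
  - by move=> u; exact: pw01.
  - move=> u; have [/andP[Y0 _] cu] := HY u.
    by apply: cvg_powR => // n; case/andP: (quantile01 mu (y n) (w n) u).
have c2 : \int[unif R]_u (q n u `^ s) @[n --> \oo] --> (psi (s + 1) - psi s) / psi 1.
  have c3 : (Psi n (s + 1) - Psi n s) / Psi n 1 @[n --> \oo] --> (psi (s + 1) - psi s) / psi 1.
    apply: cvgM; first by apply: cvgB; apply: cPsi; rewrite ?addr_ge0.
    by apply: cvgV; [rewrite psi1 oner_neq0|exact: cPsi].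
  apply: cvg_trans c3; apply: near_eq_cvg; near=> n.
  rewrite moment//; near: n; apply: (cvgr_gt _ (cPsi ler01)).
  by rewrite psi1.
rewrite psi1 divr1 in c2.
have c2U : \int[unif R]_u (q n u `^ s) @[n --> U] --> psi (s + 1) - psi s.
  by move=> A /c2 HA; exact: oU.
exact: (cvg_unique (@norm_hausdorff _ R) c1 c2U).
Unshelve. all: by end_near.
Qed.

(** X = - ln Y. Small s shows that Y = 0 has probability at most psi(s), hence 0; Y = 1 has
    probability at most psi(s + 1) - psi(s), which can be made arbitrarily small. *)
Lemma ex_limit_law : exists X : R -> R,
  [/\ measurable_fun setT (X : mR -> mR), (forall u, 0 < X u) &
  forall s : R, 0 <= s -> \int[unif R]_u expR (- (s * X u)) = psi (s + 1) - psi s].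
Proof.
have [Y [Ynd Y01] mY] := ex_limit_quantile.
have ufin := prob_fin (unif R).
have measY : measurable_fun setT (Y : mR -> mR) by case: (bmeas_nondecreasing Ynd Y01).
have mlt (a : R) : measurable (Y @^-1` [set a] : set mR).
  by rewrite -[X in measurable X]setTI; apply: measY => //; exact: measurable_set1.
have bY (s : R) : 0 < s -> bmeas (fun u : mR => Y u `^ s : R).
  move=> s0; apply: bmeas_nondecreasing => [u v uv|u]; have /andP[u0 u1] := Y01 u.
    by have /andP[v0 _] := Y01 v; apply: (ge0_ler_powR (ltW s0)); rewrite ?nnegrE ?Ynd.
  rewrite powR_ge0/=.
  by have := @ge0_ler_powR R s (ltW s0) _ 1 _ _ u1; rewrite powR1; apply; rewrite nnegrE.
have null0 (A : set mR) : measurable A -> (forall e : R, 0 < e -> fine (unif R A) <= e) -> unif R A = 0%E.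
  move=> mA H; have Afin : unif R A \is a fin_num by exact: fin_num_measure.
  apply/eqP; rewrite eq_le measure_ge0 andbT -(fineK Afin) lee_fin.
  by apply/ler_addgt0Pr => e e0; rewrite add0r; exact: H.
have Y0 : unif R (Y @^-1` [set 0]) = 0%E.
  apply: null0 => // e e0; have [s s0 se] := psi_at0 e0.
  have bI := bmeas_indic R (mlt 0).
  rewrite -Rint_indic//; apply: le_trans (ltW se).
  apply: (@le_trans _ _ (\int[unif R]_u (1 - Y u `^ s))).
    apply: (Rint_le ufin bI (bmeasB (bmeas_cst 1) (bY s s0))) => u.
    rewrite indicE; have [/set_mem/= ->|_] := boolP (u \in _).
      by rewrite powR0 ?subr0// gt_eqF.
    rewrite subr_ge0; have /andP[u0 u1] := Y01 u.
    by have := @ge0_ler_powR R s (ltW s0) _ 1 _ _ u1; rewrite powR1; apply; rewrite nnegrE.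
  rewrite (RintB ufin (bmeas_cst 1) (bY s s0)) Rint_prob_cst mY// opprB addrCA gerDl.
  rewrite subr_le0 -psi1; apply: psi_nd => //.
  by rewrite psi1 lerDr ltW.
have Y1 : unif R (Y @^-1` [set 1]) = 0%E.
  apply: null0 => // e e0; have [s s0 se] := psi_diff e0.
  rewrite -Rint_indic//; apply: le_trans (ltW se).
  rewrite -mY//; apply: (Rint_le ufin (bmeas_indic R (mlt 1)) (bY s s0)) => u.
  rewrite indicE; have [/set_mem/= ->|_] := boolP (u \in _); first by rewrite powR1.
  exact: powR_ge0.
(* The value 1 on the null set where Y is 0 or 1 only serves to keep X positive everywhere. *)
pose X u : R := if (0 < Y u) && (Y u < 1) then - ln (Y u) else 1.
have X0 u : 0 < X u.
  rewrite /X; case: ifP => // /andP[u0 u1].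
  by rewrite oppr_gt0 ln_lt0// u0.
have mX : measurable_fun setT (X : mR -> mR).
  apply: measurable_fun_ifT => //.
    by apply: measurable_and; exact: measurable_fun_ltr.
  by apply: measurableT_comp => //; apply: measurableT_comp => //; exact: measurable_ln.
exists X; split=> // s; rewrite le_eqVlt => /predU1P[<-|s0].
  have psi00 : psi 0 = 0.
    apply: (cvg_unique (@norm_hausdorff _ R) (cPsi (lexx 0))).
    rewrite (_ : Psi^~ 0 = fun=> 0); first exact: cvg_cst.
    apply/funext => n; rewrite /Psi; under eq_Rintegral do rewrite mul0r oppr0 expR0 subrr.
    by rewrite Rintegral_cst// mul0r mulr0.
  under eq_Rintegral do rewrite mul0r oppr0 expR0.
  by rewrite Rint_prob_cst add0r psi1 psi00 subr0.
rewrite -mY//.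
apply: (@Rint_eq_null _ mR (unif R) (fun u => expR (- (s * X u))) (fun u => Y u `^ s)
  (Y @^-1` [set 0] `|` Y @^-1` [set 1])) => //.
- split; last first.
    by exists 1 => u; rewrite ger0_norm ?expR_ge0// expR_le1 oppr_le0 mulr_ge0// ltW.
  apply: measurableT_comp => //; apply: measurableT_comp => //.
  by apply: measurable_funM => //.
- exact: bY.
- exact: measurableU.
- have H : (unif R (Y @^-1` [set 0%R]) + unif R (Y @^-1` [set 1%R]) <= 0)%E by rewrite Y0 Y1 adde0.
  apply/eqP; rewrite eq_le measure_ge0 andbT; apply: le_trans H.
  exact: measureU2.
move=> u nYu; have /andP[u0 u1] := Y01 u.
have Yu0 : 0 < Y u by rewrite lt_neqAle u0 andbT eq_sym; apply/eqP => E; apply: nYu; left.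
have Yu1 : Y u < 1 by rewrite lt_neqAle u1 andbT; apply/eqP => E; apply: nYu; right.
rewrite /X Yu0 Yu1/= /powR gt_eqF//; congr expR; ring.
Qed.

End LimitLaw.

(** * Eigenvalues larger than the mean *)

Section LevyMeasure.
Variable R : realType.
Local Notation mR := (measurableTypeR R).
Local Notation U := (unif R).
Variables (psi : R -> R) (X : R -> R).
Hypotheses (mX : measurable_fun setT (X : mR -> mR)) (X0 : forall u, 0 < X u).
Hypothesis momX : forall s : R, 0 <= s -> \int[U]_u expR (- (s * X u)) = psi (s + 1) - psi s.
Hypothesis psi0 : psi 0 = 0.
Hypothesis psi_incr : forall t : R, 0 <= t -> psi (n%:R + t) - psi n%:R @[n --> \oo] --> 0.

(** The power function with exponent -1 inverts nonnegative reals only; x times the inverse of its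
    square covers both signs. *)
Lemma measurable_invr : measurable_fun setT (fun x : R => x^-1 : R).
Proof.
have -> : (fun x : R => x^-1 : R) = fun x => x * (x * x) `^ (-1).
  apply/funext => x; rewrite powR_inv1 -?expr2 ?sqr_ge0//.
  by have [->|x0] := eqVneq x 0; rewrite ?invr0 ?mul0r// expr2 invfM mulrA divff ?mul1r.
apply: measurable_funM => //.
apply: (measurableT_comp (measurable_powR (-1))).
exact: measurable_funM.
Qed.

Let ufin := prob_fin U.
Let e (s u : R) : R := expR (- (s * X u)).

Let be (s : R) : 0 <= s -> bmeas (e s : mR -> R).
Proof.
move=> s0; split.
  by apply: measurableT_comp => //; apply: measurableT_comp => //; apply: measurable_funM.
by exists 1 => u; rewrite ger0_norm ?expR_ge0// expR_le1 oppr_le0 mulr_ge0// ltW.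
Qed.

Let e1_lt1 u : e 1 u < 1.
Proof. by rewrite expR_lt1 oppr_lt0 mul1r. Qed.

Definition ratio (t u : R) : R := (1 - e t u) / (1 - e 1 u).

Lemma ratio_ge0 (t u : R) : 0 <= t -> 0 <= ratio t u.
Proof.
move=> t0; rewrite divr_ge0// subr_ge0; last exact: ltW.
by rewrite expR_le1 oppr_le0 mulr_ge0// ltW.
Qed.

Lemma ratio_le (t u : R) : 0 <= t -> ratio t u <= t + 1.
Proof.
move=> t0; rewrite ler_pdivrMr ?subr_gt0//.
have [t1|t1] := leP t 1.
  apply: (@le_trans _ _ (1 - e 1 u)).
    by rewrite lerD2l lerN2 ler_expR lerN2 ler_pM2r.
  by rewrite ler_peMl ?lerDr// subr_ge0 ltW.
have tp : 0 < t by exact: lt_trans t1.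
have ti : 0 <= t^-1 <= 1 by rewrite invr_ge0 t0 invf_le1// ltW.
have := expR_concave (t * X u) ti.
rewrite mulrA mulVf ?gt_eqF// ler_pdivrMl// => /le_trans; apply.
by rewrite /e ler_pM2r ?lerDl// subr_gt0 e1_lt1.
Qed.

Lemma bmeas_ratio (t : R) : 0 <= t -> bmeas (ratio t : mR -> R).
Proof.
move=> t0; split.
  apply: measurable_funM; first by case: (bmeasB (bmeas_cst 1) (be t0)).
  apply: (measurableT_comp measurable_invr).
  by case: (bmeasB (bmeas_cst 1) (be ler01)).
exists (t + 1) => u; rewrite ger0_norm ?ratio_ge0//.
exact: ratio_le.
Qed.

Let ratioD s t u : e s u * ratio t u = ratio (s + t) u - ratio s u.
Proof.
rewrite /ratio mulrA -mulrBl; congr (_ / _).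
have -> : e (s + t) u = e s u * e t u by rewrite /e -expRD; congr expR; ring.
by ring.
Qed.

(** Only unit increments of psi are given. As (1 - exp(-n X)) [ratio t] is the sum over k < n of
    exp(-k X) - exp(-(k + t) X), its mean telescopes to psi(t) - (psi(n + t) - psi(n)). The bracket
    tends to 0, and so does exp(-n X), since X > 0. *)
Lemma Rint_ratio (t : R) : 0 <= t -> \int[U]_u ratio t u = psi t.
Proof.
move=> t0; have br := bmeas_ratio t0.
have bS n : bmeas (fun u : mR => (1 - e n%:R u) * ratio t u).
  by apply: bmeasM => //; apply: bmeasB; [exact: bmeas_cst|exact: be].
have IS n : \int[U]_u ((1 - e n%:R u) * ratio t u) = psi t - (psi (n%:R + t) - psi n%:R).
  elim: n => [|n IH].
    rewrite add0r psi0 subr0 subrr -[RHS](Rint_prob_cst U 0).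
    by apply: eq_Rintegral => u _; rewrite /e mul0r oppr0 expR0 subrr mul0r.
  have n0 : (0 : R) <= n%:R by rewrite ler0n.
  have nt0 : (0 : R) <= n%:R + t by rewrite addr_ge0.
  transitivity (\int[U]_u ((1 - e n%:R u) * ratio t u + (e n%:R u - e (n%:R + t) u))).
    apply: eq_Rintegral => u _.
    have d0 : 1 - e 1 u != 0 by rewrite gt_eqF// subr_gt0.
    have -> : e n.+1%:R u = e n%:R u * e 1 u by rewrite /e -natr1 -expRD; congr expR; ring.
    have -> : e (n%:R + t) u = e n%:R u * e t u by rewrite /e -expRD; congr expR; ring.
    rewrite /ratio; move: (e n%:R u) (e 1 u) (e t u) d0 => a b c d0.
    by field.
  rewrite (RintD ufin (bS n) (bmeasB (be n0) (be nt0))) IH (RintB ufin (be n0) (be nt0)) !momX//.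
  have -> : n.+1%:R + t = n%:R + t + 1 by rewrite -natr1 addrAC.
  by rewrite -natr1; ring.
have c1 : \int[U]_u ((1 - e n%:R u) * ratio t u) @[n --> \oo] --> \int[U]_u ratio t u.
  apply: (@Rint_bcvg _ _ _ _ ufin (fun n u => (1 - e n%:R u) * ratio t u) _ (t + 1)).
  - by move=> n; case: (bS n).
  - move=> n u; have en1 : e n%:R u <= 1 by rewrite expR_le1 oppr_le0 mulr_ge0// ltW.
    rewrite normrM ger0_norm ?subr_ge0// [X in _ * X]ger0_norm ?ratio_ge0//.
    rewrite (le_trans _ (ratio_le u t0))// ler_piMl ?ratio_ge0// gerBl.
    exact: expR_ge0.
  - move=> u; rewrite -[X in _ --> X]mul1r; apply: cvgM; last exact: cvg_cst.
    rewrite -[X in _ --> X]subr0; apply: cvgB; first exact: cvg_cst.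
    rewrite (_ : (fun n => e n%:R u) = fun n => (e 1 u) ^+ n).
      by apply: cvg_expr; rewrite ger0_norm ?expR_ge0.
    by apply/funext => n; rewrite /e -expRM_natl; congr expR; ring.
have c2 : \int[U]_u ((1 - e n%:R u) * ratio t u) @[n --> \oo] --> psi t - 0.
  rewrite (_ : (fun n => _) = fun n => psi t - (psi (n%:R + t) - psi n%:R)).
    by apply: cvgB; [exact: cvg_cst|exact: psi_incr].
  by apply/funext.
by rewrite (cvg_unique (@norm_hausdorff _ R) c1 c2) subr0.
Qed.

Variables (m alpha : R).
Hypotheses (m0 : 0 < m) (a0 : 0 < alpha).
Hypothesis psi_scale : forall t : R, 0 <= t -> psi (m * t) = m `^ alpha * psi t.

Let kappa (x : R) : R := x `^ alpha / (1 - expR (- x)).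
Let kappa_gt0 x : 0 < x -> 0 < kappa x.
Proof. by move=> x0; rewrite divr_gt0 ?powR_gt0// subr_gt0 expR_lt1 oppr_lt0. Qed.

Let mkappa : measurable_fun setT (kappa : mR -> R).
Proof.
apply: measurable_funM; first exact: measurable_powR.
by apply: (measurableT_comp measurable_invr); apply: measurable_funB => //; apply: measurableT_comp.
Qed.

Let mkX : measurable_fun setT (fun u : mR => kappa (X u)).
Proof. exact: (measurableT_comp mkappa mX). Qed.

Let kX0 u : 0 <= kappa (X u).
Proof. exact/ltW/kappa_gt0. Qed.

Definition levy : {measure set mR -> \bar R} := wlaw U mX mkX kX0.

Lemma integral_levy (g : R -> R) : measurable_fun setT (g : mR -> R) ->
  (forall x, 0 < x -> 0 <= g x) ->
  (\int[levy]_(x in `]0%R, +oo[) (g x)%:E = \int[U]_u (g (X u) * kappa (X u))%:E)%E.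
Proof.
move=> mg g0; rewrite integral_mkcond ge0_integral_wlaw.
- apply: eq_integral => u _; rewrite patchE mem_set ?EFinM//=.
  by rewrite in_itv/= andbT.
- by apply/(measurable_restrictT _ _).1 => //; apply/measurable_EFinP/measurable_funTS.
- move=> x; rewrite patchE; case: ifPn => // /set_mem; rewrite /= in_itv/= andbT => x0.
  by rewrite lee_fin g0.
Qed.

Lemma levy_normalized : normalized alpha levy.
Proof.
rewrite /normalized integral_levy.
- transitivity (\int[U]_u (1 : R)%:E)%E; last by rewrite (Rint_EFin ufin (bmeas_cst 1)) Rint_prob_cst.
  apply: eq_integral => u _; congr (_%:E); rewrite /kappa.
  have a1 : 1 - expR (- X u) != 0 by rewrite gt_eqF// subr_gt0 expR_lt1 oppr_lt0.
  have a2 : X u `^ alpha != 0 by rewrite gt_eqF// powR_gt0.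
  by field; rewrite a1 a2.
- apply: measurable_funM; last exact: (measurableT_comp measurable_invr (measurable_powR alpha)).
  by apply: measurable_funB => //; apply: measurableT_comp.
- by move=> x x0; rewrite divr_ge0 ?powR_ge0// subr_ge0 expR_le1 oppr_le0 ltW.
Qed.

Lemma integral_levy_exp (t : R) : 0 <= t <= 1 ->
  (\int[levy]_(x in `]0%R, +oo[) ((expR (- t * x) - expR (- x)) * (1 / x `^ alpha))%:E =
   (1 - psi t)%:E)%E.
Proof.
move=> /andP[t0 t1]; rewrite integral_levy.
- have b : bmeas (fun u : mR => 1 - ratio t u).
    by apply: bmeasB; [exact: bmeas_cst|exact: bmeas_ratio].
  rewrite -(Rint_ratio t0) -[X in X - _](Rint_prob_cst U 1).
  rewrite -(RintB ufin (bmeas_cst 1) (bmeas_ratio t0)) -(Rint_EFin ufin b).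
  apply: eq_integral => u _; congr (_%:E); rewrite /kappa /ratio /e [1 * X u]mul1r mulNr.
  have a1 : 1 - expR (- X u) != 0 by rewrite gt_eqF// subr_gt0 expR_lt1 oppr_lt0.
  have a2 : X u `^ alpha != 0 by rewrite gt_eqF// powR_gt0.
  move: (expR (- X u)) (X u `^ alpha) (expR (- (t * _))) a1 a2 => x y z a1 a2.
  by field; rewrite a1 a2.
- apply: measurable_funM.
    apply: measurable_funB; last by apply: measurableT_comp.
    by apply: measurableT_comp => //; exact: measurable_funM.
  apply: measurable_funM => //.
  exact: (measurableT_comp measurable_invr (measurable_powR alpha)).
- move=> x x0; rewrite mulr_ge0 ?divr_ge0 ?powR_ge0// subr_ge0 ler_expR mulNr lerN2.
  by rewrite ler_piMl// ltW.
Qed.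

(** A compact K inside (0, oo) lies between some a > 0 and some b, where [kappa] is at most b^alpha
    / (1 - exp(-a)). *)
Lemma levy_locally_finite : locally_finite levy.
Proof.
move=> K cK K0; have clK : closed K by apply: compact_closed => //; exact: norm_hausdorff.
have mK : measurable (K : set mR) by exact: closed_measurable.
have mXK : measurable (X @^-1` K : set mR) by rewrite -[X in measurable X]setTI; exact: mX.
have [a a0' aK] : exists2 a : R, 0 < a & forall x, K x -> a <= x.
  have : (~` K) 0 by move=> /K0; rewrite /= in_itv/= ltxx.
  have oK : open (~` K) by exact: closed_openC.
  rewrite openE in oK => /oK /nbhs_ballP[a /= a00 aK]; exists a => // x Kx.
  have /= := K0 x Kx; rewrite in_itv/= andbT => x0.
  rewrite leNgt; apply/negP => xa; apply: (aK x _ Kx).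
  by rewrite /ball/= sub0r normrN gtr0_norm.
have [b Kb] : exists b : R, forall x, K x -> x <= b.
  have [b [_ /(_ (b + 1)) Hb]] := compact_bounded cK.
  exists (b + 1) => x Kx; rewrite (le_trans (ler_norm x))// Hb// ltrDl//.
pose C := b `^ alpha / (1 - expR (- a)).
apply: (@le_lt_trans _ _ (\int[U]_(u in X @^-1` K) (C%:E))%E); last first.
  by rewrite integral_cst//= ltey_eq fin_numM// fin_num_measure.
apply: ge0_le_integral => //.
- by move=> u _; rewrite lee_fin.
- by apply/measurable_EFinP/measurable_funTS.
- move=> u Ku; have ax := aK _ Ku; have xb := Kb _ Ku.
  have ea : 0 < 1 - expR (- a) by rewrite subr_gt0 expR_lt1 oppr_lt0.
  have ex : 0 < 1 - expR (- X u) by rewrite subr_gt0 expR_lt1 oppr_lt0.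
  rewrite lee_fin /kappa /C ler_pM ?powR_ge0 ?invr_ge0 ?(ltW ex)//.
    apply: (ge0_ler_powR (ltW a0)) => //; rewrite nnegrE; first exact: ltW.
    by rewrite (le_trans _ xb)// ltW.
  by rewrite lef_pV2// lerD2l lerN2 ler_expR lerN2.
Qed.

(** The law of X with weight 1 is compared with that of X / m with weight m^alpha [ratio m^-1].
    Multiplied by [kappa], the first is [levy] and the second its image under division by m. Their
    moments of exp(-x) agree by psi(m t) = m^alpha psi(t), and these moments determine the law. *)
Lemma levy_scale_invariant : scale_invariant m levy.
Proof.
have mi : 0 < m^-1 by rewrite invr_gt0.
pose X' u := X u / m.
have mX' : measurable_fun setT (X' : mR -> mR) by exact: measurable_funM.
pose k u := m `^ alpha * ratio m^-1 u.
have bk : bmeas (k : mR -> R) by apply: bmeasM; [exact: bmeas_cst|exact/bmeas_ratio/ltW].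
have k0 u : 0 <= k u by rewrite mulr_ge0 ?powR_ge0// ratio_ge0// ltW.
have bp := same_law_bp_closed ufin ufin mX mX' (bmeas_cst 1) bk.
(* The maximum bounds [yy] on the whole line; at the positive values of X and X / m it is
   exp(-x). *)
pose yy (x : R) : R := expR (- Num.max x 0).
have yy01 x : 0 <= yy x <= 1 by rewrite expR_ge0/= expR_le1 oppr_le0 le_max lexx orbT.
have by_ : bmeas (yy : mR -> R).
  split; last by exists 1 => x; have /andP[y0 y1] := yy01 x; rewrite ger0_norm.
  by apply: measurableT_comp => //; apply: measurableT_comp => //; exact: measurable_maxr.
have mom j : same_law U U X (fun=> 1) X' k (fun x => 1 * yy x ^+ j).
  split.
    apply: bmeasM; first exact: bmeas_cst.
    elim: j => [|j IH]; first by under eq_fun do rewrite expr0; exact: bmeas_cst.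
    by under eq_fun do rewrite exprS; exact: bmeasM.
  have j0 : (0 : R) <= j%:R by [].
  have jm0 : 0 <= j%:R / m by rewrite divr_ge0// ltW.
  have jm1 : 0 <= j%:R / m + m^-1 by rewrite addr_ge0// ltW.
  transitivity (\int[U]_u e j%:R u).
    apply: eq_Rintegral => u _; rewrite mul1r mulr1 /yy max_l ?(ltW (X0 u))//.
    by rewrite -expRM_natl mulrN.
  rewrite momX//.
  transitivity (\int[U]_u (m `^ alpha * (ratio (j%:R / m + m^-1) u - ratio (j%:R / m) u))); last first.
    apply: eq_Rintegral => u _; rewrite -ratioD /k mul1r mulrCA; congr (_ * _).
    rewrite /yy max_l; last by rewrite divr_ge0// ltW// X0.
    by rewrite -expRM_natl /e; congr expR; rewrite /X'; ring.
  rewrite (RintZ ufin _ (bmeasB (bmeas_ratio jm1) (bmeas_ratio jm0))).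
  rewrite (RintB ufin (bmeas_ratio jm1) (bmeas_ratio jm0)) !Rint_ratio// mulrBr -!psi_scale//.
  by congr (psi _ - psi _); field; rewrite gt_eqF.
have sl1 : same_law U U X (fun=> 1) X' k (fun=> 1).
  by have := mom 0%N; congr same_law; apply/funext => x; rewrite expr0 mulr1.
have H : forall g : mR -> R, bmeas g -> same_law U U X (fun=> 1) X' k g.
  apply: (same_law_rays ufin ufin mX mX' (bmeas_cst 1) bk sl1) => a.
  (* For a > 0 the ray is the set where [yy] is below exp(-a), within reach of the powers of [yy];
     for a <= 0 it carries the whole law. *)
  have [a0'|a0'] := ltP 0 a.
    have w01 (x : R) : 0 <= (1 : R) <= 1 by rewrite ler01 lexx.
    have := bp_indic_lt bp (expR_gt0 (- a)) w01 yy01 mom; congr same_law; apply/funext => x.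
    by rewrite mul1r indicE mem_setE in_itv/= andbT ltr_expR ltrN2 lt_max [a < 0]ltNge (ltW a0') orbF.
  split; first exact: bmeas_indic.
  have ray (x : R) : 0 < x -> \1_(`]a, +oo[%classic : set R) x = 1 :> R.
    by move=> x0; rewrite indicE mem_setE in_itv/= andbT (le_lt_trans a0').
  transitivity (\int[U]_u (1 * 1 : R)); first by apply: eq_Rintegral => u _; rewrite ray.
  by rewrite sl1.2; apply: eq_Rintegral => u _; rewrite ray// divr_gt0.
have kE u : kappa (X' u) * k u = kappa (X u).
  have d1 : 1 - expR (- X u) != 0 by rewrite gt_eqF// subr_gt0 expR_lt1 oppr_lt0.
  have d2 : 1 - expR (- X' u) != 0 by rewrite gt_eqF// subr_gt0 expR_lt1 oppr_lt0 divr_gt0.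
  have XE : X u `^ alpha = X' u `^ alpha * m `^ alpha.
    by rewrite -powRM ?divr_ge0 ?ltW// /X' divfK// gt_eqF.
  rewrite /kappa /k /ratio XE /e [m^-1 * _]mulrC -/(X' u) [1 * X u]mul1r.
  move: (expR (- X u)) (expR (- X' u)) (X' u `^ alpha) (m `^ alpha) d1 d2 => a b c f d1 d2.
  by field; rewrite d1 d2.
have wE (Y w : R -> R) (mY : measurable_fun setT (Y : mR -> mR)) (bw : bmeas (w : mR -> R))
    (w0 : forall u, 0 <= w u) (B : set mR) : measurable B ->
    wlaw U mY bw.1 w0 B = (\int[U]_u (\1_B (Y u) * w u))%:E.
  move=> mB; rewrite /wlaw integral_mkcond -Rint_EFin//; last first.
    exact: (bmeas_wcomp mY bw (bmeas_indic R mB)).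
  apply: eq_integral => u _; rewrite patchE indicE.
  have [uB|uB] := boolP (u \in _); first by rewrite mem_set ?mul1r//; exact: (set_mem uB).
  by rewrite memNset ?mul0r// => Bu; move/negP: uB; apply; exact: mem_set.
have one0 (u : R) : 0 <= (1 : R) by [].
move=> B mB B0.
have fB0 x : (0 <= ((fun x => (kappa x)%:E) \_ B) x)%E.
  rewrite patchE; case: ifPn => // /set_mem/B0; rewrite /= in_itv/= andbT => x0.
  by rewrite lee_fin ltW// kappa_gt0.
have mfB : measurable_fun setT ((fun x : mR => (kappa x)%:E) \_ B).
  by apply/(measurable_restrictT _ _).1 => //; apply/measurable_EFinP/measurable_funTS.
transitivity (\int[wlaw U mX (bmeas_cst 1).1 one0]_x ((fun x => (kappa x)%:E) \_ B) x)%E.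
  rewrite ge0_integral_wlaw// /levy/= /wlaw integral_mkcond; apply: eq_integral => u _.
  by rewrite mule1 !patchE.
transitivity (\int[wlaw U mX' bk.1 k0]_x ((fun x => (kappa x)%:E) \_ B) x)%E.
  apply: eq_measure_integral => A mA _ /=.
  by rewrite !wE//; congr (_%:E); exact: (H _ (bmeas_indic R mA)).2.
rewrite ge0_integral_wlaw// /levy/= /wlaw integral_mkcond; apply: eq_integral => u _.
rewrite !patchE; have -> : (u \in X @^-1` ( *%R m @` B)) = (X' u \in B).
  apply/idP/idP => /set_mem uB; apply/mem_set.
    by case: uB => x Bx; rewrite /X' => <-; rewrite [m * x]mulrC mulfK ?gt_eqF.
  by exists (X' u) => //; rewrite /X' mulrC divfK// gt_eqF.
by case: ifP => _; [rewrite -EFinM kE|exact: mul0e].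
Qed.

End LevyMeasure.

(** * The scaling limit psi of a concave function L *)

Section ScalingLimit.
Variable R : realType.
Variables (L : R -> R) (m lam b : R) (I : Type) (A r : I -> R).
Hypotheses (L00 : L 0 = 0) (L0 : forall s : R, 0 <= s -> 0 <= L s).
Hypothesis Lnd : forall s t : R, 0 <= s -> s <= t -> L s <= L t.
Hypothesis Lratio : forall s t : R, 0 < s -> s <= t -> s * L t <= t * L s.
Hypotheses (m0 : 0 < m) (mlam : m < lam) (lam1 : lam < 1) (b0 : 0 < b).
Hypotheses (A0 : forall i, 0 <= A i) (r0 : forall i, 0 <= r i) (rb : forall i, r i <= b).
Hypothesis upper : forall i (e : R), 0 < e ->
  \forall n \near \oo, lam ^+ n * A i <= L (m ^+ n * (r i + e)).
Hypothesis lower : forall i (e : R), 0 < e -> e <= r i ->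
  \forall n \near \oo, L (m ^+ n * (r i - e)) <= lam ^+ n * A i.
Hypothesis onto : forall t : R, 0 < t < 1 -> exists i, r i = b * t.
Variable top_ : nat -> I.
Hypotheses (r_top : r (top_ j) @[j --> \oo] --> b) (A_top : A (top_ j) @[j --> \oo] --> (1 : R)).

Let lam0 : 0 < lam. Proof. exact: lt_trans mlam. Qed.
Let m1 : m < 1. Proof. exact: lt_trans lam1. Qed.

(** In the application [I] is the set of test functions h, [A] is 1 - G_Q[h], [r] is rate h, [b] is
    rate 0, and [top_] lists the constants [small j]. *)
Let Psi n (t : R) : R := lam ^- n * L (m ^+ n * (b * t)).

Let Psi_nd n (s t : R) : 0 <= s -> s <= t -> Psi n s <= Psi n t.
Proof.
move=> s0 st; have bm : 0 <= m ^+ n by rewrite exprn_ge0// ltW.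
rewrite ler_pM2l ?invr_gt0 ?exprn_gt0//; apply: Lnd.
  by rewrite !mulr_ge0// ltW.
by rewrite ler_wpM2l// ler_pM2l.
Qed.

Let Psi_ratio n (s t : R) : 0 < s -> s <= t -> s * Psi n t <= t * Psi n s.
Proof.
move=> s0 st; rewrite /Psi !(mulrCA _ (lam ^- n)) ler_pM2l ?invr_gt0 ?exprn_gt0//.
have bm : 0 < m ^+ n * b by rewrite mulr_gt0// exprn_gt0.
have := @Lratio (m ^+ n * b * s) (m ^+ n * b * t); rewrite mulr_gt0// ler_pM2l// => /(_ isT st).
by rewrite -!mulrA ler_pM2l ?exprn_gt0// ler_pM2l.
Qed.

(** [upper] and [lower] bound A through L at r + e and r - e; concavity moves both arguments to r at
    relative cost e / r. *)
Let cvg_Psi_r i : 0 < r i -> Psi n (r i / b) @[n --> \oo] --> A i.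
Proof.
move=> x0; apply/cvgrPdist_le => /= eps eps0.
have d0 : 0 < 2 * A i + 1 by rewrite ltr_wpDl// mulr_ge0.
(* e <= r / 2 gives [Psi] <= 2 A, and then e (2 A) <= eps r keeps the error e [Psi] / r below eps;
   the added 1 avoids a zero denominator. *)
pose e := Num.min (r i / 2) (eps * r i / (2 * A i + 1)).
have e0 : 0 < e by rewrite lt_min !divr_gt0// mulr_gt0.
have e2 : e <= r i / 2 by rewrite ge_min lexx.
have eA : e * (2 * A i) <= eps * r i.
  apply: (@le_trans _ _ (e * (2 * A i + 1))); first by rewrite ler_pM2l// lerDl.
  by rewrite -ler_pdivlMr// ge_min lexx orbT.
have er : e <= r i by lra.
have bE : b * (r i / b) = r i by rewrite mulrCA divff ?mulr1// gt_eqF.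
near=> n.
have ln : 0 < lam ^+ n by rewrite exprn_gt0.
have mn : 0 < m ^+ n by rewrite exprn_gt0.
have h1 : lam ^+ n * A i <= L (m ^+ n * (r i + e)) by near: n; exact: upper.
have h2 : L (m ^+ n * (r i - e)) <= lam ^+ n * A i by near: n; exact: lower.
have h3 : r i * L (m ^+ n * (r i + e)) <= (r i + e) * L (m ^+ n * r i).
  have := @Lratio (m ^+ n * r i) (m ^+ n * (r i + e)).
  rewrite mulr_gt0// ler_pM2l// lerDl ltW// => /(_ isT isT).
  by rewrite -!mulrA ler_pM2l.
have h4 : (r i - e) * L (m ^+ n * r i) <= r i * L (m ^+ n * (r i - e)).
  have := @Lratio (m ^+ n * (r i - e)) (m ^+ n * r i).
  rewrite mulr_gt0 ?ler_pM2l// ?gerBl ?subr_gt0 ?(ltW e0); last by lra.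
  by move=> /(_ isT isT); rewrite -!mulrA ler_pM2l.
rewrite /Psi bE; move: h1 h2 h3 h4.
move: (L (m ^+ n * (r i + e))) (L (m ^+ n * (r i - e))) => l1 l2.
set l := L _ => h1 h2 h3 h4.
have lE : l = lam ^+ n * (lam ^- n * l) by rewrite mulrA divff ?mul1r// gt_eqF.
have P0 : 0 <= lam ^- n * l.
  by rewrite mulr_ge0// ?invr_ge0 ?(ltW ln)// /l L0// mulr_ge0// ltW.
move: (lam ^- n * l) lE P0 => p lE p0; rewrite lE in h3 h4.
have k1 : r i * A i <= (r i + e) * p.
  rewrite -(ler_pM2l ln) mulrCA (le_trans (ler_wpM2l (ltW x0) h1))//.
  by rewrite (le_trans h3)// mulrCA.
have k2 : (r i - e) * p <= r i * A i.
  rewrite -(ler_pM2l ln) mulrCA (le_trans h4)// mulrCA.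
  exact: (ler_wpM2l (ltW x0) h2).
have k3 : p <= 2 * A i.
  rewrite -(ler_pM2l x0).
  have : r i / 2 * p <= (r i - e) * p by rewrite ler_wpM2r//; lra.
  move: k2; lra.
have k4 : e * p <= eps * r i by rewrite (le_trans _ eA)// ler_pM2l.
rewrite ler_norml; apply/andP; split; rewrite -(ler_pM2l x0); lra.
Unshelve. all: by end_near.
Qed.

Let Psi_scale n t : Psi n (m * t) = lam * Psi n.+1 t.
Proof.
rewrite /Psi exprS invfM !mulrA divff ?mul1r ?gt_eqF//; congr (_ * L _).
by rewrite exprS; ring.
Qed.

(** [onto] reaches only t in (0, 1); [Psi_scale] passes from m t to t, so induction on k with m^k t
    < 1 covers all t > 0. *)
Let is_cvg_Psi (t : R) : 0 <= t -> exists l : R, Psi n t @[n --> \oo] --> l.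
Proof.
rewrite le_eqVlt => /predU1P[<-|t0].
  exists 0; rewrite (_ : Psi^~ 0 = fun=> 0); first exact: cvg_cst.
  by apply/funext => n; rewrite /Psi !mulr0 L00 mulr0.
have [k kt] : exists k, m ^+ k * t < 1.
  have : m ^+ k * t @[k --> \oo] --> 0 * t.
    by apply: cvgM; [apply: cvg_expr; rewrite ger0_norm// ltW|exact: cvg_cst].
  rewrite mul0r => /cvgr_lt/(_ _ ltr01)[k _ Hk].
  by exists k; apply: Hk => /=.
elim: k t t0 kt => [|k IH] t t0 kt.
  have [i ri] : exists i, r i = b * t by apply: onto; rewrite t0/=; rewrite mul1r in kt.
  exists (A i); have := @cvg_Psi_r i; rewrite ri mulrAC divff ?mul1r ?gt_eqF//.
  by apply; rewrite mulr_gt0.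
have [l cl] : exists l : R, Psi n (m * t) @[n --> \oo] --> l.
  by apply: IH; [rewrite mulr_gt0|rewrite mulrA -exprSr].
exists (lam^-1 * l); rewrite -cvg_shiftS.
rewrite (_ : (fun n => _) = fun n => lam^-1 * Psi n (m * t)).
  by apply: cvgM; [exact: cvg_cst|exact: cl].
by apply/funext => n /=; rewrite Psi_scale mulKf// gt_eqF.
Qed.

Let scaling_limit (t : R) : R := limn (Psi ^~ t).
Local Notation psi := scaling_limit.

Let cvg_scaling_limit t : 0 <= t -> lam ^- n * L (m ^+ n * (b * t)) @[n --> \oo] --> psi t.
Proof. by move=> t0; have [l cl] := is_cvg_Psi t0; apply/cvg_ex; exists l. Qed.

Let scaling_limit0 : psi 0 = 0.
Proof.
apply: (cvg_unique (@norm_hausdorff _ R) (cvg_scaling_limit (lexx 0))).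
rewrite (_ : (fun n => _) = fun=> 0); first exact: cvg_cst.
by apply/funext => n; rewrite !mulr0 L00 mulr0.
Qed.

Let ler_scaling_limit (s t : R) : 0 <= s -> s <= t -> psi s <= psi t.
Proof.
move=> s0 st; apply: (ler_cvg_to (cvg_scaling_limit s0) (cvg_scaling_limit (le_trans s0 st))).
by apply: nearW => n; exact: Psi_nd.
Qed.

Let psi_ratio (s t : R) : 0 < s -> s <= t -> s * psi t <= t * psi s.
Proof.
move=> s0 st; have t0 := lt_le_trans s0 st.
have c1 : s * Psi n t @[n --> \oo] --> s * psi t.
  by apply: cvgM; [exact: cvg_cst|exact: cvg_scaling_limit (ltW t0)].
have c2 : t * Psi n s @[n --> \oo] --> t * psi s.
  by apply: cvgM; [exact: cvg_cst|exact: cvg_scaling_limit (ltW s0)].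
by apply: (ler_cvg_to c1 c2); apply: nearW => n; exact: Psi_ratio.
Qed.

Let scaling_limitM t : 0 <= t -> psi (m * t) = lam * psi t.
Proof.
move=> t0; have mt0 : 0 <= m * t by rewrite mulr_ge0// ltW.
apply: (cvg_unique (@norm_hausdorff _ R) (cvg_scaling_limit mt0)).
rewrite (_ : (fun n => _) = fun n => lam * Psi n.+1 t).
  apply: cvgM; first exact: cvg_cst.
  by have := cvg_scaling_limit t0; rewrite -cvg_shiftS.
by apply/funext => n; rewrite -Psi_scale.
Qed.

Let scaling_limitXn k t : 0 <= t -> psi (m ^+ k * t) = lam ^+ k * psi t.
Proof.
elim: k t => [|k IH] t t0; first by rewrite !mul1r.
by rewrite exprSr -mulrA IH ?scaling_limitM ?mulrA -?exprSr// mulr_ge0// ltW.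
Qed.

Let cvg_lamXn (x : R) : lam ^+ k * x @[k --> \oo] --> 0.
Proof.
rewrite -(mul0r x); apply: cvgM; last exact: cvg_cst.
by apply: cvg_expr; rewrite ger0_norm// ltW.
Qed.

Let scaling_limit_at0 (e : R) : 0 < e -> exists2 s : R, 0 < s & psi s < e.
Proof.
move=> e0; have [k _ /(_ k (leqnn k))/= kE] := cvgr_lt _ (cvg_lamXn (psi 1)) _ e0.
exists (m ^+ k * 1); first by rewrite mulr1 exprn_gt0.
by rewrite scaling_limitXn.
Qed.

Let scaling_limitE i : A i = psi (r i / b).
Proof.
have [ri|ri] := ltP 0 (r i).
  apply: (cvg_unique (@norm_hausdorff _ R) (cvg_Psi_r ri)).
  by apply: cvg_scaling_limit; rewrite divr_ge0// ltW.
have -> : r i = 0 by apply/eqP; rewrite eq_le ri r0.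
(* A zero rate is out of reach of [cvg_Psi_r]: [upper] with e = b s bounds A by psi(s) for s > 0,
   and psi is small near 0. *)
rewrite mul0r scaling_limit0; apply/eqP; rewrite eq_le A0 andbT.
apply/ler_addgt0Pr => e e0; rewrite add0r.
have [s s0 se] := scaling_limit_at0 e0.
apply: le_trans (ltW se).
apply: (limr_ge (cvgP _ (cvg_scaling_limit (ltW s0)))).
have bs0 : 0 < b * s by rewrite mulr_gt0.
apply: filterS (upper i bs0) => n /=.
have -> : r i = 0 by apply/eqP; rewrite eq_le ri r0.
by rewrite add0r /Psi ler_pdivlMl ?exprn_gt0.
Qed.

Let scaling_limit1 : psi 1 = 1.
Proof.
have c1 : r (top_ j) * psi 1 @[j --> \oo] --> b * psi 1.
  by apply: cvgM; [exact: r_top|exact: cvg_cst].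
have c2 : b * A (top_ j) @[j --> \oo] --> b * 1.
  by apply: cvgM; [exact: cvg_cst|exact: A_top].
apply/eqP; rewrite eq_le; apply/andP; split.
  rewrite -(ler_pM2l b0); apply: (ler_cvg_to c1 c2).
  have near_pos : \forall j \near \oo, 0 < r (top_ j) by exact: cvgr_gt _ r_top _ b0.
  apply: filterS near_pos => j rj; rewrite scaling_limitE.
  have rj1 : r (top_ j) / b <= 1 by rewrite ler_pdivrMr// mul1r.
  have := psi_ratio (divr_gt0 rj b0) rj1.
  by rewrite mulrAC ler_pdivrMr// mul1r mulrC [leRHS]mulrC.
have c3 : psi 1 @[j --> \oo] --> psi 1 by exact: cvg_cst.
apply: (ler_cvg_to A_top c3); apply: nearW => j.
rewrite scaling_limitE; apply: ler_scaling_limit; first by rewrite divr_ge0// ltW.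
by rewrite ler_pdivrMr// mul1r.
Qed.

(** At T = m^-k the ratio psi(T) / T is (m / lam)^k, which is small since m < lam, and psi(t) / t is
    nonincreasing. *)
Let scaling_limit_sublinear (e : R) : 0 < e -> \forall n \near \oo, psi n%:R <= e * n%:R.
Proof.
move=> e0; have [k mk] : exists k, (m / lam) ^+ k <= e.
  have : (m / lam) ^+ k @[k --> \oo] --> (0 : R).
    by apply: cvg_expr; rewrite ger0_norm ?divr_ge0 ?ltW// ltr_pdivrMr ?mul1r.
  move=> /cvgr_le/(_ _ e0)[k _ Hk].
  by exists k; apply: Hk => /=.
have mk0 : 0 < m ^+ k by rewrite exprn_gt0.
have T0 : 0 < (m ^+ k)^-1 by rewrite invr_gt0.
have psiT : psi (m ^+ k)^-1 = (lam ^+ k)^-1.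
  have := scaling_limitXn k (ltW T0); rewrite divff ?gt_eqF// scaling_limit1 => H.
  by rewrite -[LHS](mulKf (lt0r_neq0 (exprn_gt0 k lam0))) -H mulr1.
near=> n; have nT : (m ^+ k)^-1 <= n%:R by near: n; exact: nbhs_infty_ger.
have := psi_ratio T0 nT; rewrite psiT ler_pdivrMl// => /le_trans; apply.
rewrite mulrCA mulrC ler_wpM2r// -expr_div_n//.
Unshelve. all: by end_near.
Qed.

(** [psi_ratio] reads n (psi(n + t) - psi(n)) <= t psi(n), and psi(n) = o(n). *)
Let scaling_limit_incr (t : R) : 0 <= t -> psi (n%:R + t) - psi n%:R @[n --> \oo] --> 0.
Proof.
move=> t0; apply/cvgrPdist_le => /= e e0.
have t10 : 0 < t + 1 by rewrite ltr_wpDl.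
near=> n; have n0 : 0 < n%:R :> R by near: n; exact: nbhs_infty_gtr.
have nt : n%:R <= n%:R + t by rewrite lerDl.
rewrite sub0r normrN ger0_norm ?subr_ge0 ?ler_scaling_limit//.
have h1 := psi_ratio n0 nt.
have h2 : psi n%:R <= e / (t + 1) * n%:R.
  by near: n; apply: scaling_limit_sublinear; rewrite divr_gt0.
rewrite -(ler_pM2l n0).
apply: (@le_trans _ _ (t * psi n%:R)); first by lra.
have h3 : t * psi n%:R <= t * (e / (t + 1) * n%:R) by rewrite ler_wpM2l.
apply: (le_trans h3); rewrite !mulrA mulrC ler_pM2l// ler_pdivrMr// mulrDr mulr1 mulrC lerDl.
exact: ltW.
Unshelve. all: by end_near.
Qed.

Lemma ex_scaling_limit : exists psi : R -> R,
  [/\ psi 0 = 0, psi 1 = 1,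
      forall t, 0 <= t -> lam ^- n * L (m ^+ n * (b * t)) @[n --> \oo] --> psi t &
      forall t, 0 <= t -> psi (m * t) = lam * psi t] /\
  [/\ forall s t : R, 0 <= s -> s <= t -> psi s <= psi t,
      forall e : R, 0 < e -> exists2 s : R, 0 < s & psi s < e,
      forall t : R, 0 <= t -> psi (n%:R + t) - psi n%:R @[n --> \oo] --> 0 &
      forall i, A i = psi (r i / b)].
Proof.
exists psi; split; split.
- exact: scaling_limit0.
- exact: scaling_limit1.
- exact: cvg_scaling_limit.
- exact: scaling_limitM.
- exact: ler_scaling_limit.
- exact: scaling_limit_at0.
- exact: scaling_limit_incr.
- exact: scaling_limitE.
Qed.

End ScalingLimit.

(** * The mixture representation for alpha in (0, 1) *)

Section SmallEigenvalue.
Variables (R : realType) (p : probability nat R).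
Variable P : R.-pker (measurableTypeR R) ~> (measurableTypeR R).
Hypothesis C1p : C1 p.
Local Notation mR := (measurableTypeR R).
Local Notation G := (gen_op p P).
Local Notation m := (offspring_mean p).
Variables (d : measure_display) (Omega : measurableType d).
Variable PP : pointMeasure R -> probability Omega R.
Variable Z : nat -> {mfun Omega >-> pointMeasure R}.
Hypothesis bmc : branching_markov_chain p P PP Z.
Variables (pi : probability mR R).
Hypothesis C4pi : forall h : R -> R, measurable_fun setT (h : mR -> R) ->
  (forall x, 0 <= h x) -> (exists M : R, forall x, h x <= M) ->
  forall e : R, 0 < e -> \forall n \near \oo, forall x : R,
    `| \int[nstep P n x]_y h y - \int[pi]_y h y | < e.
Local Notation rate := (rate p P pi).
Variable Qmin : probability (pointMeasure R) R.
Hypothesis yaglom : yaglom_limit PP Z Qmin.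

Lemma rate_Qmin h : V0 h -> rate h / rate (fun=> 0) = 1 - pgfl Qmin h.
Proof. by move=> Vh; rewrite (pgfl_Qmin C1p bmc C4pi yaglom Vh) subKr. Qed.

Lemma rate_le h : V0 h -> rate h <= rate (fun=> 0).
Proof.
move=> Vh; have r0 := rate0_gt0 C1p C4pi; rewrite -[leRHS]mul1r -ler_pdivrMr//.
rewrite rate_Qmin//; have /andP[q0 _] := pgfl_bounds Qmin Vh.
by move: (pgfl _ _) q0 => x x0; rewrite gerBl.
Qed.

Lemma cvg_rate_small : rate (fun=> small R j) @[j --> \oo] --> rate (fun=> 0).
Proof.
by apply: (cvg_rate C1p C4pi) => // [j|x]; [exact/V0_unit_fun/V0_small|exact: cvg_small].
Qed.

(** Constants suffice: along exp(-|s|) the rate is continuous, 0 at s = 0, and close to [rate 0] for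
    large s. The absolute value keeps the path in [V0] on the whole line. *)
Lemma rate_onto (t : R) : 0 < t < 1 -> exists2 h, V0 h & rate h = rate (fun=> 0) * t.
Proof.
move=> /andP[t0 t1]; have r0 := rate0_gt0 C1p C4pi.
pose h (s : R) := fun _ : mR => expR (- `|s|).
have Vh s : V0 (h s) by apply: V0_expRN; exact: normr_ge0.
pose g (s : R) : R := rate (h s).
have cg : continuous g.
  move=> s; apply/(@cvg_nbhsP R R^o) => u us; apply: (cvg_rate C1p C4pi) => [n|y].
    exact: V0_unit_fun.
  apply: continuous_cvg; first exact: continuous_expR.
  by apply: cvgN; apply: cvg_norm.
have g0 : g 0 = 0.
  have h0E : h 0 = fun=> 1 by apply/funext => y; rewrite /h normr0 oppr0 expR0.
  rewrite /g; have := rate_Qmin (Vh 0); rewrite h0E pgfl1 subrr => /eqP.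
  by rewrite mulf_eq0 invr_eq0 [X in _ || X]gt_eqF// orbF => /eqP.
have tr : rate (fun=> 0) * t < rate (fun=> 0) by rewrite gtr_pMr.
have [j _ /(_ j (leqnn j))/= Hj] := cvgr_gt _ cvg_rate_small _ tr.
pose s := - ln (small R j).
have s0 : 0 <= s by rewrite oppr_ge0 ln_le0// small_le1.
have gs : g s = rate (fun=> small R j).
  congr rate; apply/funext => y; rewrite /h ger0_norm// opprK lnK// posrE.
  exact: small_gt0.
have [||c _ gc] := @IVT R g 0 s (rate (fun=> 0) * t) s0.
- by apply: continuous_subspaceT => x; exact: cg.
- rewrite g0 gs ge_min le_max (ltW Hj) orbT andbT; apply/orP; left.
  by rewrite mulr_ge0// ltW.
by exists (h c).
Qed.

Variables (Q : probability (pointMeasure R) R) (alpha : R).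
Hypotheses (Q1 : prob_on_nonnull Q) (a0 : 0 < alpha) (a1 : alpha < 1).

Lemma powR_mean_bounds : m < m `^ alpha < 1.
Proof.
have m0 := mean_gt0 C1p; have m1 := mean_lt1 C1p.
apply/andP; split.
  rewrite -[X in X < _](powRr1 (ltW m0)) /powR gt_eqF// ltr_expR.
  by rewrite ltr_nM2r// ln_lt0// m0.
by rewrite /powR gt_eqF// -expR0 ltr_expR pmulr_rlt0// ln_lt0// m0.
Qed.

Lemma eigen_mixture : pgfl_eigen p P Q (m `^ alpha) ->
  exists D : {measure set mR -> \bar R},
    [/\ locally_finite D, scale_invariant m D, normalized alpha D
      & forall h : R -> R, V0 h ->
        ((pgfl Q h)%:E = \int[D]_(x in `]0%R, +oo[)
          ((expR ((pgfl Qmin h - 1) * x) - expR (- x)) * (1 / x `^ alpha))%:E)%E].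
Proof.
move=> E; have m0 := mean_gt0 C1p; have /andP[mlam lam1] := powR_mean_bounds.
have b0 := rate0_gt0 C1p C4pi.
have lam0 : 0 < m `^ alpha by rewrite powR_gt0.
pose I := {h : R -> R | V0 h}.
pose A (i : I) : R := 1 - pgfl Q (sval i); pose r (i : I) : R := rate (sval i).
pose top_ j : I := exist _ _ (V0_small R j).
have [|i|i|i|i e e0|i e e0 er|t t01|||psi] :=
    @ex_scaling_limit R (lap Q) m (m `^ alpha) (rate (fun=> 0)) I A r
      _ (@lap_ge0 R Q) (@ler_lap R Q) (@lap_ratio R Q) m0 mlam lam1 b0 _ _ _ _ _ _ top_.
- by rewrite lapE//; under eq_Rintegral do rewrite mul0r oppr0 expR0 subrr; rewrite Rint_prob_cst.
- by rewrite /A subr_ge0; case/andP: (pgfl_bounds Q (svalP i)).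
- have Vi : V0 (sval i) := svalP i; exact: (rate_ge0 P C1p pi (V0_unit_fun Vi)).
- exact: (rate_le (svalP i)).
- exact: (pgfl_le_lap C1p C4pi E (svalP i) e0).
- exact: (lap_le_pgfl C1p C4pi E (svalP i) e0 er).
- by have [h Vh rh] := rate_onto t01; exists (exist _ h Vh).
- exact: cvg_rate_small.
- have c : 1 - pgfl Q (fun=> small R j) @[j --> \oo] --> (1 : R) - 0.
    by apply: cvgB; [exact: cvg_cst|exact: prob_on_nonnull_small].
  by rewrite subr0 in c.
move=> [[psi0 psi1 cpsi psiM] [psi_nd psi_at0 psi_incr psiE]].
pose x_ n (mu : pointMeasure R) : R := m ^+ n * rate (fun=> 0) * mass mu.
have mx n : measurable_fun setT (x_ n).
  by apply: measurable_funM => //; exact: measurable_mass.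
have x0 n mu : 0 <= x_ n mu.
  by rewrite !mulr_ge0 ?exprn_ge0 ?mass_ge0 ?(ltW m0) ?(ltW b0).
have c0 n : 0 <= (m `^ alpha) ^- n by rewrite invr_ge0 exprn_ge0// ltW.
have cPsi (s : R) : 0 <= s -> (m `^ alpha) ^- n * \int[Q]_mu (1 - expR (- (s * x_ n mu))) @[n --> \oo] --> psi s.
  move=> s0; rewrite (_ : (fun n => _) = fun n => (m `^ alpha) ^- n * lap Q (m ^+ n * (rate (fun=> 0) * s))).
    exact: cpsi.
  apply/funext => n; rewrite lapE; last by rewrite !mulr_ge0 ?exprn_ge0 ?(ltW m0) ?(ltW b0).
  congr (_ * _); apply: eq_Rintegral => mu _; congr (1 - expR (- _)).
  by rewrite /x_; move: (rate _) => b; ring.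
have psi_diff (e : R) : 0 < e -> exists2 s : R, 0 < s & psi (s + 1) - psi s < e.
  move=> e0; have [n _ Hn] := cvgr_lt _ (psi_incr 1 ler01) _ e0.
  by exists n.+1%:R; [rewrite ltr0n|exact: (Hn n.+1 (leqnSn n))].
have [X [mX X0 mom]] := ex_limit_law (prob_fin Q) mx x0 c0 cPsi psi1 psi_nd psi_at0 psi_diff.
exists (levy mX X0 alpha); split.
- exact: levy_locally_finite.
- exact: (levy_scale_invariant mX X0 mom psi0 psi_incr m0 psiM).
- exact: levy_normalized.
move=> h Vh; have /andP[q0 q1] := pgfl_bounds Qmin Vh.
have t01 : 0 <= 1 - pgfl Qmin h <= 1.
  by move: (pgfl _ _) q0 q1 => x x0' x1; rewrite subr_ge0 x1 gerBl.
have := integral_levy_exp mX X0 mom psi0 psi_incr alpha t01; rewrite opprB => ->; congr (_%:E).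
have := psiE (exist _ h Vh); rewrite /A /r/= rate_Qmin// => <-.
by rewrite subKr.
Qed.

End SmallEigenvalue.

(** * Scale-invariant mixtures satisfy the eigenvalue equation *)

Section LaplaceScaling.
Variable R : realType.
Local Notation mR := (measurableTypeR R).
Variables (D : {measure set mR -> \bar R}) (m alpha : R).
Hypotheses (m0 : 0 < m) (invD : scale_invariant m D) (normD : normalized alpha D).

Let integrand (t x : R) : R := (1 - expR (- (t * x))) / x `^ alpha.

Let measurable_integrand t : measurable_fun setT (integrand t : mR -> R).
Proof.
apply: measurable_funM; last exact: (measurableT_comp (@measurable_invr R) (measurable_powR alpha)).
apply: measurable_funB => //; apply: measurableT_comp => //; apply: measurableT_comp => //.
Qed.

Let integrand_ge0 t x : 0 <= t -> 0 < x -> 0 <= integrand t x.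
Proof.
move=> t0 x0; rewrite divr_ge0 ?powR_ge0// subr_ge0 expR_le1 oppr_le0.
by rewrite mulr_ge0// ltW.
Qed.

Let J (t : R) : \bar R := (\int[D]_(x in `]0%R, +oo[) (integrand t x)%:E)%E.

(** Substituting m x for x leaves [D] unchanged on (0, oo), turns t into m t and takes out the
    factor m^-alpha. *)
Let J_scale t : 0 <= t -> J (m * t) = ((m `^ alpha)%:E * J t)%E.
Proof.
move=> t0; have mm : measurable_fun setT ( *%R m : mR -> mR) by exact: measurable_funM.
have preE : *%R m @^-1` `]0, +oo[%classic = `]0, +oo[%classic :> set R.
  by apply/seteqP; split=> x /=; rewrite !in_itv/= !andbT pmulr_rgt0.
have JE : J t = (\int[D]_(x in `]0%R, +oo[) (integrand t (m * x))%:E)%E.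
  transitivity (\int[pushforward D ( *%R m : mR -> mR)]_(x in `]0%R, +oo[) (integrand t x)%:E)%E.
    apply: eq_measure_integral => A mA A0; rewrite /pushforward.
    have mA' : measurable ( *%R m @^-1` A : set mR).
      by rewrite -[X in measurable X]setTI; exact: mm.
    rewrite [RHS]invD//; last by rewrite -preE => x /= /A0.
    congr (D _); apply/seteqP; split => [x Ax|_ [x Ax <-]//].
    by exists (m^-1 * x); rewrite /= mulVKf// gt_eqF.
  rewrite ge0_integral_pushforward// ?preE//.
  - by apply/measurable_EFinP/measurable_funTS.
  - move=> x; rewrite inE /= in_itv/= andbT => x0.
    by rewrite lee_fin integrand_ge0.
have m_a : 0 < m `^ alpha by rewrite powR_gt0.
rewrite JE -ge0_integralZl//; last 3 first.
- by apply/measurable_EFinP/measurable_funTS; exact: (measurableT_comp (measurable_integrand t) mm).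
- move=> x; rewrite /= in_itv/= andbT => x0.
  by rewrite lee_fin integrand_ge0// mulr_gt0.
- by rewrite lee_fin ltW.
apply: eq_integral => x; rewrite inE /= in_itv/= andbT => x0.
rewrite -EFinM /integrand powRM ?(ltW m0) ?(ltW x0)//; congr (_%:E).
rewrite mulrA [t * m]mulrC.
have x_a : x `^ alpha != 0 by rewrite gt_eqF// powR_gt0.
by move: (expR _) => z; field; rewrite x_a gt_eqF.
Qed.

(** The mixture formula reads 1 - G_Q[h] = J(1 - G_Qmin[h]); G multiplies the argument by m, hence J
    by m^alpha. *)
Lemma mixture_pgfl_eigen p (P : R.-pker (measurableTypeR R) ~> (measurableTypeR R))
    (Q Qmin : probability (pointMeasure R) R) : C1 p -> m = offspring_mean p ->
  pgfl_eigen p P Qmin m ->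
  (forall h : R -> R, V0 h ->
    ((pgfl Q h)%:E = \int[D]_(x in `]0%R, +oo[)
      ((expR ((pgfl Qmin h - 1) * x) - expR (- x)) * (1 / x `^ alpha))%:E)%E) ->
  pgfl_eigen p P Q (m `^ alpha).
Proof.
move=> C1p mE Emin QE.
have JQ h : V0 h -> J (1 - pgfl Qmin h) = (1 - pgfl Q h)%:E.
  move=> Vh; have := QE h Vh; have /andP[] := pgfl_bounds Qmin Vh.
  move: (pgfl Qmin h) (pgfl Q h) => a c qa1 qa2 cE.
  have t0 : 0 <= 1 - a by rewrite subr_ge0.
  (* The mixture formula completes the integrand of J to that of [normalized]; the sum being 1, J is
     finite. *)
  have : (J (1 - a) + c%:E)%E = 1%E.
    rewrite cE -[RHS]normD -ge0_integralD//=.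
    - apply: eq_integral => x _; rewrite -EFinD; congr (_%:E).
      rewrite /integrand -mulNr opprB; move: (expR _) (expR _) => y z; ring.
    - by move=> x; rewrite in_itv/= andbT => x0; rewrite lee_fin integrand_ge0.
    - by apply/measurable_EFinP/measurable_funTS.
    - move=> x; rewrite in_itv/= andbT => x0; rewrite lee_fin mulr_ge0 ?divr_ge0 ?powR_ge0//.
      by rewrite subr_ge0 ler_expR mulrBl mul1r lerBrDr addrC subrr mulr_ge0// ltW.
    - apply/measurable_EFinP/measurable_funTS; apply: measurable_funM.
        by apply: measurable_funB; apply: measurableT_comp => //; exact: measurable_funM.
      apply: measurable_funM => //.
      exact: (measurableT_comp (@measurable_invr R) (measurable_powR alpha)).
  case: (J _) => //= r /eqP; rewrite -EFinD eqe => /eqP rc; congr (_%:E); lra.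
move=> h Vh; apply/EFin_inj; rewrite -JQ; last exact: V0_gen_op.
rewrite (Emin h Vh) J_scale; first by rewrite JQ.
by rewrite subr_ge0; case/andP: (pgfl_bounds Qmin Vh).
Qed.

End LaplaceScaling.

Theorem theorem2p12 (R : realType) (p : probability nat R)
    (P : R.-pker (measurableTypeR R) ~> (measurableTypeR R))
    (d : measure_display) (Omega : measurableType d)
    (PP : pointMeasure R -> probability Omega R)
    (Z : nat -> {mfun Omega >-> pointMeasure R})
    (Qmin : probability (pointMeasure R) R) :
  branching_markov_chain p P PP Z ->
  C1 p -> C2 p -> C4 P ->
  yaglom_limit PP Z Qmin ->
  [/\ (forall alpha : R, 1 < alpha ->
         ~ exists Q : probability (pointMeasure R) R,
             is_QSD_eigen p PP Z alpha Q),
      (forall Q : probability (pointMeasure R) R,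
         is_QSD_eigen p PP Z 1 Q <->
         forall B : set (pointMeasure R), measurable B -> Q B = Qmin B)
    & (forall (alpha : R) (Q : probability (pointMeasure R) R),
         0 < alpha < 1 -> prob_on_nonnull Q ->
         (is_QSD_eigen p PP Z alpha Q <->
          exists D : {measure set (measurableTypeR R) -> \bar R},
            [/\ locally_finite D,
                scale_invariant (offspring_mean p) D,
                normalized alpha D
              & forall h : R -> R, V0 h ->
                  ((pgfl Q h)%:E =
                   \int[D]_(x in `]0%R, +oo[)
                     ((expR ((pgfl Qmin h - 1) * x) - expR (- x))
                        * (1 / x `^ alpha))%:E)%E]))].
Proof.
move=> bmc C1p _ [pi C4pi] yaglom.
have m0 := mean_gt0 C1p; have m1 := mean_lt1 C1p.
have Emin : pgfl_eigen p P Qmin (offspring_mean p).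
  by move=> h Vh; exact: (pgfl_Qmin_gen_op C1p bmc C4pi yaglom Vh).
split.
- move=> alpha a1 [Q QE]; have E := QSD_eigen_pgfl C1p bmc QE.
  apply: (no_eigen_gt1 C1p C4pi QE.1.1 _ _ E); first by rewrite powR_gt0.
  rewrite -[ltRHS](powRr1 (ltW m0)) /powR gt_eqF// ltr_expR.
  by rewrite ltr_nM2r// ln_lt0// m0.
- move=> Q; split=> [QE|QQ].
    have E := QSD_eigen_pgfl C1p bmc QE; rewrite (powRr1 (ltW m0)) in E.
    exact: pgfl_unique (eigen_mean_unique C1p bmc C4pi yaglom QE.1.1 E).
  apply: (pgfl_eigen_QSD_eigen C1p bmc).
    by rewrite /prob_on_nonnull QQ; [exact: yaglom.1|exact: measurable_nonnull].
  rewrite (powRr1 (ltW m0)) => h Vh.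
  have QE g : pgfl Q g = pgfl Qmin g.
    by rewrite /pgfl /Rintegral; congr fine; apply: eq_measure_integral => A mA _; exact: QQ.
  by rewrite !QE; exact: Emin.
- move=> alpha Q /andP[a0 a1] Q1; split=> [QE|[D [_ invD normD QE]]].
    exact: (eigen_mixture C1p bmc C4pi yaglom Q1 a0 a1 (QSD_eigen_pgfl C1p bmc QE)).
  apply: (pgfl_eigen_QSD_eigen C1p bmc Q1).
  exact: (mixture_pgfl_eigen m0 invD normD C1p erefl Emin QE).
Qed.
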